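(* The left asymptotic tensor norm $\|\cdot\|_\lambda$ differs in general both from the minimal and from the maximal $C^*$-tensor norm, and the symmetric asymptotic tensor norm $\|\cdot\|_\sigma$ differs in general from the minimal one. That is: (1) there exist separable $C^*$-algebras $A$ and $D$ such that $\|\cdot\|_\lambda\neq\|\cdot\|_{\min}$ on the algebraic tensor product $A\odot D$; (2) there exist separable $C^*$-algebras $A$ and $D$ such that $\|\cdot\|_\lambda\neq\|\cdot\|_{\max}$ on $A\odot D$; (3) there exist separable $C^*$-algebras $A$ and $D$ such that $\|\cdot\|_\sigma\neq\|\cdot\|_{\min}$ on $A\odot D$.
   Context: $A\odot D$ is the algebraic tensor product; $\|\cdot\|_{\min}$, $\|\cdot\|_{\max}$ are the minimal (spatial) and maximal $C^*$-norms on it. $L(H)$ is the algebra of bounded operators on a Hilbert space $H$. An asymptotic homomorphism $\mu=(\mu_t)_{t\in[0,\infty)}:A\to B$ between $C^*$-algebras is (in the sense of Connes and Higson) a family of maps $\mu_t:A\to B$ such that $t\mapsto\mu_t(a)$ is continuous for each $a\in A$ and, for all $a,b\in A$, $\alpha\in\mathbb C$, the norms of $\mu_t(ab)-\mu_t(a)\mu_t(b)$, $\mu_t(a+\alpha b)-\mu_t(a)-\alpha\mu_t(b)$ and $\mu_t(a^* )-\mu_t(a)^*$ tend to $0$ as $t\to\infty$. An asymptotic representation of $A$ on $H$ is an asymptotic homomorphism $A\to L(H)$; a genuine representation ($*$-homomorphism $A\to L(H)$) is regarded as a (constant in $t$) asymptotic representation. Given separable Hilbert spaces $H_1,H_2$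 and asymptotic representations $\mu:A\to L(H_1)$, $\nu:D\to L(H_2)$, define the $*$-homomorphism $$\mu\odot\nu: A\odot D\to C_b([0,\infty),L(H_1\otimes H_2))/C_0([0,\infty),L(H_1\otimes H_2))$$ by sending $\sum_i a_i\odot d_i$ to the class of $t\mapsto\sum_i(\mu_t(a_i)\otimes 1_{H_2})(1_{H_1}\otimes\nu_t(d_i))$. The symmetric asymptotic tensor norm is $\|x\|_\sigma=\sup_{\mu,\nu}\|\mu\odot\nu(x)\|$, $x\in A\odot D$, the supremum being over all asymptotic representations $\mu$ of $A$ and $\nu$ of $D$ on separable Hilbert spaces. The left asymptotic tensor norm is $\|x\|_\lambda=\sup_{\mu,\nu}\|\mu\odot\nu(x)\|$, the supremum being over all asymptotic representations $\mu$ of $A$ and all genuine representations $\nu$ of $D$ on separable Hilbert spaces. *)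

(* Defs.v *)
From HB Require Import structures.
From mathcomp Require Import all_boot all_order all_algebra.
From mathcomp Require Import complex ring lra.
From mathcomp Require Import all_classical all_reals all_analysis.

Set Implicit Arguments.
Unset Strict Implicit.
Unset Printing Implicit Defensive.

Import Order.TTheory GRing.Theory Num.Theory numFieldNormedType.Exports.

Local Open Scope classical_set_scope.
Local Open Scope ring_scope.
Local Open Scope complex_scope.

(* Algebras are not assumed to be unital, so the product is not that of algType. *)
HB.mixin Record isStarAlgebra (R : realType) V of GRing.Lmodule R[i] V := {
  amul : V -> V -> V;
  astar : V -> V;
  amulA : associative amul;
  amulDl : left_distributive amul +%R;
  amulDr : right_distributive amul +%R;
  amulZl : forall (c : R[i]) x y, amul (c *: x) y = c *: amul x y;
  amulZr : forall (c : R[i]) x y, amul x (c *: y) = c *: amul x y;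
  astarK : involutive astar;
  astarD : {morph astar : x y / x + y};
  astarZ : forall (c : R[i]) x, astar (c *: x) = c^* *: astar x;
  astarM : forall x y, astar (amul x y) = amul (astar y) (astar x)
}.

#[short(type="starAlgebra")]
HB.structure Definition StarAlgebra (R : realType) :=
  {V of GRing.Lmodule R[i] V & isStarAlgebra R V}.

HB.mixin Record isCStarAlgebra (R : realType) V
    of CompleteNormedModule R[i] V & isStarAlgebra R V := {
  ler_normM : forall x y : V, `|amul x y| <= `|x| * `|y|;
  norm_cstar : forall x : V, `|amul (astar x) x| = `|x| ^+ 2
}.

#[short(type="cstarAlgebra")]
HB.structure Definition CStarAlgebra (R : realType) :=
  {V of CompleteNormedModule R[i] V & isStarAlgebra R V & isCStarAlgebra R V}.

HB.mixin Record isHilbert (R : realType) H of CompleteNormedModule R[i] H := {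
  inner : {dot H for @Num.conj R[i]};
  inner_norm : forall x : H, inner x x = `|x| ^+ 2
}.

#[short(type="hilbertSpace")]
HB.structure Definition Hilbert (R : realType) :=
  {H of CompleteNormedModule R[i] H & isHilbert R H}.

Definition separable (T : topologicalType) :=
  exists2 S : set T, countable S & dense S.

(* The norm of a normed module over R[i] takes its values in R[i]. *)
Definition rnorm (R : realType) (V : normedModType R[i]) (x : V) : R :=
  complex.Re `|x|.

Lemma normc_ge0 (R : realType) (c : R[i]) : 0 <= Normc.normc c.
Proof. by rewrite -ler0c; exact: (normr_ge0 c). Qed.

Section real_norm.
Context {R : realType} {V : normedModType R[i]}.
Implicit Types (x y : V) (c : R[i]).

Lemma rnormE x : `|x| = (rnorm x)%:C.
Proof. by rewrite RRe_real// ger0_real. Qed.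

Lemma rnorm_ge0 x : 0 <= rnorm x.
Proof. by rewrite -ler0c -rnormE. Qed.

Lemma rnorm0 : rnorm (0 : V) = 0.
Proof. by rewrite /rnorm normr0. Qed.

Lemma rnorm_eq0 x : rnorm x = 0 -> x = 0.
Proof. by move=> x0; apply/normr0_eq0; rewrite rnormE x0. Qed.

Lemma rnormD x y : rnorm (x + y) <= rnorm x + rnorm y.
Proof. by rewrite -lecR rmorphD/= -!rnormE ler_normD. Qed.

Lemma rnormN x : rnorm (- x) = rnorm x.
Proof. by rewrite /rnorm normrN. Qed.

Lemma rnormB x y : rnorm (x - y) = rnorm (y - x).
Proof. by rewrite -rnormN opprB. Qed.

Lemma rnormZ c x : rnorm (c *: x) = Normc.normc c * rnorm x.
Proof. by apply: (@complexI R); rewrite -rnormE normrZ rnormE rmorphM. Qed.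

Lemma norm_lt_rnorm (e : R) x : (`|x| < e%:C) = (rnorm x < e).
Proof. by rewrite rnormE ltcR. Qed.

End real_norm.

Section inner_product.
Context {R : realType} {H : hilbertSpace R}.
Implicit Types (x y z : H) (c : R[i]).

Lemma innerDl x y z : inner (x + y) z = inner x z + inner y z.
Proof. by rewrite linearDl. Qed.

Lemma innerDr x y z : inner z (x + y) = inner z x + inner z y.
Proof. by rewrite linearDr. Qed.

Lemma innerZl c x z : inner (c *: x) z = c * inner x z.
Proof. by rewrite linearZl_LR. Qed.

Lemma innerZr c x z : inner z (c *: x) = c^* * inner z x.
Proof. by rewrite linearZr_LR. Qed.

Lemma innerC x z : inner z x = (inner x z)^*.
Proof. by rewrite hermC expr0 mul1r. Qed.

Lemma inner_rnorm x : inner x x = (rnorm x ^+ 2)%:C.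
Proof. by rewrite inner_norm rnormE rmorphXn. Qed.

Lemma inner_inj x y : (forall z, inner z x = inner z y) -> x = y.
Proof.
move=> xy; apply/eqP; rewrite -subr_eq0 -normr_eq0 -sqrf_eq0 -inner_norm.
by rewrite linearBr/= xy subrr.
Qed.

Lemma rnormD_sqr x y :
  rnorm (x + y) ^+ 2 = rnorm x ^+ 2 + 2 * complex.Re (inner x y) + rnorm y ^+ 2.
Proof.
have E z : rnorm z ^+ 2 = complex.Re (inner z z) by rewrite inner_rnorm.
rewrite !E innerDl !innerDr (innerC x y).
by case: (inner x x) (inner x y) (inner y y) => [a b] [c d] [e f] /=; ring.
Qed.

Lemma cauchy_schwarz x y : complex.Re (inner x y) <= rnorm x * rnorm y.
Proof.
have : rnorm (x + y) ^+ 2 <= (rnorm x + rnorm y) ^+ 2.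
  by rewrite lerXn2r// ?nnegrE ?addr_ge0 ?rnorm_ge0// rnormD.
by rewrite rnormD_sqr sqrrD; lra.
Qed.

End inner_product.

Section bounded_operators.
Context {R : realType} {H : hilbertSpace R}.

Definition bounded_operator : {pred H -> H} := fun f =>
  `[< linear f /\ exists M : R, forall x, rnorm (f x) <= M * rnorm x >].

Lemma bounded_operator_submod : GRing.submod_closed bounded_operator.
Proof.
split=> [|c f g /asboolP[lf [M fM]] /asboolP[lg [N gN]]]; apply/asboolP.
  split=> [a x y|]; first by rewrite scaler0 addr0.
  by exists 0 => x; rewrite rnorm0 mul0r.
split=> [a x y|].
  rewrite /= !fctE lf lg !scalerDr !scalerA (mulrC c a) -!addrA; congr (_ + _).
  by rewrite addrCA.
exists (Normc.normc c * M + N) => x; apply: le_trans (rnormD _ _) _.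
by rewrite mulrDl lerD// rnormZ -mulrA ler_wpM2l// normc_ge0.
Qed.

HB.instance Definition _ :=
  GRing.isSubmodClosed.Build R[i] (H -> H) bounded_operator bounded_operator_submod.

End bounded_operators.
Arguments bounded_operator {R} H.

Record bop (R : realType) (H : hilbertSpace R) :=
  Bop { bop_fun :> H -> H; bop_subproof : bop_fun \in bounded_operator H }.

HB.instance Definition _ (R : realType) (H : hilbertSpace R) :=
  [isSub for @bop_fun R H].
HB.instance Definition _ (R : realType) (H : hilbertSpace R) :=
  [Choice of bop H by <:].
HB.instance Definition _ (R : realType) (H : hilbertSpace R) :=
  [SubChoice_isSubLmodule of bop H by <:].

Section operator_norm.
Context {R : realType} {H : hilbertSpace R}.
Implicit Types (f g : bop H) (x y : H) (c : R[i]) (M : R).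

Lemma bop_linear f : linear f.
Proof. by have /asboolP[] := bop_subproof f. Qed.

HB.instance Definition _ f :=
  GRing.isLinear.Build R[i] H H *:%R f (bop_linear f).

Lemma bopE (f g : bop H) : (forall x, f x = g x) -> f = g.
Proof. by move=> fg; apply: val_inj; apply/funext. Qed.

Lemma bop_addE f g x : (f + g) x = f x + g x.
Proof. by []. Qed.

Lemma bop_oppE f x : (- f) x = - f x.
Proof. by []. Qed.

Lemma bop_scaleE c f x : (c *: f) x = c *: f x.
Proof. by []. Qed.

Definition opnorm f : R := sup [set rnorm (f x) | x in [set x | rnorm x <= 1]].

Lemma opnorm_has_sup f :
  has_sup [set rnorm (f x) | x in [set x | rnorm x <= 1]].
Proof.
have /asboolP[_ [M fM]] := bop_subproof f.
split; first by exists (rnorm (f 0)), 0 => //=; rewrite rnorm0.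
exists `|M| => _ [x /= x1 <-]; apply: le_trans (fM x) _.
apply: (@le_trans _ _ (`|M| * rnorm x)).
  by rewrite ler_wpM2r ?rnorm_ge0// ler_norm.
by rewrite ler_piMr.
Qed.

Lemma opnorm_ge0 f : 0 <= opnorm f.
Proof.
apply: le_trans (rnorm_ge0 (f 0)) _; apply: (sup_upper_bound (opnorm_has_sup f)).
by exists 0 => //=; rewrite rnorm0.
Qed.

Lemma rnorm_bop f x : rnorm (f x) <= opnorm f * rnorm x.
Proof.
have [->|x0] := eqVneq x 0; first by rewrite linear0 rnorm0 mulr0.
have nx0 : 0 < rnorm x.
  by rewrite lt_neqAle rnorm_ge0 andbT eq_sym; apply: contraNN x0 => /eqP/rnorm_eq0/eqP.
have nV : Normc.normc (rnorm x)^-1%:C = (rnorm x)^-1.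
  apply: (@complexI R); rewrite -[LHS]/(`|(rnorm x)^-1%:C|).
  by rewrite ger0_norm// ler0c invr_ge0 ltW.
rewrite -ler_pdivrMr// mulrC.
have -> : (rnorm x)^-1 * rnorm (f x) = rnorm (f ((rnorm x)^-1%:C *: x)).
  by rewrite linearZ rnormZ nV.
apply: (sup_upper_bound (opnorm_has_sup f)).
by exists ((rnorm x)^-1%:C *: x) => //=; rewrite rnormZ nV mulVf// gt_eqF.
Qed.

Lemma opnorm_le f M : 0 <= M -> (forall x, rnorm (f x) <= M * rnorm x) ->
  opnorm f <= M.
Proof.
move=> M0 fM; apply: ge_sup; first by case: (opnorm_has_sup f).
move=> _ [x /= x1 <-]; apply: le_trans (fM x) _.
by rewrite ler_piMr.
Qed.

Let norm f : R[i] := (opnorm f)%:C.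

Let norm_triangle f g : norm (f + g) <= norm f + norm g.
Proof.
rewrite /norm -rmorphD lecR; apply: opnorm_le; first by rewrite addr_ge0 ?opnorm_ge0.
by move=> x; rewrite mulrDl (le_trans (rnormD _ _))// lerD ?rnorm_bop.
Qed.

Let opnormZ_le c f : opnorm (c *: f) <= Normc.normc c * opnorm f.
Proof.
apply: opnorm_le => [|x]; first by rewrite mulr_ge0 ?normc_ge0 ?opnorm_ge0.
by rewrite bop_scaleE rnormZ -mulrA ler_wpM2l ?normc_ge0 ?rnorm_bop.
Qed.

Let norm_scale c f : norm (c *: f) = `|c| * norm f.
Proof.
rewrite [`|c|](_ : _ = (Normc.normc c)%:C)// /norm -rmorphM; congr _%:C.
apply/le_anti; rewrite opnormZ_le/=.
have [->|c0] := eqVneq c 0; first by rewrite Normc.normc0 mul0r opnorm_ge0.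
have := opnormZ_le c^-1 (c *: f).
rewrite scalerA mulVf// scale1r Normc.normcV mulrC ler_pdivlMr 1?mulrC//.
rewrite lt_neqAle normc_ge0 andbT eq_sym.
by apply: contraNN c0 => /eqP/Normc.eq0_normc/eqP.
Qed.

Let norm_eq0 f : norm f = 0 -> f = 0.
Proof.
move=> [f0]; apply: bopE => x; apply: rnorm_eq0; apply/le_anti.
by rewrite rnorm_ge0 andbT (le_trans (rnorm_bop f x))// f0 mul0r.
Qed.

HB.instance Definition _ :=
  Lmodule_isNormed.Build R[i] (bop H) norm_triangle norm_scale norm_eq0.

Lemma bop_normE f : `|f| = (opnorm f)%:C.
Proof. by []. Qed.

Lemma bop_rnormE f : rnorm f = opnorm f.
Proof. by []. Qed.

End operator_norm.

Section operator_complete.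
Context {R : realType} {H : hilbertSpace R}.

Lemma bop_complete (F : set_system (bop H)) :
  ProperFilter F -> cauchy F -> cvg F.
Proof.
move=> FF /cauchyP Fc.
have Fr (e : R) : 0 < e -> exists S : bop H, F [set f | rnorm (S - f) < e].
  move=> e0; have [|S FS] := Fc e%:C; first by rewrite ltcR.
  exists S; apply: filterS FS => f.
  by rewrite -ball_normE /ball_/= norm_lt_rnorm.
have Fx (x : H) : cvg ((fun f : bop H => f x) @ F).
  apply: cauchy_cvg; apply: cauchy_exP => e e0.
  have eE : e = (complex.Re e)%:C by rewrite RRe_real// gtr0_real.
  have {e0} : 0 < complex.Re e by rewrite -ltcR -eE.
  rewrite {}eE; move: (complex.Re e) => {}e e0.
  have x1 : 0 < rnorm x + 1 by rewrite ltr_wpDl ?rnorm_ge0.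
  have [|S FS] := Fr (e / (rnorm x + 1)); first by rewrite divr_gt0.
  exists (S x); rewrite -[_ (ball _ _)]/(F [set f : bop H | ball (S x) e%:C (f x)]).
  apply: filterS FS => f /= Sf.
  rewrite -ball_normE /ball_/= norm_lt_rnorm -[S x - f x]/((S - f) x).
  apply: le_lt_trans (rnorm_bop _ _) _; rewrite -bop_rnormE.
  apply: (@le_lt_trans _ _ (rnorm (S - f) * (rnorm x + 1))).
    by rewrite ler_wpM2l ?rnorm_ge0// lerDl.
  by rewrite -ltr_pdivlMr.
pose L x := lim ((fun f : bop H => f x) @ F).
have LE x : f x @[f --> F] --> L x by exact: Fx.
have Ld (x : H) (d : R) : 0 < d -> F [set f : bop H | rnorm (L x - f x) < d].
  move=> d0; have /cvgrPdist_lt/(_ d%:C) := LE x.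
  rewrite ltcR => /(_ d0) FL.
  have {}FL : F [set f : bop H | `|L x - f x| < d%:C] by exact: FL.
  by apply: filterS FL => f /=; rewrite norm_lt_rnorm.
have Llin : linear L.
  move=> a x y.
  suff : (fun f : bop H => f (a *: x + y)) @ F --> a *: L x + L y.
    exact: (cvg_unique (@norm_hausdorff _ _) (LE _)).
  have -> : (fun f : bop H => f (a *: x + y)) = (fun f => a *: f x + f y).
    by apply/funext => f; rewrite linearP.
  by apply: cvgD; [apply: cvgZl_tmp|]; exact: LE.
have LS (e : R) : 0 < e -> exists S : bop H,
    F [set f | rnorm (S - f) < e] /\ forall x, rnorm (L x - S x) <= e * rnorm x.
  move=> e0; have [S FS] := Fr e e0; exists S; split=> // x.
  apply/ler_addgt0Pr => d d0.
  have [f [/= Sf Lf]] := filter_ex (filterI FS (Ld x d d0)).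
  rewrite -(subrKA (f x)) (le_trans (rnormD _ _))// addrC lerD// ?(ltW Lf)//.
  rewrite rnormB -[S x - f x]/((S - f) x) (le_trans (rnorm_bop _ _))//.
  by rewrite ler_wpM2r ?rnorm_ge0// -bop_rnormE ltW.
have Lb : L \in bounded_operator H.
  apply/asboolP; split=> //; have [S [_ SL]] := LS 1 ltr01.
  exists (1 + opnorm S) => x; rewrite -(subrK (S x) (L x)).
  by rewrite (le_trans (rnormD _ _))// mulrDl lerD// rnorm_bop.
apply/cvg_ex; exists (Bop Lb); apply/cvgrPdist_lt => e e0.
have eE : e = (complex.Re e)%:C by rewrite RRe_real// gtr0_real.
have {e0} : 0 < complex.Re e by rewrite -ltcR -eE.
rewrite {}eE; move: (complex.Re e) => {}e e0.
have [|S [FS SL]] := LS (e / 2); first by rewrite divr_gt0.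
apply: filterS FS => f /= Sf; rewrite norm_lt_rnorm -(subrKA S).
rewrite (le_lt_trans (rnormD _ _))// [ltRHS]splitr ler_ltD//.
by rewrite bop_rnormE; apply: opnorm_le => //; rewrite divr_ge0// ltW.
Qed.

HB.instance Definition _ := Uniform_isComplete.Build (bop H) bop_complete.

End operator_complete.

Section riesz.
Context {R : realType} {H : hilbertSpace R}.
Implicit Types x y z h : H.

Lemma Re_innerC x y : complex.Re (inner y x) = complex.Re (inner x y).
Proof. by rewrite innerC; case: (inner x y). Qed.

Lemma ReZ (t : R) (c : R[i]) : complex.Re (t%:C * c) = t * complex.Re c.
Proof. by case: c => a b /=; rewrite mul0r subr0. Qed.

Lemma ReD (b c : R[i]) : complex.Re (b + c) = complex.Re b + complex.Re c.
Proof. by case: b c => [? ?] [? ?]. Qed.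

Lemma rnormZR (t : R) x : rnorm (t%:C *: x) ^+ 2 = t ^+ 2 * rnorm x ^+ 2.
Proof.
by rewrite rnormZ exprMn /= expr0n/= addr0 sqr_sqrtr ?sqr_ge0.
Qed.

Lemma riesz (phi : H -> R[i]) :
  (forall c x y, phi (c *: x + y) = c * phi x + phi y) ->
  (exists M : R, forall x, complex.Re (phi x) <= M * rnorm x) ->
  exists z, forall x, phi x = inner x z.
Proof.
move=> phiL [M phiM].
have phi0 : phi 0 = 0 by have := phiL (-1) 0 0; rewrite scaler0 addr0 mulN1r addNr.
have phiZ c x : phi (c *: x) = c * phi x by rewrite -[c *: x]addr0 phiL phi0 addr0.
have phiD x y : phi (x + y) = phi x + phi y by rewrite -[x]scale1r phiL mul1r scale1r.
pose J z := rnorm z ^+ 2 - 2 * complex.Re (phi z).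
have Jlb z : - M ^+ 2 <= J z.
  by rewrite /J; have := phiM z; have := sqr_ge0 (M - rnorm z); rewrite sqrrB; nra.
have Jinf : has_inf (range J).
  by split; [exists (J 0), 0|exists (- M ^+ 2) => _ [z _ <-]].
pose d := inf (range J).
have dJ z : d <= J z by apply: (ge_inf Jinf.2); exists z.
have JD z t h : J (z + t%:C *: h) = J z +
    2 * t * (complex.Re (inner h z) - complex.Re (phi h)) + t ^+ 2 * rnorm h ^+ 2.
  rewrite /J rnormD_sqr rnormZR -(Re_innerC z) innerZl ReZ phiD phiZ ReD ReZ.
  by ring.
have Jpar z w : rnorm (z - w) ^+ 2 <= 2 * (J z + J w - 2 * d).
  have := dJ ((1 / 2)%:C *: (z + w)).
  rewrite /J rnormZR phiZ ReZ phiD ReD -[- w]scaleN1r.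
  rewrite rnormD_sqr rnormD_sqr -(Re_innerC z (-1 *: w)) innerZl.
  have -> : complex.Re (-1 * inner w z) = - complex.Re (inner z w).
    by rewrite mulN1r (innerC z w); case: (inner z w).
  rewrite scaleN1r rnormN; lra.
pose F := filter_from [set e : R | 0 < e] (fun e => [set z | J z < d + e]).
have FF : ProperFilter F.
  apply: filter_from_proper.
    apply: filter_from_filter; first by exists 1 => /=.
    move=> e f /= e0 f0; exists (Num.min e f); first by rewrite /= lt_min e0.
    move=> z /= zef; split; apply: (lt_le_trans zef).
      by rewrite lerD2l ge_min lexx.
    by rewrite lerD2l ge_min lexx orbT.
  move=> e /= e0; have [_ [z _ <-] zd] := inf_adherent e0 Jinf.
  by exists z.
have FJ (e : R) : 0 < e -> F [set z | J z < d + e] by move=> e0; exists e.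
have cF : cauchy F.
  apply: cauchy_exP => e e0.
  have eE : e = (complex.Re e)%:C by rewrite RRe_real// gtr0_real.
  have {e0} : 0 < complex.Re e by rewrite -ltcR -eE.
  rewrite {}eE; move: (complex.Re e) => {}e e0.
  have e4 : 0 < e ^+ 2 / 4 by rewrite divr_gt0 ?exprn_gt0.
  have [z /= zd] := filter_ex (FJ _ e4); exists z.
  apply: filterS (FJ _ e4) => w /= wd.
  rewrite -ball_normE /ball_/= norm_lt_rnorm ltNge; apply/negP => ezw.
  have : e ^+ 2 <= rnorm (z - w) ^+ 2 by rewrite lerXn2r// nnegrE ?rnorm_ge0 ?ltW.
  by apply/negP; rewrite -ltNge; apply: le_lt_trans (Jpar z w) _; lra.
have [z0 Fz0] : exists z0, F --> z0 by apply/cvg_ex; exact: cauchy_cvg.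
have Jc z h (e : R) : 0 < e -> J z < d + e ^+ 2 ->
    complex.Re (inner h z) - complex.Re (phi h) <= e * rnorm h.
  move=> e0 zd; have [->|h0] := eqVneq h 0.
    by rewrite phi0 linear0l rnorm0 mulr0 subrr.
  have nh0 : 0 < rnorm h.
    rewrite lt_neqAle rnorm_ge0 andbT eq_sym.
    by apply: contraNN h0 => /eqP/rnorm_eq0/eqP.
  have := dJ (z + (- (e / rnorm h))%:C *: h); rewrite JD.
  set c := _ - _ => dz.
  have E : (- (e / rnorm h)) ^+ 2 * rnorm h ^+ 2 = e ^+ 2.
    by rewrite -exprMn mulNr divfK ?gt_eqF// sqrrN.
  rewrite -ler_pdivrMr// leNgt; apply/negP => ce.
  move: dz; rewrite E leNgt => /negP; apply.
  have -> : 2 * - (e / rnorm h) * c = - 2 * e * (c / rnorm h) by ring.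
  by nra.
have Re_le h : complex.Re (inner h z0) <= complex.Re (phi h).
  rewrite -subr_le0; apply/ler_addgt0Pr => e e0; rewrite add0r.
  have h1 : 0 < 2 * rnorm h + 1 by rewrite ltr_wpDl// mulr_ge0// rnorm_ge0.
  pose t := e / (2 * rnorm h + 1).
  have t0 : 0 < t by rewrite divr_gt0.
  have Fz : F [set z | `|z0 - z| < t%:C].
    by have /fcvgrPdist_lt/(_ t%:C) := Fz0; rewrite ltcR => /(_ t0).
  have [z [/= zd zz0]] := filter_ex (filterI (FJ _ (exprn_gt0 2 t0)) Fz).
  have := Jc _ h _ t0 zd.
  rewrite norm_lt_rnorm in zz0.
  have := cauchy_schwarz h (z0 - z).
  have -> : complex.Re (inner h (z0 - z)) =
      complex.Re (inner h z0) - complex.Re (inner h z).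
    by rewrite linearBr /=; case: (inner h z0) (inner h z) => [? ?] [? ?].
  have : rnorm h * rnorm (z0 - z) <= rnorm h * t.
    by rewrite ler_wpM2l ?rnorm_ge0// ltW.
  have : t * (2 * rnorm h + 1) = e by rewrite divfK// gt_eqF.
  by nra.
have Re_eq h : complex.Re (phi h) = complex.Re (inner h z0).
  apply/le_anti; rewrite Re_le andbT.
  have := Re_le (- h); rewrite -scaleN1r innerZl phiZ !mulN1r.
  by case: (inner h z0) (phi h) => [? ?] [? ?] /=; rewrite lerN2.
exists z0 => h; have := Re_eq ('i%C *: h); have := Re_eq h.
rewrite innerZl phiZ.
case: (inner h z0) (phi h) => [a b] [a' b'] /= -> /eqP.
by rewrite !mul0r !mul1r !sub0r eqr_opp => /eqP ->.
Qed.

End riesz.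

Section operator_cstar.
Context {R : realType} {H : hilbertSpace R}.
Implicit Types (f g : bop H) (x y : H) (c : R[i]).

Lemma adjoint_ex f :
  exists g : bop H, forall x y, inner (f x) y = inner x (g y).
Proof.
have /choice[g gE] : forall y, exists z, forall x, inner (f x) y = inner x z.
  move=> y; apply: riesz => [c x x'|]; first by rewrite linearP innerDl innerZl.
  exists (opnorm f * rnorm y) => x; apply: le_trans (cauchy_schwarz _ _) _.
  by rewrite mulrAC ler_wpM2r ?rnorm_ge0 ?rnorm_bop.
have gb : g \in bounded_operator H.
  apply/asboolP; split=> [c x y|].
    by apply: inner_inj => z; rewrite -gE !innerDr !innerZr !gE.
  exists (opnorm f) => y; have [->|y0] := eqVneq (rnorm (g y)) 0.
    by rewrite mulr_ge0 ?opnorm_ge0 ?rnorm_ge0.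
  have gy0 : 0 < rnorm (g y) by rewrite lt_neqAle eq_sym y0 rnorm_ge0.
  rewrite -(ler_pM2r gy0) -expr2.
  have -> : rnorm (g y) ^+ 2 = complex.Re (inner (f (g y)) y).
    by rewrite gE inner_rnorm.
  apply: le_trans (cauchy_schwarz _ _) _.
  by rewrite mulrAC ler_wpM2r ?rnorm_ge0 ?rnorm_bop.
by exists (Bop gb) => x y; rewrite gE.
Qed.

Definition adjoint f : bop H := sval (cid (adjoint_ex f)).

Lemma adjointE f x y : inner (f x) y = inner x (adjoint f y).
Proof. exact: (svalP (cid (adjoint_ex f))). Qed.

Lemma adjoint_uniq f g :
  (forall x y, inner (f x) y = inner x (g y)) -> g = adjoint f.
Proof.
by move=> fg; apply: bopE => y; apply: inner_inj => x; rewrite -fg adjointE.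
Qed.

Lemma comp_bounded f g : (f \o g) \in bounded_operator H.
Proof.
apply/asboolP; split=> [c x y|]; first by rewrite /= !linearP.
exists (opnorm f * opnorm g) => x /=; apply: le_trans (rnorm_bop _ _) _.
by rewrite -mulrA ler_wpM2l ?opnorm_ge0 ?rnorm_bop.
Qed.

Definition bop_comp f g : bop H := Bop (comp_bounded f g).

Lemma id_bounded : idfun \in bounded_operator H.
Proof. by apply/asboolP; split=> //; exists 1 => x; rewrite mul1r. Qed.

Definition bop_id : bop H := Bop id_bounded.

Let compA : associative bop_comp.
Proof. by move=> f g h; exact: bopE. Qed.

Let compDl : left_distributive bop_comp +%R.
Proof. by move=> f g h; exact: bopE. Qed.

Let compDr : right_distributive bop_comp +%R.
Proof. by move=> f g h; apply: bopE => x; exact: linearD. Qed.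

Let compZl c f g : bop_comp (c *: f) g = c *: bop_comp f g.
Proof. exact: bopE. Qed.

Let compZr c f g : bop_comp f (c *: g) = c *: bop_comp f g.
Proof. by apply: bopE => x; exact: linearZ. Qed.

Let adjointK : involutive adjoint.
Proof.
move=> f; apply/esym/adjoint_uniq => x y.
by rewrite innerC -adjointE -innerC.
Qed.

Let adjointD : {morph adjoint : f g / f + g}.
Proof.
move=> f g; apply/esym/adjoint_uniq => x y.
by rewrite !bop_addE innerDl innerDr !adjointE.
Qed.

Let adjointZ c f : adjoint (c *: f) = c^* *: adjoint f.
Proof.
apply/esym/adjoint_uniq => x y.
by rewrite !bop_scaleE innerZl innerZr adjointE conjCK.
Qed.

Let adjointM f g : adjoint (bop_comp f g) = bop_comp (adjoint g) (adjoint f).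
Proof. by apply/esym/adjoint_uniq => x y; rewrite /= !adjointE. Qed.

HB.instance Definition _ := isStarAlgebra.Build R (bop H)
  compA compDl compDr compZl compZr adjointK adjointD adjointZ adjointM.

Let opnormM f g : opnorm (bop_comp f g) <= opnorm f * opnorm g.
Proof.
apply: opnorm_le => [|x]; first by rewrite mulr_ge0 ?opnorm_ge0.
by rewrite (le_trans (rnorm_bop f (g x)))// -mulrA ler_wpM2l ?opnorm_ge0 ?rnorm_bop.
Qed.

Let opnorm_star f : opnorm f ^+ 2 <= opnorm (bop_comp (adjoint f) f).
Proof.
rewrite -[leRHS]sqr_sqrtr ?opnorm_ge0// lerXn2r ?nnegrE ?sqrtr_ge0 ?opnorm_ge0//.
apply: opnorm_le => [|x]; first exact: sqrtr_ge0.
rewrite -ler_sqr ?nnegrE ?mulr_ge0 ?sqrtr_ge0 ?rnorm_ge0//.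
rewrite exprMn sqr_sqrtr ?opnorm_ge0//.
have -> : rnorm (f x) ^+ 2 = complex.Re (inner x (bop_comp (adjoint f) f x)).
  by rewrite -adjointE inner_rnorm.
apply: le_trans (cauchy_schwarz _ _) _.
by rewrite mulrC expr2 mulrA ler_wpM2r ?rnorm_ge0 ?rnorm_bop.
Qed.

Let opnorm_adjoint_le f : opnorm f <= opnorm (adjoint f).
Proof.
have [->|f0] := eqVneq (opnorm f) 0; first exact: opnorm_ge0.
have {}f0 : 0 < opnorm f by rewrite lt_neqAle eq_sym f0 opnorm_ge0.
rewrite -(ler_pM2r f0) -expr2 (le_trans (opnorm_star f))//; exact: opnormM.
Qed.

Let bop_normM f g : `|amul f g| <= `|f| * `|g|.
Proof. by rewrite !bop_normE -rmorphM lecR; exact: opnormM. Qed.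

Let bop_norm_cstar f : `|amul (astar f) f| = `|f| ^+ 2.
Proof.
rewrite !bop_normE -rmorphXn; congr _%:C; apply/le_anti.
rewrite [X in _ && X]opnorm_star andbT (le_trans (opnormM _ _))//.
rewrite expr2 ler_wpM2r ?opnorm_ge0//.
by rewrite -[in leRHS](adjointK f); exact: opnorm_adjoint_le.
Qed.

HB.instance Definition _ :=
  isCStarAlgebra.Build R (bop H) bop_normM bop_norm_cstar.

End operator_cstar.
Arguments bop_id {R} H.

Section algebraic_tensor.
Context {R : realType} {A D : starAlgebra R}.
Implicit Types (s t u : seq (A * D)) (p q : A * D) (c : R[i]).

(* A formal sum [:: (a1, d1); ...; (an, dn)] stands for a1 ⊙ d1 + ... + an ⊙ dn,
   and two formal sums are identified modulo the bilinearity relations. *)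
Inductive tensor_eqv : seq (A * D) -> seq (A * D) -> Prop :=
| TensorRefl s : tensor_eqv s s
| TensorSym s t : tensor_eqv s t -> tensor_eqv t s
| TensorTrans t s u : tensor_eqv s t -> tensor_eqv t u -> tensor_eqv s u
| TensorPerm s t : perm_eq s t -> tensor_eqv s t
| TensorCat s s' t t' :
    tensor_eqv s s' -> tensor_eqv t t' -> tensor_eqv (s ++ t) (s' ++ t')
| TensorDl a a' d : tensor_eqv [:: (a + a', d)] [:: (a, d); (a', d)]
| TensorDr a d d' : tensor_eqv [:: (a, d + d')] [:: (a, d); (a, d')]
| TensorZ c a d : tensor_eqv [:: (c *: a, d)] [:: (a, c *: d)]
| TensorZ0 d : tensor_eqv [:: (0, d)] [::].

Definition tensor_eqvb s t := `[< tensor_eqv s t >].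

Let tensor_eqvb_refl : reflexive tensor_eqvb.
Proof. by move=> s; apply/asboolP; exact: TensorRefl. Qed.

Let tensor_eqvb_sym : symmetric tensor_eqvb.
Proof. by move=> s t; apply/asboolP/asboolP; exact: TensorSym. Qed.

Let tensor_eqvb_trans : transitive tensor_eqvb.
Proof.
by move=> t s u /asboolP st /asboolP tu; apply/asboolP; exact: TensorTrans tu.
Qed.

Canonical tensor_equiv :=
  EquivRel tensor_eqvb tensor_eqvb_refl tensor_eqvb_sym tensor_eqvb_trans.

End algebraic_tensor.

Definition algTensor (R : realType) (A D : starAlgebra R) : Type :=
  {eq_quot (@tensor_equiv R A D)}%qT.

HB.instance Definition _ (R : realType) (A D : starAlgebra R) :=
  Choice.on (algTensor A D).
HB.instance Definition _ (R : realType) (A D : starAlgebra R) :=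
  EqQuotient.on (algTensor A D).

Notation "A ⊙ D" := (algTensor A D) (at level 40, left associativity) : type_scope.

Section algebraic_tensor_theory.
Context {R : realType} {A D : starAlgebra R}.
Implicit Types (s t : seq (A * D)) (p q : A * D) (c : R[i]) (x y z : A ⊙ D).

Definition tclass s : A ⊙ D := (\pi s)%qT.

Lemma classP s t : tclass s = tclass t <-> tensor_eqv s t.
Proof.
by split=> [/eqquotP/asboolP//|st]; apply/eqquotP/asboolP.
Qed.

Lemma class_repr x : tclass (repr x) = x.
Proof. exact: reprK. Qed.

Lemma repr_class s : tensor_eqv (repr (tclass s)) s.
Proof. by apply/classP; rewrite class_repr. Qed.

Lemma tensor_map (h : A * D -> A * D) s t :
    (forall a a' d, tensor_eqv [:: h (a + a', d)] [:: h (a, d); h (a', d)]) ->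
    (forall a d d', tensor_eqv [:: h (a, d + d')] [:: h (a, d); h (a, d')]) ->
    (forall c a d, tensor_eqv [:: h (c *: a, d)] [:: h (a, c *: d)]) ->
    (forall d, tensor_eqv [:: h (0, d)] [::]) ->
  tensor_eqv s t -> tensor_eqv (map h s) (map h t).
Proof.
move=> hDl hDr hZ h0; elim=> {s t}//=.
- by move=> s; exact: TensorRefl.
- by move=> s t _; exact: TensorSym.
- by move=> t s u _ + _; exact: TensorTrans.
- by move=> s t st; apply: TensorPerm; exact: perm_map.
- by move=> s s' t t' _ ss' _ tt'; rewrite !map_cat; exact: TensorCat.
Qed.

Definition tensor_scale c p : A * D := (c *: p.1, p.2).
Definition tensor_mul p q : A * D := (amul p.1 q.1, amul p.2 q.2).
Definition tensor_star p : A * D := (astar p.1, astar p.2).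

Definition tens0 : A ⊙ D := tclass [::].
Definition tens_add x y : A ⊙ D := tclass (repr x ++ repr y).
Definition tens_scale c x : A ⊙ D := tclass (map (tensor_scale c) (repr x)).
Definition tens_opp x : A ⊙ D := tens_scale (-1) x.
Definition tens_mul x y : A ⊙ D :=
  tclass [seq tensor_mul p q | p <- repr x, q <- repr y].
Definition tens_star x : A ⊙ D := tclass (map tensor_star (repr x)).

Lemma amul0l (B : starAlgebra R) (a : B) : amul 0 a = 0.
Proof. by rewrite -[X in amul X](scale0r 0) amulZl scale0r. Qed.

Lemma amul0r (B : starAlgebra R) (a : B) : amul a 0 = 0.
Proof. by rewrite -(scale0r 0) amulZr !scale0r. Qed.

Lemma astar0 (B : starAlgebra R) : astar 0 = 0 :> B.
Proof. by rewrite -(scale0r 0) astarZ rmorph0 !scale0r. Qed.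

Lemma tensor_scale_eqv c s t :
  tensor_eqv s t -> tensor_eqv (map (tensor_scale c) s) (map (tensor_scale c) t).
Proof.
apply: tensor_map => [a a' d|a d d'|b a d|d]; rewrite /tensor_scale/=.
- by rewrite scalerDr; exact: TensorDl.
- exact: TensorDr.
- by rewrite scalerA mulrC -scalerA; exact: TensorZ.
- by rewrite scaler0; exact: TensorZ0.
Qed.

Lemma tensor_star_eqv s t :
  tensor_eqv s t -> tensor_eqv (map tensor_star s) (map tensor_star t).
Proof.
apply: tensor_map => [a a' d|a d d'|b a d|d]; rewrite /tensor_star/=.
- by rewrite astarD; exact: TensorDl.
- by rewrite astarD; exact: TensorDr.
- by rewrite !astarZ; exact: TensorZ.
- by rewrite astar0; exact: TensorZ0.
Qed.

Lemma tensor_mul_eqv s s' t t' : tensor_eqv s s' -> tensor_eqv t t' ->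
  tensor_eqv [seq tensor_mul p q | p <- s, q <- t]
             [seq tensor_mul p q | p <- s', q <- t'].
Proof.
move=> ss' tt'; apply: (@TensorTrans _ _ _ [seq tensor_mul p q | p <- s, q <- t']).
  elim: s {ss'} => [|p s IHs]; first exact: TensorRefl.
  rewrite !allpairs_cons; apply: TensorCat IHs.
  apply: tensor_map tt' => [a a' d|a d d'|b a d|d]; rewrite /tensor_mul/=.
  - by rewrite amulDr; exact: TensorDl.
  - by rewrite amulDr; exact: TensorDr.
  - by rewrite !amulZr; exact: TensorZ.
  - by rewrite amul0r; exact: TensorZ0.
elim: t' {tt'} => [|q t' IHt].
  by rewrite !allpairs0r; exact: TensorRefl.
have E r : tensor_eqv [seq tensor_mul p q | p <- r, q <- q :: t']
    ([seq tensor_mul p q | p <- r] ++ [seq tensor_mul p q | p <- r, q <- t']).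
  by apply: TensorPerm; rewrite perm_allpairs_consr.
apply: TensorTrans (E s) _; apply: TensorTrans (TensorSym (E s')).
apply: TensorCat IHt.
apply: tensor_map ss' => [a a' d|a d d'|b a d|d]; rewrite /tensor_mul/=.
- by rewrite amulDl; exact: TensorDl.
- by rewrite amulDl; exact: TensorDr.
- by rewrite !amulZl; exact: TensorZ.
- by rewrite amul0l; exact: TensorZ0.
Qed.

Lemma class_cat s t : tclass (s ++ t) = tens_add (tclass s) (tclass t).
Proof. by apply/classP/TensorCat; apply/TensorSym/repr_class. Qed.

Lemma class_scale c s :
  tclass (map (tensor_scale c) s) = tens_scale c (tclass s).
Proof. by apply/classP/tensor_scale_eqv/TensorSym/repr_class. Qed.

Lemma class_mul s t :
  tclass [seq tensor_mul p q | p <- s, q <- t] = tens_mul (tclass s) (tclass t).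
Proof. by apply/classP/tensor_mul_eqv; apply/TensorSym/repr_class. Qed.

Lemma class_star s : tclass (map tensor_star s) = tens_star (tclass s).
Proof. by apply/classP/tensor_star_eqv/TensorSym/repr_class. Qed.

Lemma class_ind (P : A ⊙ D -> Prop) : (forall s, P (tclass s)) -> forall x, P x.
Proof. by move=> Ps x; rewrite -(class_repr x). Qed.

Let addA : associative tens_add.
Proof.
elim/class_ind => s; elim/class_ind => t; elim/class_ind => u.
by rewrite -!class_cat catA.
Qed.

Let addC : commutative tens_add.
Proof.
elim/class_ind => s; elim/class_ind => t; rewrite -!class_cat.
by apply/classP/TensorPerm; rewrite perm_catC.
Qed.

Let add0 : left_id tens0 tens_add.
Proof. by elim/class_ind => s; rewrite -class_cat. Qed.

Let scaleA b c x : tens_scale b (tens_scale c x) = tens_scale (b * c) x.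
Proof.
elim/class_ind: x => s; rewrite -!class_scale -map_comp; congr tclass.
by apply: eq_map => p; rewrite /tensor_scale/= scalerA.
Qed.

Let scale1 : left_id 1 tens_scale.
Proof.
elim/class_ind => s; rewrite -class_scale; congr tclass; rewrite -[RHS]map_id.
by apply: eq_map => -[a d]; rewrite /tensor_scale/= scale1r.
Qed.

Let scaleDr c : {morph tens_scale c : x y / tens_add x y}.
Proof.
elim/class_ind => s; elim/class_ind => t.
by rewrite -class_cat -!class_scale -class_cat map_cat.
Qed.

Let scaleDl x b c : tens_scale (b + c) x = tens_add (tens_scale b x) (tens_scale c x).
Proof.
elim/class_ind: x => s; rewrite -!class_scale -class_cat; apply/classP.
elim: s => [|[a d] s IHs] /=; first exact: TensorRefl.
rewrite -cat1s.
apply: TensorTrans (TensorPerm (_ : perm_eq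
  ([:: tensor_scale b (a, d); tensor_scale c (a, d)] ++
   (map (tensor_scale b) s ++ map (tensor_scale c) s)) _)); last first.
  by rewrite /= perm_cons perm_sym; exact: permEl (perm_catCA _ [:: _] _).
by apply: TensorCat IHs; rewrite /tensor_scale/= scalerDl; exact: TensorDl.
Qed.

Let scale0 x : tens_scale 0 x = tens0.
Proof.
elim/class_ind: x => s; rewrite -class_scale; apply/classP.
elim: s => [|[a d] s IHs] /=; first exact: TensorRefl.
rewrite -cat1s -[X in tensor_eqv _ X]cat0s; apply: TensorCat IHs.
by rewrite /tensor_scale scale0r; exact: TensorZ0.
Qed.

Let addN : left_inverse tens0 tens_opp tens_add.
Proof.
by move=> x; rewrite -[X in tens_add _ X]scale1 -scaleDl addNr scale0.
Qed.

HB.instance Definition _ := GRing.isZmodule.Build (A ⊙ D) addA addC add0 addN.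

HB.instance Definition _ := GRing.Zmodule_isLmodule.Build R[i] (A ⊙ D)
  scaleA scale1 scaleDr scaleDl.

Lemma class_catE s t : tclass (s ++ t) = tclass s + tclass t.
Proof. exact: class_cat. Qed.

Lemma tclass_sum s : tclass s = \sum_(p <- s) tclass [:: p].
Proof.
by elim: s => [|p s IHs]; rewrite ?big_nil// big_cons -IHs -class_catE.
Qed.

End algebraic_tensor_theory.

Section algebraic_tensor_star.
Context {R : realType} {A D : starAlgebra R}.
Implicit Types (s t : seq (A * D)) (p q : A * D) (c : R[i]) (x y : A ⊙ D).

Lemma tclass_ex x : exists s, x = tclass s.
Proof. by exists (repr x); rewrite class_repr. Qed.

Lemma scale_tclass c s :
  c *: tclass s = \sum_(p <- s) tclass [:: tensor_scale c p].
Proof.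
by transitivity (tclass (map (tensor_scale c) s));
  [exact/esym/class_scale | rewrite tclass_sum big_map].
Qed.

Lemma mul_tclass s t : tens_mul (tclass s) (tclass t) =
  \sum_(p <- s) \sum_(q <- t) tclass [:: tensor_mul p q].
Proof. by rewrite -class_mul tclass_sum big_allpairs_dep. Qed.

Lemma star_tclass s :
  tens_star (tclass s) = \sum_(p <- s) tclass [:: tensor_star p].
Proof. by rewrite -class_star tclass_sum big_map. Qed.

Let mulA : associative (@tens_mul R A D).
Proof.
move=> x y z.
have [s ->] := tclass_ex x; have [t ->] := tclass_ex y; have [u ->] := tclass_ex z.
rewrite -!class_mul tclass_sum [RHS]tclass_sum !big_allpairs_dep.
apply: eq_bigr => p _; rewrite big_allpairs_dep.
apply: eq_bigr => q _; apply: eq_bigr => r _.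
by rewrite /tensor_mul/= !amulA.
Qed.

Let mulDl : left_distributive (@tens_mul R A D) +%R.
Proof.
move=> x y z.
have [s ->] := tclass_ex x; have [t ->] := tclass_ex y; have [u ->] := tclass_ex z.
by rewrite -class_catE !mul_tclass big_cat.
Qed.

Let mulDr : right_distributive (@tens_mul R A D) +%R.
Proof.
move=> x y z.
have [s ->] := tclass_ex x; have [t ->] := tclass_ex y; have [u ->] := tclass_ex z.
rewrite -class_catE !mul_tclass -big_split; apply: eq_bigr => p _.
by rewrite big_cat.
Qed.

Let mulZl c x y : tens_mul (c *: x) y = c *: tens_mul x y.
Proof.
have [s ->] := tclass_ex x; have [t ->] := tclass_ex y.
rewrite -[c *: _]class_scale !mul_tclass big_map scaler_sumr.
apply: eq_bigr => p _; rewrite scaler_sumr; apply: eq_bigr => q _.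
by rewrite scale_tclass big_seq1 /tensor_mul /tensor_scale/= amulZl.
Qed.

Let mulZr c x y : tens_mul x (c *: y) = c *: tens_mul x y.
Proof.
have [s ->] := tclass_ex x; have [t ->] := tclass_ex y.
rewrite -[c *: _]class_scale !mul_tclass scaler_sumr.
apply: eq_bigr => p _; rewrite big_map scaler_sumr; apply: eq_bigr => q _.
by rewrite scale_tclass big_seq1 /tensor_mul /tensor_scale/= amulZr.
Qed.

Let starK : involutive (@tens_star R A D).
Proof.
move=> x; have [s ->] := tclass_ex x; rewrite -!class_star -map_comp; congr tclass.
by rewrite -[RHS]map_id; apply: eq_map => -[a d]; rewrite /tensor_star/= !astarK.
Qed.

Let starD : {morph @tens_star R A D : x y / x + y}.
Proof.
move=> x y; have [s ->] := tclass_ex x; have [t ->] := tclass_ex y.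
by rewrite -class_catE !star_tclass big_cat.
Qed.

Let starZ c x : tens_star (c *: x) = (c^*)%R *: tens_star x.
Proof.
have [s ->] := tclass_ex x; rewrite -[c *: _]class_scale !star_tclass big_map scaler_sumr.
apply: eq_bigr => p _; rewrite scale_tclass big_seq1.
by rewrite /tensor_star /tensor_scale/= astarZ.
Qed.

Let starM x y : tens_star (tens_mul x y) = tens_mul (tens_star y) (tens_star x).
Proof.
have [s ->] := tclass_ex x; have [t ->] := tclass_ex y.
rewrite -class_mul star_tclass big_allpairs_dep -!class_star mul_tclass big_map.
rewrite exchange_big; apply: eq_bigr => q _; rewrite big_map.
by apply: eq_bigr => p _; rewrite /tensor_star /tensor_mul/= !astarM.
Qed.

HB.instance Definition _ := isStarAlgebra.Build R (A ⊙ D)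
  mulA mulDl mulDr mulZl mulZr starK starD starZ starM.

End algebraic_tensor_star.

(* The elementary tensor a ⊙ d. *)
Definition tens (R : realType) (A D : starAlgebra R) (a : A) (d : D) : A ⊙ D :=
  tclass [:: (a, d)].

Lemma tclass_tens (R : realType) (A D : starAlgebra R) (s : seq (A * D)) :
  tclass s = \sum_(p <- s) tens p.1 p.2.
Proof. by rewrite tclass_sum; apply: eq_bigr => -[]. Qed.

Definition star_hom (R : realType) (B C : starAlgebra R) (f : B -> C) : Prop :=
  [/\ linear f, {morph f : x y / amul x y} & {morph f : x / astar x}].

(* H1 ⊗ H2 is determined up to unitary equivalence by the inner product of
   elementary tensors and the density of their linear span. *)
Record hilbertTensor (R : realType) (H1 H2 : hilbertSpace R) := HilbertTensor {
  ht_space :> hilbertSpace R;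
  ht_map : {bilinear H1 -> H2 -> ht_space};
  inner_ht_map : forall x x' y y',
    inner (ht_map x y) (ht_map x' y') = inner x x' * inner y y';
  dense_ht_map :
    dense [set \sum_(p <- s) ht_map p.1 p.2 | s in [set: seq (H1 * H2)]]
}.

(* S ⊗ T, the unique bounded operator with (S ⊗ T) (x ⊗ y) = S x ⊗ T y. *)
Definition op_tensor (R : realType) (H1 H2 : hilbertSpace R)
    (K : hilbertTensor H1 H2) (S : bop H1) (T : bop H2) : bop K :=
  get [set U : bop K | forall x y, U (ht_map K x y) = ht_map K (S x) (T y)].

Section asymptotic.
Context {R : realType}.

Record asymptotic_hom (B C : cstarAlgebra R) (mu : R -> B -> C) : Prop := {
  asymptotic_continuous : forall a, {within `[0, +oo[, continuous (mu^~ a)};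
  asymptotic_mul : forall a b,
    rnorm (mu t (amul a b) - amul (mu t a) (mu t b)) @[t --> +oo] --> (0 : R);
  asymptotic_linear : forall a b (c : R[i]),
    rnorm (mu t (a + c *: b) - mu t a - c *: mu t b) @[t --> +oo] --> (0 : R);
  asymptotic_star : forall a,
    rnorm (mu t (astar a) - astar (mu t a)) @[t --> +oo] --> (0 : R)
}.

(* C_0([0, +oo), B); only the values on [0, +oo) matter. *)
Definition vanishing (B : cstarAlgebra R) : set (R -> B) :=
  [set g : R -> B | {within `[0, +oo[, continuous g} /\
           rnorm (g t) @[t --> +oo] --> (0 : R)].

(* The norm of the class of f in C_b([0, +oo), B) / C_0([0, +oo), B). *)
Definition quotient_norm (B : cstarAlgebra R) (f : R -> B) : \bar R :=
  ereal_inf [set ereal_sup [set (rnorm (f t - g t))%:E | t in `[0, +oo[]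
            | g in @vanishing B].

(* A representative of the class (mu ⊙ nu) x; this class does not depend on the
   formal sum that repr picks for x, by asymptotic linearity. *)
Definition asymptotic_tensor (A D : cstarAlgebra R) (H1 H2 : hilbertSpace R)
    (K : hilbertTensor H1 H2) (mu : R -> A -> bop H1) (nu : R -> D -> bop H2)
    (x : A ⊙ D) (t : R) : bop K :=
  \sum_(p <- repr x) amul (op_tensor K (mu t p.1) (bop_id H2))
                          (op_tensor K (bop_id H1) (nu t p.2)).

(* (pi ⊗ rho) x, for representations pi and rho. *)
Definition spatial_tensor (A D : cstarAlgebra R) (H1 H2 : hilbertSpace R)
    (K : hilbertTensor H1 H2) (pi : A -> bop H1) (rho : D -> bop H2)
    (x : A ⊙ D) : bop K :=
  \sum_(p <- repr x) op_tensor K (pi p.1) (rho p.2).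

End asymptotic.

Section tensor_norms.
Context {R : realType} {A D : cstarAlgebra R}.
Implicit Types x : A ⊙ D.

Definition min_norm x : \bar R :=
  ereal_sup [set r | exists (H1 H2 : hilbertSpace R) (K : hilbertTensor H1 H2)
      (pi : A -> bop H1) (rho : D -> bop H2),
    [/\ star_hom pi, star_hom rho & r = (rnorm (spatial_tensor K pi rho x))%:E]].

Definition max_norm x : \bar R :=
  ereal_sup [set r | exists (H : hilbertSpace R) (pi : A ⊙ D -> bop H),
    star_hom pi /\ r = (rnorm (pi x))%:E].

Definition sigma_norm x : \bar R :=
  ereal_sup [set r | exists (H1 H2 : hilbertSpace R) (K : hilbertTensor H1 H2)
      (mu : R -> A -> bop H1) (nu : R -> D -> bop H2),
    [/\ separable H1, separable H2, asymptotic_hom mu, asymptotic_hom nu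
      & r = quotient_norm (asymptotic_tensor K mu nu x)]].

Definition lambda_norm x : \bar R :=
  ereal_sup [set r | exists (H1 H2 : hilbertSpace R) (K : hilbertTensor H1 H2)
      (mu : R -> A -> bop H1) (nu : D -> bop H2),
    [/\ separable H1, separable H2, asymptotic_hom mu, star_hom nu
      & r = quotient_norm (asymptotic_tensor K mu (fun=> nu) x)]].

End tensor_norms.
Arguments min_norm {R} A D x.
Arguments max_norm {R} A D x.
Arguments sigma_norm {R} A D x.
Arguments lambda_norm {R} A D x.

(* Main.v *)
Require Import Defs.
From HB Require Import structures.
From mathcomp Require Import all_boot all_order all_algebra.
From mathcomp Require Import complex.
From mathcomp Require Import finmap ring lra.
From mathcomp Require Import all_classical all_reals all_analysis.
Set Implicit Arguments.
Unset Strict Implicit.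
Unset Printing Implicit Defensive.
Import Order.TTheory GRing.Theory Num.Theory numFieldNormedType.Exports.
Local Open Scope classical_set_scope.
Local Open Scope ring_scope.
Local Open Scope complex_scope.

(** Both halves compare a large value of a tensor Σ a_i ⊗ d_i, of order n, with an
    upper bound of order √n, where a_i or d_i are n involutions that act like the
    generators of a free product of n groups of order 2.

    The upper bound. Move the vertices of the n-regular tree along its edges of colour
    i by the involution U_i. For matrices t_i of norm at most tau the operator
    Σ U_i ⊗ t_i has norm at most 2 √n tau (tree_sum_le): an edge of the tree is the
    first edge towards a root of exactly one of its two ends, which splits the sum into
    a part with orthogonal ranges and a part with orthogonal sources
    (two_projections_bound). If an algebra contains matrix units e_j besides p U_i p,
    with p = e_0^* e_0, then all these sums belong to it, and every representation pi
    and all contractions T_i satisfy |Σ pi(p U_i p) ⊗ T_i| <= sup_t |Σ U_i ⊗ t_i|,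
    because the T_i can be compressed to scalar matrices (tensor_bound_left and
    tensor_bound_right). The contractions T_i are arbitrary here, and this is what makes
    the bound hold for asymptotic representations on the other side.

    The maximal norm. On the maps x of the tree into itself, composition with the
    generators after and before x gives commuting families L_i and S_i. The identity map
    is fixed by each L_i S_i, so that Σ S_i ⊗ L_i has maximal norm at least n
    (max_left_right_ge). In an asymptotic tensor product with genuine representations of
    the algebra D of the L_i and the matrix units, the S_i become asymptotically
    contractive, hence the left norm is at most 2 √n (lambda_left_right_le).

    The minimal norm. Now let the generators act on the permutations of the finite balls
    of the tree. There the vector Σ_x δ_x ⊗ δ_x over one ball is fixed by each U_i ⊗ U_i,
    so that Σ U_i ⊗ U_i has norm n already in the spatial tensor product. The involutions
    U_i are therefore replaced, at stage m, by b_i = p g^* U_i p, where g is a positive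
    damping operator adapted to the m-th finite set of test matrices t: it nearly kills the
    vectors on which a high power of Y Y^* is large, Y = Σ U_i ⊗ t_i, and hence
    Σ b_i ⊗ t_i has norm O(√n) for these t. On a basis vector δ_x, with x in a ball much
    larger than the power, Y Y^* only sees a piece of a tree; there g does little, and
    Σ b_i ⊗ U_i keeps norm at least n/3 (damped_stage). Joining the stages by segments
    gives paths whose classes modulo paths vanishing at infinity generate, together with
    the matrix units, the algebra A; D is generated by the U_i. All test matrices are
    under control at infinity, which bounds the minimal norm of Σ b_i ⊗ U_i
    (min_limit_le). Evaluating representatives at time t is an asymptotic representation
    of A which passes through every stage, so that the left norm, and with it the
    symmetric norm, is at least n/3 (evaluate_limit_ge). *)

(** * Square-summable families *)

Definition nsq (R : realType) (z : R[i]) : R :=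
  complex.Re z ^+ 2 + complex.Im z ^+ 2.

Section nsq.
Context {R : realType}.
Implicit Types (z w c : R[i]).

Lemma nsq_ge0 z : 0 <= nsq z.
Proof. by rewrite addr_ge0// sqr_ge0. Qed.

Lemma nsqM z w : nsq (z * w) = nsq z * nsq w.
Proof. by case: z w => [a b] [c d]; rewrite /nsq/=; ring. Qed.

Lemma nsqD_le z w : nsq (z + w) <= 2 * nsq z + 2 * nsq w.
Proof.
case: z w => [a b] [c d]; rewrite /nsq/=.
have := sqr_ge0 (a - c); have := sqr_ge0 (b - d); lra.
Qed.

Lemma nsq_normc z : Normc.normc z = Num.sqrt (nsq z).
Proof. by case: z. Qed.

Lemma nsq_eq0 z : nsq z = 0 -> z = 0.
Proof. by move=> z0; apply: Normc.eq0_normc; rewrite nsq_normc z0 sqrtr0. Qed.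

Lemma conj_RC (t : R) : Num.conj t%:C = t%:C.
Proof. exact: conjc_real. Qed.

Lemma nsq_RC (t : R) : nsq t%:C = t ^+ 2.
Proof. by rewrite /nsq/= expr0n addr0. Qed.

Lemma normc_RC (t : R) : 0 <= t -> Normc.normc t%:C = t.
Proof. by move=> t0; rewrite nsq_normc nsq_RC sqrtr_sqr ger0_norm. Qed.

Lemma Re_sum (J : Type) (r : seq J) (P : pred J) (F : J -> R[i]) :
  complex.Re (\sum_(j <- r | P j) F j) = \sum_(j <- r | P j) complex.Re (F j).
Proof. exact: (big_morph _ (@ReD R) (erefl : complex.Re 0 = 0)). Qed.

Lemma mulJ_nsq z : z * Num.conj z = (nsq z)%:C.
Proof.
by case: z => a b; apply/eqP; rewrite eq_complex /nsq/=; apply/andP; split;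
  apply/eqP; ring.
Qed.

End nsq.

Section ell2.
Context {R : realType} {I : choiceType}.
Implicit Types (f g h : I -> R[i]^o) (A B : {fset I}) (c : R[i]) (x y : I).

Definition psq f A : R := \sum_(x <- A) nsq (f x).

Lemma psq_ge0 f A : 0 <= psq f A.
Proof. by apply: sumr_ge0 => x _; exact: nsq_ge0. Qed.

Lemma psq_mono f A B : (A `<=` B)%fset -> psq f A <= psq f B.
Proof.
move=> AB; rewrite /psq [leRHS](big_fsetID _ (mem A))/=.
have -> : [fset x | x in B & x \in A]%fset = A.
  by apply/fsetP => x; rewrite !inE/= andbC; case: (boolP (x \in A)) => //= /(fsubsetP AB).
by rewrite lerDl; apply: sumr_ge0 => x _; exact: nsq_ge0.
Qed.

Definition square_summable : {pred I -> R[i]^o} :=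
  fun f => `[< exists M : R, forall A, psq f A <= M >].

Lemma square_summable_submod : GRing.submod_closed square_summable.
Proof.
split=> [|c f g /asboolP[M fM] /asboolP[N gN]]; apply/asboolP.
  by exists 0 => A; rewrite /psq big1// => x _; rewrite /nsq/= expr0n addr0.
exists (2 * (nsq c * M) + 2 * N) => A.
apply: (@le_trans _ _ (2 * (nsq c * psq f A) + 2 * psq g A)).
  rewrite /psq !mulr_sumr -big_split/=; apply: ler_sum => x _.
  by rewrite !fctE (le_trans (nsqD_le _ _))// [c *: f x]/(c * f x) nsqM.
by rewrite lerD// ler_wpM2l// ler_wpM2l ?nsq_ge0.
Qed.

HB.instance Definition _ :=
  GRing.isSubmodClosed.Build R[i] (I -> R[i]^o) square_summable square_summable_submod.

End ell2.
Arguments square_summable {R} I.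

Record ell2 (R : realType) (I : choiceType) :=
  Ell2 { ell2_fun :> I -> R[i]^o; ell2_subproof : ell2_fun \in square_summable I }.

HB.instance Definition _ (R : realType) (I : choiceType) :=
  [isSub for @ell2_fun R I].
HB.instance Definition _ (R : realType) (I : choiceType) :=
  [Choice of ell2 R I by <:].
HB.instance Definition _ (R : realType) (I : choiceType) :=
  [SubChoice_isSubLmodule of ell2 R I by <:].

(** Sums over an arbitrary index set are limits along the finite subsets. *)
Definition finsets (I : choiceType) : set_system {fset I} :=
  filter_from setT (fun A => [set B | A `<=` B]%fset).

#[global] Instance finsets_filter (I : choiceType) : ProperFilter (@finsets I).
Proof.
apply: filter_from_proper; last by move=> A _; exists A => /=.
apply: filter_fromT_filter; first by exists fset0.
by move=> A B; exists (A `|` B)%fset => C /=; rewrite fsubUset => /andP[].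
Qed.

Definition ccvg (R : realType) (T : Type) (F : set_system T) (u : T -> R[i]) (l : R[i]) :=
  (complex.Re (u t) @[t --> F] --> complex.Re l) /\
  (complex.Im (u t) @[t --> F] --> complex.Im l).

Section ccvg.
Context {R : realType} {T : Type} {F : set_system T} {FF : ProperFilter F}.
Implicit Types (u v : T -> R[i]) (k l c : R[i]).

Lemma ccvg_unique u k l : ccvg F u k -> ccvg F u l -> k = l.
Proof.
move=> [uk uk'] [ul ul'].
have := cvg_unique (@norm_hausdorff _ _) uk ul.
have := cvg_unique (@norm_hausdorff _ _) uk' ul'.
by case: k l {uk uk' ul ul'} => [a b] [a' b'] /= -> ->.
Qed.

Lemma ccvgD u v k l : ccvg F u k -> ccvg F v l -> ccvg F (fun t => u t + v t) (k + l).
Proof.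
move=> [uk uk'] [vl vl']; split.
  rewrite ReD; under eq_fun do rewrite ReD; exact: cvgD.
have E (a b : R[i]) : complex.Im (a + b) = complex.Im a + complex.Im b.
  by case: a b => [? ?] [? ?].
by rewrite E; under eq_fun do rewrite E; exact: cvgD.
Qed.

Lemma ccvgM u v k l : ccvg F u k -> ccvg F v l -> ccvg F (fun t => u t * v t) (k * l).
Proof.
have E1 (a b : R[i]) : complex.Re (a * b) =
    complex.Re a * complex.Re b - complex.Im a * complex.Im b.
  by case: a b => [? ?] [? ?].
have E2 (a b : R[i]) : complex.Im (a * b) =
    complex.Re a * complex.Im b + complex.Im a * complex.Re b.
  by case: a b => [? ?] [? ?].
move=> [uk uk'] [vl vl']; split.
  by rewrite E1; under eq_fun do rewrite E1; apply: cvgB; exact: cvgM.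
by rewrite E2; under eq_fun do rewrite E2; apply: cvgD; exact: cvgM.
Qed.

Lemma ccvg_cst l : ccvg F (fun=> l) l.
Proof. by split; exact: cvg_cst. Qed.

Lemma ccvg_conj u l : ccvg F u l -> ccvg F (fun t => (u t)^*) l^*.
Proof.
move=> [ul ul'].
have E1 (z : R[i]) : complex.Re z^* = complex.Re z by case: z.
have E2 (z : R[i]) : complex.Im z^* = - complex.Im z by case: z.
split; first by rewrite E1; under eq_fun do rewrite E1.
by rewrite E2; under eq_fun do rewrite E2; exact: cvgN.
Qed.

End ccvg.

Section ell2_inner.
Context {R : realType} {I : choiceType}.
Local Notation H := (ell2 R I).
Implicit Types (f g h : H) (A B : {fset I}) (c : R[i]) (x y : I).

Lemma ell2E f g : f =1 g -> f = g.
Proof. by move=> fg; apply: val_inj; apply/funext. Qed.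

Lemma ell2_addE f g x : (f + g : H) x = f x + g x.
Proof. by []. Qed.

Lemma ell2_oppE f x : (- f : H) x = - f x.
Proof. by []. Qed.

Lemma ell2_scaleE c f x : (c *: f : H) x = c * f x.
Proof. by []. Qed.

Definition ell2_sq f : R := sup (range (psq f)).

Lemma ell2_has_sup f : has_sup (range (psq f)).
Proof.
have /asboolP[M fM] := ell2_subproof f.
by split; [exists (psq f fset0), fset0|exists M => _ [A _ <-]].
Qed.

Lemma psq_le f A : psq f A <= ell2_sq f.
Proof. by apply: (sup_upper_bound (ell2_has_sup f)); exists A. Qed.

Lemma ell2_sq_le f (M : R) : (forall A, psq f A <= M) -> ell2_sq f <= M.
Proof.
move=> fM; apply: ge_sup; first by case: (ell2_has_sup f).
by move=> _ [A _ <-].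
Qed.

Lemma ell2_sq_ge0 f : 0 <= ell2_sq f.
Proof. exact: le_trans (psq_ge0 f fset0) (psq_le f fset0). Qed.

Lemma psq_cvg f : psq f A @[A --> @finsets I] --> ell2_sq f.
Proof.
apply/cvgrPdist_lt => e e0.
have [_ [A _ <-] fA] := sup_adherent e0 (ell2_has_sup f).
exists A => // B /= AB; rewrite ger0_norm ?subr_ge0 ?psq_le//.
by rewrite ltrBlDr -ltrBlDl (lt_le_trans fA)// psq_mono.
Qed.

Definition ell2_pair (f g : H) A : R[i] := \sum_(x <- A) f x * (g x)^*.

Lemma Re_pair f g A :
  complex.Re (ell2_pair f g A) = (psq (f + g : H) A - psq (f - g : H) A) / 4.
Proof.
rewrite /psq -sumrB mulr_suml /ell2_pair.
rewrite Re_sum; apply: eq_bigr => x _.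
rewrite !ell2_addE ell2_oppE.
by case: (f x) (g x) => [a b] [c d]; rewrite /nsq /=; field.
Qed.

Lemma Im_pair f g A :
  complex.Im (ell2_pair f g A) = complex.Re (ell2_pair f ('i *: g : H) A).
Proof.
rewrite /ell2_pair.
have ImD (a b : R[i]) : complex.Im (a + b) = complex.Im a + complex.Im b.
  by case: a b => [? ?] [? ?].
rewrite Re_sum (big_morph _ (id1 := 0) ImD)//.
apply: eq_bigr => x _; rewrite ell2_scaleE.
by case: (f x) (g x) => [a b] [c d] /=; ring.
Qed.

Definition ell2_re f g : R := (ell2_sq (f + g) - ell2_sq (f - g)) / 4.

(** By polarization, so that only suprema of sums of squares are taken; ell2_pair_cvg
    identifies it with the limit of the finite sums. *)
Definition ell2_inner f g : R[i] := ell2_re f g +i* ell2_re f ('i *: g).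

Lemma ell2_pair_cvg f g : ccvg (@finsets I) (ell2_pair f g) (ell2_inner f g).
Proof.
have E f' g' : complex.Re (ell2_pair f' g' A) @[A --> @finsets I] --> ell2_re f' g'.
  under eq_fun do rewrite Re_pair.
  by apply: cvgM; [apply: cvgB; exact: psq_cvg|exact: cvg_cst].
by split=> /=; [|under eq_fun do rewrite Im_pair]; exact: E.
Qed.

Lemma ell2_innerC f g : ell2_inner g f = (ell2_inner f g)^*.
Proof.
apply: ccvg_unique (ell2_pair_cvg g f) _.
suff -> : ell2_pair g f = (fun A => (ell2_pair f g A)^*).
  exact: ccvg_conj (ell2_pair_cvg f g).
apply/funext => A.
rewrite /ell2_pair rmorph_sum; apply: eq_bigr => x _.
by rewrite rmorphM /= conjcK mulrC.
Qed.

Lemma ell2_inner_linear h : linear_for *%R (fun f => ell2_inner f h).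
Proof.
move=> c f g; apply: ccvg_unique (ell2_pair_cvg _ h) _.
suff -> : ell2_pair (c *: f + g) h = (fun A => c * ell2_pair f h A + ell2_pair g h A).
  exact: ccvgD (ccvgM (ccvg_cst c) (ell2_pair_cvg f h)) (ell2_pair_cvg g h).
apply/funext => A; rewrite /ell2_pair mulr_sumr -big_split.
by apply: eq_bigr => x _; rewrite ell2_addE ell2_scaleE [LHS]mulrDl mulrA.
Qed.

Lemma ell2_inner_sq f : ell2_inner f f = (ell2_sq f)%:C.
Proof.
apply: ccvg_unique (ell2_pair_cvg f f) _.
have E A : ell2_pair f f A = (psq f A)%:C.
  by rewrite /psq rmorph_sum; apply: eq_bigr => x _; rewrite mulJ_nsq.
by split=> /=; under eq_fun do rewrite E /=; [exact: psq_cvg|exact: cvg_cst].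
Qed.

Lemma nsq_le f x : nsq (f x) <= ell2_sq f.
Proof. by have := psq_le f [fset x]%fset; rewrite /psq big_seq_fset1. Qed.

Lemma ell2_sq_eq0 f : ell2_sq f = 0 -> f = 0.
Proof.
move=> f0; apply: ell2E => x; apply: nsq_eq0; apply/le_anti.
by rewrite nsq_ge0 andbT -f0 nsq_le.
Qed.

Lemma ell2_innerDl f g h : ell2_inner (f + g) h = ell2_inner f h + ell2_inner g h.
Proof. by have := ell2_inner_linear h 1 f g; rewrite scale1r mul1r. Qed.

Lemma ell2_innerZl c f h : ell2_inner (c *: f) h = c * ell2_inner f h.
Proof.
have h0 : ell2_inner 0 h = 0.
  by have := ell2_inner_linear h (-1) 0 0; rewrite scaler0 addr0 mulN1r addNr.
by have := ell2_inner_linear h c f 0; rewrite addr0 h0 addr0.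
Qed.

Lemma ell2_innerDr f g h : ell2_inner h (f + g) = ell2_inner h f + ell2_inner h g.
Proof. by rewrite !(ell2_innerC _ h) ell2_innerDl rmorphD. Qed.

Lemma ell2_innerZr c f h : ell2_inner h (c *: f) = c^* * ell2_inner h f.
Proof. by rewrite !(ell2_innerC _ h) ell2_innerZl rmorphM. Qed.

Lemma ell2_sqZ c f : ell2_sq (c *: f) = nsq c * ell2_sq f.
Proof.
apply: (@complexI R).
by rewrite -ell2_inner_sq ell2_innerZl ell2_innerZr mulrA mulJ_nsq ell2_inner_sq rmorphM.
Qed.

Lemma ell2_sqD f g :
  ell2_sq (f + g) = ell2_sq f + 2 * ell2_re f g + ell2_sq g.
Proof.
have E z : ell2_sq z = complex.Re (ell2_inner z z) by rewrite ell2_inner_sq.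
rewrite !E ell2_innerDl !ell2_innerDr (ell2_innerC f g) -/(complex.Re (ell2_inner f g)).
rewrite (_ : ell2_re f g = complex.Re (ell2_inner f g))//.
by case: (ell2_inner f f) (ell2_inner f g) (ell2_inner g g) => [a b] [c d] [? ?] /=; ring.
Qed.

(** The quadratic polynomial t |-> |f + t g|^2 is nonnegative; look at its minimum. *)
Lemma ell2_re_le f g : ell2_re f g <= Num.sqrt (ell2_sq f) * Num.sqrt (ell2_sq g).
Proof.
have [g0|g0] := eqVneq (ell2_sq g) 0.
  rewrite (ell2_sq_eq0 g0) /ell2_re addr0 subr0 subrr mul0r.
  by rewrite mulr_ge0// sqrtr_ge0.
have {}g0 : 0 < ell2_sq g by rewrite lt_neqAle eq_sym g0 ell2_sq_ge0.
rewrite -sqrtrM ?ell2_sq_ge0//; have [r0|r0] := leP (ell2_re f g) 0.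
  by rewrite (le_trans r0)// sqrtr_ge0.
rewrite -(ler_sqr (ltW r0 : _ \in Num.nneg)) ?nnegrE ?sqrtr_ge0//.
rewrite sqr_sqrtr ?mulr_ge0 ?ell2_sq_ge0//.
have := ell2_sq_ge0 (f + (- (ell2_re f g / ell2_sq g))%:C *: g).
rewrite ell2_sqD ell2_sqZ.
have -> : ell2_re f ((- (ell2_re f g / ell2_sq g))%:C *: g) =
    - (ell2_re f g / ell2_sq g) * ell2_re f g.
  by rewrite -[LHS]/(complex.Re (ell2_inner f _)) ell2_innerZr conj_RC ReZ.
rewrite nsq_RC.
set r := ell2_re f g; set F := ell2_sq f; set G := ell2_sq g in g0 *.
have -> : F + 2 * (- (r / G) * r) + (- (r / G)) ^+ 2 * G = (F * G - r ^+ 2) / G.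
  by field; rewrite gt_eqF.
by rewrite pmulr_lge0 ?invr_gt0// subr_ge0.
Qed.

Let norm f : R[i] := (Num.sqrt (ell2_sq f))%:C.

Let normD f g : norm (f + g) <= norm f + norm g.
Proof.
rewrite /norm -rmorphD lecR.
rewrite -ler_sqr ?nnegrE ?addr_ge0 ?sqrtr_ge0// sqr_sqrtr ?ell2_sq_ge0//.
rewrite sqrrD !sqr_sqrtr ?ell2_sq_ge0// ell2_sqD lerD2r lerD2l -[leRHS]mulr_natl.
by rewrite ler_wpM2l// ell2_re_le.
Qed.

Let normZ c f : norm (c *: f) = `|c| * norm f.
Proof.
rewrite /norm ell2_sqZ sqrtrM ?nsq_ge0// rmorphM; congr (_ * _).
by case: c.
Qed.

Let norm0_eq0 f : norm f = 0 -> f = 0.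
Proof.
move=> [/eqP]; rewrite sqrtr_eq0 => f0; apply: ell2_sq_eq0.
by apply/le_anti; rewrite f0 ell2_sq_ge0.
Qed.

HB.instance Definition _ :=
  Lmodule_isNormed.Build R[i] H normD normZ norm0_eq0.

Lemma ell2_rnormE f : rnorm f = Num.sqrt (ell2_sq f).
Proof. by []. Qed.

Lemma ell2_rnorm_sq f : rnorm f ^+ 2 = ell2_sq f.
Proof. by rewrite ell2_rnormE sqr_sqrtr ?ell2_sq_ge0. Qed.

Lemma ell2_coord_le f x : Normc.normc (f x) <= rnorm f.
Proof. by rewrite nsq_normc ell2_rnormE ler_sqrt ?ell2_sq_ge0// nsq_le. Qed.

End ell2_inner.

(** * Completeness through Cauchy sequences *)

Section cauchy_sequences.
Context {R : realType} {V : normedModType R[i]}.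
Implicit Types (u : nat -> V) (l : V).

Definition cauchy_seq u := forall e : R, 0 < e ->
  exists N, forall m n, (N <= m)%N -> (N <= n)%N -> rnorm (u m - u n) < e.

Definition tends_to u l := forall e : R, 0 < e ->
  exists N, forall n, (N <= n)%N -> rnorm (u n - l) < e.

Lemma invS_gt0 (k : nat) : 0 < k.+1%:R^-1 :> R.
Proof. by rewrite invr_gt0 ltr0n. Qed.

Lemma invS_lt (e : R) : 0 < e -> exists N, forall n, (N <= n)%N -> n.+1%:R^-1 < e.
Proof.
move=> e0; have [N _ NE] := near_infty_natSinv_lt (PosNum e0).
by exists N => n Nn; have := NE n Nn.
Qed.

Lemma cauchy_rnorm (F : set_system V) : ProperFilter F -> cauchy F ->
  forall e : R, 0 < e -> exists x, F [set y | rnorm (x - y) < e].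
Proof.
move=> FF /cauchyP Fc e e0; have [|x Fx] := Fc e%:C; first by rewrite ltcR.
by exists x; apply: filterS Fx => y; rewrite -ball_normE /ball_/= norm_lt_rnorm.
Qed.

Lemma cvg_rnormP (T : Type) (F : set_system T) (FF : Filter F)
    (f : T -> V) (l : V) :
  f @ F --> l <-> forall e : R, 0 < e -> F [set s | rnorm (l - f s) < e].
Proof.
split=> [fl e e0|fl].
  have /cvgrPdist_lt/(_ e%:C) := fl; rewrite ltcR => /(_ e0).
  by apply: filterS => s; rewrite norm_lt_rnorm.
apply/cvgrPdist_lt => e e0.
have eE : e = (complex.Re e)%:C by rewrite RRe_real// gtr0_real.
have {}e0 : 0 < complex.Re e by rewrite -ltcR -eE.
by apply: filterS (fl _ e0) => s /=; rewrite [in X in _ -> X]eE norm_lt_rnorm.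
Qed.

(** A Cauchy filter is within 1 / (k + 1) of some point x_k; a limit of the sequence x
    is a limit of the filter. *)
Lemma complete_of_cauchy_seq :
    (forall u, cauchy_seq u -> exists l, tends_to u l) ->
  forall F : set_system V, ProperFilter F -> cauchy F -> cvg F.
Proof.
move=> Vc F FF Fc.
have /choice[u Fu] : forall k : nat, exists x, F [set y | rnorm (x - y) < k.+1%:R^-1].
  by move=> k; apply: cauchy_rnorm => //; exact: invS_gt0.
have [l ul] : exists l, tends_to u l.
  apply: Vc => e e0; have [N NE] := invS_lt (divr_gt0 e0 (ltr0n _ 2 : 0 < 2)).
  exists N => m n /NE mE /NE nE; have [y [/= ym yn]] := filter_ex (filterI (Fu m) (Fu n)).
  rewrite -(subrKA y) (le_lt_trans (rnormD _ _))// [ltRHS]splitr ltrD//.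
    exact: lt_trans mE.
  by rewrite rnormB (lt_trans yn).
apply/cvg_ex; exists l; apply: (cvg_rnormP FF id l).2 => e e0.
have e2 : 0 < e / 2 by rewrite divr_gt0.
have [N NE] := invS_lt e2; have [N' NE'] := ul _ e2.
pose k := maxn N N'; apply: filterS (Fu k) => y /= ky.
rewrite -(subrKA (u k)) (le_lt_trans (rnormD _ _))// [ltRHS]splitr ltrD//.
  by rewrite rnormB NE'// leq_maxr.
by rewrite (lt_trans ky)// NE// leq_maxl.
Qed.

Lemma tends_to_unique u l l' : tends_to u l -> tends_to u l' -> l = l'.
Proof.
move=> ul ul'; apply/eqP; rewrite -subr_eq0; apply/eqP/rnorm_eq0/le_anti.
rewrite rnorm_ge0 andbT; apply/ler_addgt0Pr => e e0; rewrite add0r.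
have e2 : 0 < e / 2 by rewrite divr_gt0.
have [N NE] := ul _ e2; have [N' NE'] := ul' _ e2; pose k := maxn N N'.
rewrite -(subrKA (u k)) (le_trans (rnormD _ _))// ltW// [ltRHS]splitr ltrD//.
  by rewrite rnormB NE// leq_maxl.
by rewrite NE'// leq_maxr.
Qed.

End cauchy_sequences.

Lemma cauchy_seq_cvg (R : realType) (V : completeNormedModType R[i]) (u : nat -> V) :
  cauchy_seq u -> exists l, tends_to u l.
Proof.
move=> uc; have : cvg (u @ \oo).
  apply: cauchy_cvg; apply: cauchy_exP => e e0.
  have eE : e = (complex.Re e)%:C by rewrite RRe_real// gtr0_real.
  have {e0} : 0 < complex.Re e by rewrite -ltcR -eE.
  rewrite {}eE; move: (complex.Re e) => {}e /uc[N NE].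
  exists (u N); exists N => // n /= Nn.
  by rewrite -ball_normE /ball_/= norm_lt_rnorm NE.
move/cvg_ex => [l ul]; exists l => e e0.
have /cvgrPdist_lt/(_ e%:C) := ul; rewrite ltcR => /(_ e0)[N _ NE].
by exists N => n Nn; have := NE n Nn; rewrite /= norm_lt_rnorm rnormB.
Qed.

Lemma cvg_sum_seq (R : realType) (T : Type) (F : set_system T) (FF : Filter F)
    (J : Type) (r : seq J) (f : J -> T -> R) (l : J -> R) :
  (forall j, f j t @[t --> F] --> l j) ->
  \sum_(j <- r) f j t @[t --> F] --> \sum_(j <- r) l j.
Proof.
move=> fl; elim: r => [|j r IHr].
  by rewrite big_nil; under eq_fun do rewrite big_nil; exact: cvg_cst.
by rewrite big_cons; under eq_fun do rewrite big_cons; exact: cvgD.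
Qed.

Lemma ccvg_complete (R : realType) (z : nat -> R[i]) :
    (forall e : R, 0 < e -> exists N, forall m n, (N <= m)%N -> (N <= n)%N ->
      Normc.normc (z m - z n) < e) ->
  exists l, ccvg \oo z l.
Proof.
have cR (r : nat -> R) : (forall e : R, 0 < e -> exists N, forall m n, (N <= m)%N ->
    (N <= n)%N -> `|r m - r n| < e) -> exists l : R, r n @[n --> \oo] --> l.
  move=> rc; suff /cvg_ex[l rl] : cvg (r n @[n --> \oo]) by exists l.
  apply: cauchy_cvg; apply: cauchy_exP => e /rc[N NE].
  by exists (r N); exists N => // n /= Nn; rewrite -ball_normE /ball_/= NE.
have Rle (w : R[i]) : `|complex.Re w| <= Normc.normc w.
  case: w => a b /=; rewrite -sqrtr_sqr ler_sqrt ?addr_ge0 ?sqr_ge0//.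
  by rewrite lerDl sqr_ge0.
have Ile (w : R[i]) : `|complex.Im w| <= Normc.normc w.
  case: w => a b /=; rewrite -sqrtr_sqr ler_sqrt ?addr_ge0 ?sqr_ge0//.
  by rewrite lerDr sqr_ge0.
move=> zc; have [|a za] := cR (fun n => complex.Re (z n)).
  move=> e /zc[N NE]; exists N => m n Nm Nn; apply: le_lt_trans (NE m n Nm Nn).
  by apply: le_trans (Rle _); case: (z m) (z n) => [? ?] [? ?].
have [|b zb] := cR (fun n => complex.Im (z n)).
  move=> e /zc[N NE]; exists N => m n Nm Nn; apply: le_lt_trans (NE m n Nm Nn).
  by apply: le_trans (Ile _); case: (z m) (z n) => [? ?] [? ?].
by exists (a +i* b).
Qed.

Section ell2_complete.
Context {R : realType} {I : choiceType}.
Local Notation H := (ell2 R I).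

(** The coordinatewise limit L: finite partial sums of |u_n - L|^2 are limits of those of
    |u_n - u_m|^2, hence small uniformly in the finite set. *)
Lemma ell2_cauchy_seq (u : nat -> H) : cauchy_seq u -> exists l, tends_to u l.
Proof.
move=> uc.
have /choice[L uL] : forall x, exists l, ccvg \oo (fun n => u n x) l.
  move=> x; apply: ccvg_complete => e /uc[N NE]; exists N => m n Nm Nn.
  exact: le_lt_trans (ell2_coord_le (u m - u n) x) (NE m n Nm Nn).
have bound (e : R) n (A : {fset I}) : (\forall m \near \oo, rnorm (u n - u m) <= e) ->
    psq (fun x => u n x - L x) A <= e ^+ 2.
  move=> ume; have cv : psq (fun x => u n x - u m x) A @[m --> \oo] -->
      psq (fun x => u n x - L x) A.
    apply: cvg_sum_seq => x; have [Re_u Im_u] :=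
      ccvgD (ccvg_cst (u n x)) (ccvgM (ccvg_cst (-1)) (uL x)).
    rewrite /nsq -mulN1r; under eq_fun do rewrite -mulN1r.
    by apply: cvgD; apply: cvgM.
  apply: (cvgr_to_le cv); apply: filterS ume => m um.
  apply: le_trans (psq_le (u n - u m) A) _; rewrite -ell2_rnorm_sq.
  by rewrite lerXn2r// nnegrE ?rnorm_ge0// (le_trans (rnorm_ge0 _) um).
have near_u (e : R) : 0 < e -> exists N, forall n, (N <= n)%N ->
    \forall m \near \oo, rnorm (u n - u m) <= e.
  move=> /uc[N NE]; exists N => n Nn; exists N => // m /= Nm.
  by rewrite ltW// NE.
have [N NE] := near_u 1 ltr01.
have dL : (fun x => u N x - L x) \in square_summable I.
  by apply/asboolP; exists (1 ^+ 2) => A; exact: bound (NE N (leqnn N)).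
pose l : H := u N - Ell2 dL.
have lE x : l x = L x by rewrite ell2_addE ell2_oppE /= subKr.
exists l => e e0; have e2 : 0 < e / 2 by rewrite divr_gt0.
have [N' NE'] := near_u _ e2; exists N' => n Nn.
apply: (@le_lt_trans _ _ (e / 2)); last by rewrite ltr_pdivrMr// ltr_pMr// ltr1n.
rewrite -ler_sqr ?nnegrE ?rnorm_ge0 ?(ltW e2)// ell2_rnorm_sq; apply: ell2_sq_le => A.
apply: le_trans (bound _ _ A (NE' n Nn)); rewrite /psq.
by apply: ler_sum => x _; rewrite ell2_addE ell2_oppE lE.
Qed.

HB.instance Definition _ := Uniform_isComplete.Build H
  (complete_of_cauchy_seq ell2_cauchy_seq).

Lemma ell2_inner_bilinear :
  @bilinear_for R[i] H H R[i] *%R (Num.conj \; *%R) (@ell2_inner R I).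
Proof.
split=> [g c f f'|f c g g']; first exact: ell2_inner_linear.
by rewrite ell2_innerDr ell2_innerZr.
Qed.

HB.instance Definition _ := bilinear_isBilinear.Build R[i] H H R[i]
  *%R (Num.conj \; *%R) (@ell2_inner R I) ell2_inner_bilinear.

Let inner_herm (f g : H) : ell2_inner f g = (-1) ^+ false * Num.conj (ell2_inner g f).
Proof. by rewrite expr0 mul1r ell2_innerC. Qed.

HB.instance Definition _ := isHermitianSesquilinear.Build R[i] H false (@Num.conj R[i])
  (@ell2_inner R I) inner_herm.

Let inner_pos (f : H) : f != 0 -> 0 < ell2_inner f f.
Proof.
move=> f0; rewrite ell2_inner_sq ltcE/= eqxx/= lt_neqAle ell2_sq_ge0 andbT eq_sym.
by apply: contraNN f0 => /eqP/ell2_sq_eq0/eqP.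
Qed.

HB.instance Definition _ := isDotProduct.Build R[i] H (@ell2_inner R I) inner_pos.

Let inner_normE (f : H) : ell2_inner f f = `|f| ^+ 2.
Proof. by rewrite ell2_inner_sq rnormE -rmorphXn ell2_rnorm_sq. Qed.

HB.instance Definition _ := isHilbert.Build R H inner_normE.

Lemma ell2_innerE (f g : H) : inner f g = ell2_inner f g.
Proof. by []. Qed.

End ell2_complete.

Section dense.
Context {R : realType}.

Lemma dense_rnormP (V : normedModType R[i]) (S : set V) :
  (forall (x : V) (e : R), 0 < e -> exists2 s, S s & rnorm (x - s) < e) <-> dense S.
Proof.
split=> [Sd O [x Ox] Oo|Sd x e e0].
  have : nbhs x O by apply: open_nbhs_nbhs; split.
  move=> /nbhs_normP[e /= e0 eO].
  have eE : e = (complex.Re e)%:C by rewrite RRe_real// gtr0_real.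
  have {}e0 : 0 < complex.Re e by rewrite -ltcR -eE.
  have [s Ss xs] := Sd x _ e0; exists s; split=> //; apply: eO => /=.
  by rewrite /ball_/= eE norm_lt_rnorm.
have e0C : (0 : R[i]) < e%:C by rewrite ltcR.
have [y [xy Sy]] := Sd _ (ex_intro _ x (ballxx x e0C)) (ball_open x _).
have {}xy : ball x e%:C y by exact: xy.
by exists y => //; move: xy; rewrite -ball_normE /ball_/= norm_lt_rnorm.
Qed.

Definition ratc (q : rat * rat) : R[i] := ratr q.1 +i* ratr q.2.

Lemma normc_le_sum (z : R[i]) : Normc.normc z <= `|complex.Re z| + `|complex.Im z|.
Proof.
rewrite nsq_normc -[leRHS]ger0_norm ?addr_ge0// -sqrtr_sqr ler_wsqrtr//.
rewrite sqrrD !real_normK ?num_real// /nsq lerD2r lerDl.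
by rewrite mulrn_wge0// mulr_ge0.
Qed.

Lemma ratc_dense (z : R[i]) (e : R) : 0 < e ->
  exists q, Normc.normc (z - ratc q) < e.
Proof.
move=> e0; have e2 : 0 < e / 2 by rewrite divr_gt0.
have app (a : R) : exists q : rat, `|a - ratr q| < e / 2.
  have [|q] := @rat_in_itvoo R (a - e / 2) (a + e / 2).
    by rewrite ltrBlDr -addrA ltrDl addr_gt0.
  rewrite in_itv/= => /andP[q1 q2]; exists q; rewrite ltr_norml; apply/andP; split.
    by rewrite ltrNl opprB ltrBlDr addrC.
  by rewrite ltrBlDr addrC -ltrBlDr.
have [q qz] := app (complex.Re z); have [q' q'z] := app (complex.Im z).
exists (q, q'); apply: le_lt_trans (normc_le_sum _) _.
by case: z qz q'z => a b /= qz q'z; rewrite [ltRHS]splitr ltrD.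
Qed.

End dense.

(** * Operators induced by partial bijections of the index set *)

(** A partial bijection together with its inverse, so that the induced operators are
    closed under composition and adjoints by construction. *)
Record pbij (I : Type) := PBij {
  pbij_fun :> I -> option I;
  pbij_inv : I -> option I;
  pbijP : forall x y, pbij_fun x = Some y <-> pbij_inv y = Some x }.

Lemma pinvP I (u : pbij I) x y : pbij_inv u x = Some y <-> u y = Some x.
Proof. exact: iff_sym (pbijP u y x). Qed.

Definition pinv I (u : pbij I) : pbij I := PBij (pinvP u).

Lemma pcompP I (u v : pbij I) x y :
  obind v (u x) = Some y <-> obind (pinv u) (pinv v y) = Some x.
Proof.
split.
  case ux : (u x) => [z|]//= vz; have /pbijP := vz => /= ->/=.
  exact/pbijP.
rewrite /=; case vy : (pbij_inv v y) => [z|]//= uz; have /pbijP := uz => ->/=.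
exact/pbijP.
Qed.

Definition pcomp I (u v : pbij I) : pbij I := PBij (pcompP u v).

Section partial_bijection_operators.
Context {R : realType} {I : choiceType}.
Local Notation H := (ell2 R I).
Implicit Types (f g : H) (u v : pbij I) (x y : I) (c : R[i]).

Lemma psq_uniq_le f (s : seq I) : uniq s -> \sum_(x <- s) nsq (f x) <= ell2_sq f.
Proof.
move=> us; apply: le_trans (psq_le f (seq_fset tt s)).
by rewrite /psq (perm_big _ (seq_fset_perm tt s)) undup_id.
Qed.

Lemma pmap_pbij_uniq u (s : seq I) : uniq s -> uniq (pmap u s).
Proof.
elim: s => //= x s IHs /andP[xs us]; case ux : (pbij_fun u x) => [y|] /=; last exact: IHs.
rewrite IHs// andbT mem_pmap; apply: contraNN xs => /mapP[x' x's ux'].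
suff -> : x = x' by [].
by move/pbijP: ux => ux; move/esym/pbijP: ux'; rewrite ux => -[].
Qed.

Lemma psq_pbij f u (A : {fset I}) :
  psq (fun x => oapp f 0 (u x)) A <= ell2_sq f.
Proof.
apply: le_trans (psq_uniq_le f (pmap_pbij_uniq u (fset_uniq A))).
rewrite /psq; elim: (enum_fset A) => [|x s IHs]; first by rewrite !big_nil.
rewrite big_cons /=; case: (pbij_fun u x) => [y|] /=; first by rewrite big_cons lerD2l.
by rewrite /nsq/= expr0n addr0 add0r.
Qed.

Lemma pop_summable u f : (fun x => oapp f 0 (u x)) \in square_summable I.
Proof. by apply/asboolP; exists (ell2_sq f) => A; exact: psq_pbij. Qed.

Definition pop_fun u f : H := Ell2 (pop_summable u f).

Lemma rnorm_pop_fun u f : rnorm (pop_fun u f) <= rnorm f.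
Proof.
rewrite -ler_sqr ?nnegrE ?rnorm_ge0// !ell2_rnorm_sq.
by apply: ell2_sq_le => A; exact: psq_pbij.
Qed.

Lemma pop_bounded u : pop_fun u \in bounded_operator H.
Proof.
apply/asboolP; split=> [c f g|]; last first.
  by exists 1 => f; rewrite mul1r rnorm_pop_fun.
apply: ell2E => x; rewrite ell2_addE ell2_scaleE /=.
by case: (pbij_fun u x) => [y|] /=; rewrite ?mulr0 ?addr0.
Qed.

Definition pop u : bop H := Bop (pop_bounded u).

Lemma popE u f x : pop u f x = oapp f 0 (u x).
Proof. by []. Qed.

Lemma rnorm_pop u f : rnorm (pop u f) <= rnorm f.
Proof. exact: rnorm_pop_fun. Qed.

Lemma eq_pop u v : u =1 v -> pop u = pop v.
Proof. by move=> uv; apply: bopE => f; apply: ell2E => x; rewrite !popE uv. Qed.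

Lemma pop_comp u v : amul (pop u) (pop v) = pop (pcomp u v).
Proof.
apply: bopE => f; apply: ell2E => x; rewrite -[LHS]/(pop u (pop v f) x) !popE /=.
by case: (pbij_fun u x).
Qed.

Lemma delta_summable x : (fun y => (y == x)%:R : R[i]^o) \in square_summable I.
Proof.
apply/asboolP; exists 1 => A; rewrite /psq.
have nsqb (b : bool) : nsq (b%:R : R[i]) = b%:R by case: b; rewrite /nsq/=; ring.
under eq_bigr => y _ do rewrite nsqb.
have [xA|xA] := boolP (x \in A).
  rewrite (big_fsetD1 x)//= eqxx big_seq big1 ?addr0// => y.
  by rewrite !inE => /andP[/negbTE ->].
rewrite big_seq big1// => y yA; case: eqP => // yx; by rewrite yx (negbTE xA) in yA.
Qed.

Definition delta x : H := Ell2 (delta_summable x).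

Arguments delta : simpl never.
Arguments pop : simpl never.

Lemma deltaE x y : delta x y = (y == x)%:R.
Proof. by []. Qed.

Lemma inner_delta f x : inner f (delta x) = f x.
Proof.
rewrite ell2_innerE; apply: ccvg_unique (ell2_pair_cvg f (delta x)) _.
have E (A : {fset I}) : x \in A -> ell2_pair f (delta x) A = f x.
  move=> xA; rewrite /ell2_pair (big_fsetD1 x xA) deltaE eqxx conjC1 mulr1.
  rewrite big_seq big1 => [|y]; first exact: addr0.
  by rewrite deltaE !inE => /andP[/negbTE -> _]; rewrite conjC0 mulr0.
have nE : \forall A \near @finsets I, ell2_pair f (delta x) A = f x.
  by exists [fset x]%fset => // A /= xA; rewrite E// (fsubsetP xA)// inE.
by split; apply: cvg_near_cst; apply: filterS nE => A ->.
Qed.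

Lemma rnorm_delta x : rnorm (delta x) = 1.
Proof.
apply/eqP; rewrite -(@eqrXn2 _ 2)// ?rnorm_ge0// expr1n; apply/eqP.
by apply: (@complexI R); rewrite -inner_rnorm inner_delta deltaE eqxx.
Qed.

Lemma pop_delta u x : pop u (delta x) = oapp delta 0 (pinv u x).
Proof.
apply: ell2E => y; rewrite popE /=; case uy : (pbij_fun u y) => [z|] /=.
  rewrite ?deltaE; have [zx|zx] := eqVneq z x.
    by rewrite zx in uy; move/pbijP: uy => /= -> /=; rewrite ?deltaE eqxx.
  case vx : (pbij_inv u x) => [y'|]//=; rewrite ?deltaE.
  case: eqP => // yy'; move/pinvP: vx; rewrite -yy' uy => -[zx'].
  by rewrite zx' eqxx in zx.
case vx : (pbij_inv u x) => [y'|]//=; rewrite ?deltaE; case: eqP => // yy'.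
by move/pinvP: vx; rewrite -yy' uy.
Qed.

Lemma pop_star u : astar (pop u) = pop (pinv u).
Proof.
apply: bopE => f; apply: ell2E => x.
rewrite -inner_delta [astar _]/(adjoint _) adjointE.
have -> : adjoint (adjoint (pop u)) = pop u by exact: astarK.
rewrite pop_delta popE; case: (pinv u x) => [y|] /=.
  by rewrite inner_delta.
by rewrite linear0r.
Qed.

Definition pid : pbij I := @PBij I Some Some
  (fun x y => conj (fun '(erefl) => erefl) (fun '(erefl) => erefl)).

Lemma pop_id : pop pid = bop_id H.
Proof. by apply: bopE => f; apply: ell2E. Qed.

End partial_bijection_operators.
Arguments delta R {I} x : simpl never.
Arguments pop R {I} u : simpl never.

Section ell2_density.
Context {R : realType} {I : choiceType}.
Local Notation H := (ell2 R I).

Lemma ell2_sum_deltaE (s : seq I) (c : I -> R[i]) (y : I) :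
  (\sum_(x <- s) c x *: delta R x : H) y = \sum_(x <- s) c x * (y == x)%:R.
Proof.
elim: s => [|x s IHs]; first by rewrite !big_nil.
by rewrite !big_cons ell2_addE IHs ell2_scaleE.
Qed.

Lemma psqID (f : I -> R[i]^o) (A B : {fset I}) :
  psq f B = psq f (B `&` A)%fset + psq f (B `\` A)%fset.
Proof.
rewrite /psq (big_fsetID _ (mem A))/=; congr (_ + _);
  by apply: eq_fbigl => y; rewrite !inE// andbC.
Qed.

Lemma finite_approx (f : H) (e : R) : 0 < e ->
  exists A : {fset I}, rnorm (f - \sum_(x <- A) f x *: delta R x) < e.
Proof.
move=> e0; have e2 : 0 < e ^+ 2 / 2 by rewrite divr_gt0// exprn_gt0.
have [_ [A _ <-] fA] := sup_adherent e2 (ell2_has_sup f).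
exists A; rewrite -ltr_sqr ?nnegrE ?rnorm_ge0 ?ltW// ell2_rnorm_sq.
apply: (@le_lt_trans _ _ (e ^+ 2 / 2)); last by rewrite ltr_pdivrMr// ltr_pMr ?exprn_gt0// ltr1n.
apply: ell2_sq_le => B.
apply: (@le_trans _ _ (psq f (A `|` B)%fset - psq f A)); last first.
  by rewrite lerBlDl -lerBlDr (le_trans _ (ltW fA))// lerD2r psq_le.
have E y : (f - \sum_(x <- A) f x *: delta R x : H) y = if y \in A then 0 else f y.
  rewrite ell2_addE ell2_oppE ell2_sum_deltaE.
  have [yA|yA] := boolP (y \in A).
    rewrite (big_fsetD1 y)//= eqxx mulr1 big_seq big1 ?addr0 ?subrr// => x.
    by rewrite !inE eq_sym => /andP[/negbTE -> _]; rewrite mulr0.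
  rewrite big_seq big1 ?subr0// => x xA; case: eqP => [yx|]; last by rewrite mulr0.
  by rewrite yx xA in yA.
rewrite lerBrDr; apply: (@le_trans _ _ (psq f (B `\` A)%fset + psq f A)).
  rewrite lerD2r (psqID _ A B) [X in X + _](_ : _ = 0) ?add0r; last first.
    rewrite /psq big_seq big1// => y; rewrite inE => /andP[_ yA].
    by rewrite E yA /nsq/= expr0n addr0.
  rewrite /psq big_seq [leRHS]big_seq; apply: ler_sum => y; rewrite inE E.
  by move=> /andP[/negbTE ->].
rewrite (psqID f A (A `|` B)%fset) addrC.
have -> : ((A `|` B) `&` A = A)%fset.
  by apply/fsetP => y; rewrite !inE; case: (y \in A); rewrite ?andbF ?andbT.
by rewrite fsetDUl fsetDv fset0U.
Qed.

End ell2_density.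

Section ell2_separable.
Context {R : realType} {I : countType}.
Local Notation H := (ell2 R I).

Lemma ell2_separable : separable H.
Proof.
pose F (s : seq (I * (rat * rat))) : H := \sum_(p <- s) (ratc p.2 : R[i]) *: delta R p.1.
exists (range F); first by apply: sub_countable (card_image_le _ _) _; exact: countableP.
apply/dense_rnormP => f e e0; have e2 : 0 < e / 2 by rewrite divr_gt0.
have [A fA] := finite_approx f e2.
suff [s sE] : exists s, rnorm (\sum_(x <- A) f x *: delta R x - F s) < e / 2.
  exists (F s); first by exists s.
  by rewrite -(subrKA (\sum_(x <- A) f x *: delta R x)) (le_lt_trans (rnormD _ _))//
    [ltRHS]splitr ltrD.
elim: (enum_fset A) (e / 2) e2 => [|x s IHs] d d0.
  by exists [::]; rewrite /F !big_nil subr0 rnorm0.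
have d2 : 0 < d / 2 by rewrite divr_gt0.
have [t tE] := IHs _ d2; have [q qE] := ratc_dense (f x) d2.
exists ((x, q) :: t); rewrite /F !big_cons opprD addrACA -scalerBl.
rewrite (le_lt_trans (rnormD _ _))// [ltRHS]splitr ltrD//.
by rewrite rnormZ rnorm_delta mulr1.
Qed.

End ell2_separable.

(** * The Hilbert tensor product of two l2 spaces *)

Lemma big_fsetX (V : nmodType) (I J : choiceType) (A : {fset I}) (B : {fset J})
    (F : I * J -> V) :
  \sum_(p <- (A `*` B)%fset) F p = \sum_(x <- A) \sum_(y <- B) F (x, y).
Proof.
rewrite (perm_big [seq (x, y) | x <- A, y <- B]); first by rewrite big_allpairs.
apply: uniq_perm; first exact: fset_uniq.
  by apply: allpairs_uniq; rewrite ?fset_uniq// => -[? ?] [? ?].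
move=> [x y]; rewrite in_fsetM; apply/andP/allpairsP => [[xA yB]|[p [pA pB [-> ->]]]] //.
by exists (x, y).
Qed.

Section ell2_tensor.
Context {R : realType} {I J : choiceType}.
Implicit Types (f : ell2 R I) (g : ell2 R J).

Lemma psq_prod_le (f : ell2 R I) (g : ell2 R J) (A : {fset I * J}) :
  psq (fun p => f p.1 * g p.2) A <= ell2_sq f * ell2_sq g.
Proof.
pose A1 := [fset p.1 | p in A]%fset; pose A2 := [fset p.2 | p in A]%fset.
have sub : (A `<=` A1 `*` A2)%fset.
  by apply/fsubsetP => p pA; rewrite inE; apply/andP; split; apply/imfsetP; exists p.
apply: le_trans (psq_mono _ sub) _.
apply: (@le_trans _ _ (psq f A1 * psq g A2)); last first.
  by rewrite ler_pM ?psq_ge0 ?psq_le.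
rewrite /psq big_fsetX /= mulr_suml; apply: ler_sum => x _.
by rewrite mulr_sumr; apply: ler_sum => y _; rewrite nsqM.
Qed.

Lemma ell2_tens_summable f g : (fun p => f p.1 * g p.2) \in square_summable (I * J)%type.
Proof. by apply/asboolP; exists (ell2_sq f * ell2_sq g); exact: psq_prod_le. Qed.

Definition ell2_tens f g : ell2 R (I * J)%type := Ell2 (ell2_tens_summable f g).

Lemma ell2_tensE f g p : ell2_tens f g p = f p.1 * g p.2.
Proof. by []. Qed.

Lemma ell2_tens_bilinear :
  @bilinear_for R[i] (ell2 R I) (ell2 R J) (ell2 R (I * J)%type) *:%R *:%R ell2_tens.
Proof.
split=> [g c f f'|f c g g']; apply: ell2E => p;
  rewrite ell2_addE ell2_scaleE !ell2_tensE ell2_addE ell2_scaleE.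
  by rewrite mulrDl mulrA.
by rewrite mulrDr mulrCA.
Qed.

HB.instance Definition _ := bilinear_isBilinear.Build R[i] (ell2 R I) (ell2 R J)
  (ell2 R (I * J)%type) *:%R *:%R ell2_tens ell2_tens_bilinear.

(** The finite rectangles are cofinal among the finite subsets of a product, which lets
    a double limit compute the inner product of elementary tensors. *)
Lemma fsetX_cofinal : (p.1 `*` p.2)%fset @[p --> (@finsets I, @finsets J)] -->
  @finsets (I * J)%type.
Proof.
move=> U [S _ SU].
exists ([set B | [fset p.1 | p in S] `<=` B]%fset, [set B | [fset p.2 | p in S] `<=` B]%fset).
  split=> /=; first by exists [fset p.1 | p in S]%fset.
  by exists [fset p.2 | p in S]%fset.
move=> [A B] /= [SA SB]; apply: SU => /=; apply/fsubsetP => p pS; rewrite inE.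
apply/andP; split; [apply: (fsubsetP SA)|apply: (fsubsetP SB)];
  by apply/imfsetP; exists p.
Qed.

Lemma ell2_inner_tens f f' g g' :
  inner (ell2_tens f g) (ell2_tens f' g') = inner f f' * inner g g'.
Proof.
rewrite !ell2_innerE.
pose F := filter_prod (@finsets I) (@finsets J).
have FF : ProperFilter F by exact: filter_prod_proper.
apply: (@ccvg_unique R _ F _ (fun p => ell2_pair f f' p.1 * ell2_pair g g' p.2)).
  have E : (fun p => ell2_pair f f' p.1 * ell2_pair g g' p.2) =
    (fun p : {fset I} * {fset J} => ell2_pair (ell2_tens f g) (ell2_tens f' g') (p.1 `*` p.2)%fset).
    apply/funext => -[A B] /=; rewrite /ell2_pair big_fsetX/= mulr_suml.
    apply: eq_bigr => x _; rewrite mulr_sumr; apply: eq_bigr => y _.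
    by rewrite rmorphM mulrACA.
  have [Rc Ic] := ell2_pair_cvg (ell2_tens f g) (ell2_tens f' g').
  by rewrite E; split; [apply: (cvg_comp _ _ fsetX_cofinal Rc)|
                        apply: (cvg_comp _ _ fsetX_cofinal Ic)].
have [Rf If] := ell2_pair_cvg f f'; have [Rg Ig] := ell2_pair_cvg g g'.
apply: ccvgM.
  by split; [apply: (cvg_comp _ _ cvg_fst Rf)|apply: (cvg_comp _ _ cvg_fst If)].
by split; [apply: (cvg_comp _ _ cvg_snd Rg)|apply: (cvg_comp _ _ cvg_snd Ig)].
Qed.

Lemma ell2_tens_delta x y : ell2_tens (delta R x) (delta R y) = delta R (x, y).
Proof.
by apply: ell2E => -[x' y']; rewrite ell2_tensE !deltaE xpair_eqE/= -natrM mulnb.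
Qed.

Lemma ell2_tens_dense :
  dense [set \sum_(p <- s) ell2_tens p.1 p.2 | s in [set: seq (ell2 R I * ell2 R J)]].
Proof.
apply/dense_rnormP => f e /(finite_approx f)[A fA]; exists (\sum_(p <- A) f p *: delta R p) => //.
exists [seq (f p *: delta R p.1, delta R p.2) | p <- A] => //.
rewrite big_map; apply: eq_bigr => -[x y] _ /=.
rewrite -ell2_tens_delta; apply: ell2E => q.
by rewrite ell2_scaleE !ell2_tensE ell2_scaleE mulrA.
Qed.

Definition ell2_hilbertTensor : hilbertTensor (ell2 R I) (ell2 R J) :=
  @HilbertTensor R _ _ (ell2 R (I * J)%type) ell2_tens
    (fun f f' g g' => ell2_inner_tens f f' g g') ell2_tens_dense.

End ell2_tensor.

(** * Operators on Hilbert tensor products *)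

Section bounded_extension.
Context {R : realType} {K : hilbertSpace R}.
Implicit Types (z w : K) (G : K -> K -> Prop).

(** A densely defined bounded linear operator, given by its graph, extends to the
    whole space: the closure of the graph is again the graph of a function. *)
Lemma bounded_extension G (M : R) : 0 <= M ->
    (forall c z w z' w', G z w -> G z' w' -> G (c *: z + z') (c *: w + w')) ->
    (forall z w, G z w -> rnorm w <= M * rnorm z) ->
    dense [set z | exists w, G z w] ->
  exists U : bop K, (forall z w, G z w -> U z = w) /\
                    (forall z, rnorm (U z) <= M * rnorm z).
Proof.
move=> M0 GL GM /dense_rnormP Gd.
pose cl z w := forall e : R, 0 < e ->
  exists z' w', [/\ G z' w', rnorm (z - z') < e & rnorm (w - w') < e].
have clL c z w z' w' : cl z w -> cl z' w' -> cl (c *: z + z') (c *: w + w').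
  move=> zw zw' e e0; have c1 : 0 < Normc.normc c + 1 by rewrite ltr_wpDl ?normc_ge0.
  have [|x [y [Gxy zx wy]]] := zw (e / (Normc.normc c + 1) / 2); first by rewrite !divr_gt0.
  have [|x' [y' [Gxy' zx' wy']]] := zw' (e / 2); first by rewrite divr_gt0.
  have est (a b a' b' : K) : rnorm (a - b) < e / (Normc.normc c + 1) / 2 ->
      rnorm (a' - b') < e / 2 -> rnorm (c *: a + a' - (c *: b + b')) < e.
    move=> ab ab'; rewrite opprD addrACA -scalerBr (le_lt_trans (rnormD _ _))//.
    rewrite rnormZ [ltRHS]splitr ler_ltD//.
    apply: (@le_trans _ _ ((Normc.normc c + 1) * (e / (Normc.normc c + 1) / 2))).
      by rewrite ler_pM ?normc_ge0 ?rnorm_ge0 ?lerDl// ltW.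
    by rewrite mulrA [_ * (e / _)]mulrC divfK ?gt_eqF.
  by exists (c *: x + x'), (c *: y + y'); split; [exact: GL|exact: est|exact: est].
have clM z w : cl z w -> rnorm w <= M * rnorm z.
  move=> zw; apply/ler_addgt0Pr => e e0; have M1 : 0 < M + 1 by rewrite ltr_wpDl.
  have [|x [y [Gxy zx wy]]] := zw (e / (M + 1)); first by rewrite divr_gt0.
  rewrite -(subrK y w) (le_trans (rnormD _ _))//.
  apply: (@le_trans _ _ (e / (M + 1) + M * (rnorm z + e / (M + 1)))).
    rewrite lerD ?(ltW wy)// (le_trans (GM _ _ Gxy))// ler_wpM2l//.
    by rewrite -(subrK z x) (le_trans (rnormD _ _))// addrC lerD2l rnormB ltW.
  have : e / (M + 1) * (M + 1) = e by rewrite divfK ?gt_eqF.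
  by set t := e / _; lra.
have cl_ex z : exists w, cl z w.
  have /choice[x xE] : forall n : nat, exists x, (exists w, G x w) /\ rnorm (z - x) < n.+1%:R^-1.
    by move=> n; have [x [w Gxw] zx] := Gd z _ (invS_gt0 n); exists x; split=> //; exists w.
  have /choice[y yE] : forall n, exists y, G (x n) y by move=> n; case: (xE n).
  have GB n m : G (x n - x m) (y n - y m).
    by have := GL (-1) _ _ _ _ (yE m) (yE n); rewrite !scaleN1r ![- _ + _]addrC.
  have M1 : 0 < M + 1 by rewrite ltr_wpDl.
  have xz (e : R) : 0 < e -> exists N, forall n, (N <= n)%N -> rnorm (z - x n) < e.
    by move=> /invS_lt[N NE]; exists N => n /NE; apply: lt_trans; case: (xE n).
  have [|w yw] := @cauchy_seq_cvg _ _ y.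
    move=> e e0; have [|N NE] := xz (e / (M + 1) / 2); first by rewrite !divr_gt0.
    exists N => m n Nm Nn; apply: le_lt_trans (GM _ _ (GB m n)) _.
    apply: (@le_lt_trans _ _ (M * (e / (M + 1)))).
      rewrite ler_wpM2l// -(subrKA z) (le_trans (rnormD _ _))// [leRHS]splitr.
      by rewrite lerD// ltW// ?NE// rnormB NE.
    rewrite mulrA ltr_pdivrMr// mulrDr mulr1 mulrC ltrDl//.
  exists w => e e0; have [N NE] := xz e e0; have [N' NE'] := yw e e0.
  exists (x (maxn N N')), (y (maxn N N')); split=> //.
    by rewrite NE// leq_maxl.
  by rewrite rnormB NE'// leq_maxr.
have cl_unique z w w' : cl z w -> cl z w' -> w = w'.
  move=> zw zw'; have /clM := clL (-1) _ _ _ _ zw' zw.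
  rewrite !scaleN1r addNr rnorm0 mulr0 => ww'; apply/eqP.
  rewrite -subr_eq0 addrC; apply/eqP/rnorm_eq0/le_anti.
  by rewrite ww' rnorm_ge0.
have /choice[U UE] := cl_ex.
have Ub : U \in bounded_operator K.
  apply/asboolP; split; last by exists M => z; exact: clM.
  by move=> c z z'; apply: cl_unique (UE _) _; exact: clL.
exists (Bop Ub); split=> [z w Gzw|z]; last exact: clM.
apply: cl_unique (UE _) _ => e e0; exists z, w; split=> //; by rewrite subrr rnorm0.
Qed.

End bounded_extension.

Section gram_schmidt.
Context {R : realType} {H : hilbertSpace R}.

Lemma inner_suml (J : Type) (r : seq J) (P : pred J) (F : J -> H) (z : H) :
  inner (\sum_(i <- r | P i) F i) z = \sum_(i <- r | P i) inner (F i) z.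
Proof.
by apply: (big_morph (fun x => inner x z)) => [x y|]; rewrite ?innerDl ?linear0l.
Qed.

Lemma inner_sumr (J : Type) (r : seq J) (P : pred J) (F : J -> H) (z : H) :
  inner z (\sum_(i <- r | P i) F i) = \sum_(i <- r | P i) inner z (F i).
Proof.
by apply: (big_morph (fun x => inner z x)) => [x y|]; rewrite ?innerDr ?linear0r.
Qed.

Definition orthonormal k (e : nat -> H) :=
  forall i j, (i < k)%N -> (j < k)%N -> inner (e i) (e j) = (i == j)%:R.

Lemma gram_schmidt (s : seq H) : exists k (e : nat -> H), orthonormal k e /\
  forall y, y \in s -> y = \sum_(i < k) inner y (e i) *: e i.
Proof.
elim: s => [|y s [k [e [oe se]]]]; first by exists 0%N, (fun=> 0).
pose r := y - \sum_(i < k) inner y (e i) *: e i.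
have re i : (i < k)%N -> inner r (e i) = 0.
  move=> ik; rewrite linearBl /= inner_suml (bigD1 (Ordinal ik))//=.
  rewrite innerZl oe// eqxx mulr1 big1 ?addr0 ?subrr// => j ji.
  by rewrite innerZl oe// (negbTE (ji : (j : nat) != i)) mulr0.
have [r0|r0] := eqVneq r 0.
  exists k, e; split=> // z; rewrite inE => /predU1P[->|/se//].
  by apply/eqP; rewrite -subr_eq0; apply/eqP.
have nr0 : 0 < rnorm r.
  by rewrite lt_neqAle rnorm_ge0 andbT eq_sym; apply: contraNN r0 => /eqP/rnorm_eq0/eqP.
pose f := (rnorm r)^-1%:C *: r.
have ff : inner f f = 1.
  rewrite innerZl innerZr conj_RC inner_rnorm -!rmorphM.
  by rewrite (_ : _ * _ = 1) ?rmorph1//; field; rewrite gt_eqF.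
have fe i : (i < k)%N -> inner f (e i) = 0 by move=> ik; rewrite innerZl re// mulr0.
have ef i : (i < k)%N -> inner (e i) f = 0 by move=> ik; rewrite innerC fe// conjc0.
exists k.+1, (fun i => if i == k then f else e i); split=> [i j|z].
  rewrite !ltnS (leq_eqVlt i) (leq_eqVlt j) => /predU1P[->|ik] /predU1P[->|jk].
  - by rewrite eqxx ff.
  - by rewrite eqxx (ltn_eqF jk) fe// gtn_eqF.
  - by rewrite eqxx (ltn_eqF ik) ef.
  - by rewrite (ltn_eqF ik) (ltn_eqF jk) oe.
rewrite inE big_ord_recr /= eqxx => zs.
under eq_bigr => i _ do rewrite (ltn_eqF (ltn_ord i)).
case/predU1P: zs => [->|/se zE].
  rewrite -{1}[y](subrK (\sum_(i < k) inner y (e i) *: e i)) -/r addrC; congr (_ + _).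
  have -> : inner y f = (rnorm r)%:C.
    rewrite -[y](subrK (\sum_(i < k) inner y (e i) *: e i)) -/r innerDl.
    rewrite inner_suml big1 => [|i _]; last by rewrite innerZl ef// mulr0.
    rewrite addr0 innerZr conj_RC inner_rnorm -rmorphM.
    by congr _%:C; field; rewrite gt_eqF.
  by rewrite scalerA -rmorphM divff ?gt_eqF// scale1r.
have -> : inner z f = 0.
  by rewrite zE inner_suml big1// => i _; rewrite innerZl ef// mulr0.
by rewrite scale0r addr0 -zE.
Qed.

End gram_schmidt.

Section hilbert_tensor_flip.
Context {R : realType} {H1 H2 : hilbertSpace R} (K : hilbertTensor H1 H2).

(** The same tensor product with the factors exchanged, to transfer statements on left
    factors to right factors. *)
Definition flip_map (y : H2) (x : H1) : K := ht_map K x y.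

Lemma flip_bilinear : @bilinear_for R[i] H2 H1 K *:%R *:%R flip_map.
Proof. by split=> [x c y y'|y c x x']; rewrite /flip_map ?linearPl ?linearPr. Qed.

HB.instance Definition _ :=
  bilinear_isBilinear.Build R[i] H2 H1 K *:%R *:%R flip_map flip_bilinear.

Lemma inner_flip y y' x x' :
  inner (flip_map y x) (flip_map y' x') = inner y y' * inner x x'.
Proof. by rewrite inner_ht_map mulrC. Qed.

Lemma dense_flip :
  dense [set \sum_(p <- s) flip_map p.1 p.2 | s in [set: seq (H2 * H1)]].
Proof.
apply/dense_rnormP => z e e0.
have [_ [s _ <-] zs] := (dense_rnormP _).2 (@dense_ht_map _ _ _ K) z e e0.
exists (\sum_(p <- s) ht_map K p.1 p.2) => //.
by exists [seq (p.2, p.1) | p <- s] => //; rewrite big_map.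
Qed.

Definition ht_flip : hilbertTensor H2 H1 :=
  @HilbertTensor R H2 H1 K flip_map inner_flip dense_flip.

End hilbert_tensor_flip.

Section op_tensor_theory.
Context {R : realType} {H1 H2 : hilbertSpace R} (K : hilbertTensor H1 H2).
Implicit Types (S : bop H1) (T : bop H2) (x : H1) (y : H2) (s : seq (H1 * H2)).

Lemma ht_onb_sq k (e : nat -> H2) (z : nat -> H1) : orthonormal k e ->
  rnorm (\sum_(i < k) ht_map K (z i) (e i)) ^+ 2 = \sum_(i < k) rnorm (z i) ^+ 2.
Proof.
move=> oe; apply: (@complexI R); rewrite -inner_rnorm rmorph_sum inner_suml.
apply: eq_bigr => i _; rewrite inner_sumr (bigD1 i)//= inner_ht_map oe// eqxx mulr1.
rewrite big1 ?addr0 ?inner_rnorm// => j ji.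
by rewrite inner_ht_map oe// eq_sym (negbTE (ji : (j : nat) != i)) mulr0.
Qed.

(** Expanding the second factors in an orthonormal system makes a finite tensor sum
    orthogonal, and the expansion is compatible with operators on the first factor. *)
Lemma ht_onb s : exists k (e : nat -> H2) (z : nat -> H1), orthonormal k e /\
  forall S, \sum_(p <- s) ht_map K (S p.1) p.2 = \sum_(i < k) ht_map K (S (z i)) (e i).
Proof.
have [k [e [oe sE]]] := gram_schmidt (map snd s).
exists k, e, (fun i => \sum_(p <- s) inner p.2 (e i) *: p.1); split=> // S.
transitivity (\sum_(p <- s) \sum_(i < k) inner p.2 (e i) *: ht_map K (S p.1) (e i)).
  rewrite big_seq [RHS]big_seq; apply: eq_bigr => p ps.
  rewrite {1}(sE p.2) ?map_f// linear_sumr /=.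
  by apply: eq_bigr => i _; rewrite linearZr.
rewrite exchange_big; apply: eq_bigr => i _ /=.
rewrite linear_sum linear_sumlz; apply: eq_bigr => p _.
by rewrite linearZ linearZl_LR.
Qed.

Lemma sum_bop_left_le S s :
  rnorm (\sum_(p <- s) ht_map K (S p.1) p.2) <=
  opnorm S * rnorm (\sum_(p <- s) ht_map K p.1 p.2).
Proof.
have [k [e [z [oe sE]]]] := ht_onb s.
have -> : \sum_(p <- s) ht_map K p.1 p.2 = \sum_(i < k) ht_map K (z i) (e i).
  exact: (sE (bop_id H1)).
rewrite sE -ler_sqr ?nnegrE ?mulr_ge0 ?opnorm_ge0 ?rnorm_ge0// exprMn.
rewrite (ht_onb_sq (fun i => S (z i)) oe) (ht_onb_sq z oe) mulr_sumr.
apply: ler_sum => i _; rewrite -exprMn lerXn2r ?nnegrE ?rnorm_ge0 ?rnorm_bop//.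
by rewrite mulr_ge0 ?opnorm_ge0 ?rnorm_ge0.
Qed.

End op_tensor_theory.

Section op_tensor_theory.
Context {R : realType} {H1 H2 : hilbertSpace R} (K : hilbertTensor H1 H2).
Implicit Types (S : bop H1) (T : bop H2) (x : H1) (y : H2) (s : seq (H1 * H2)).

Lemma sum_bop_right_le T s :
  rnorm (\sum_(p <- s) ht_map K p.1 (T p.2)) <=
  opnorm T * rnorm (\sum_(p <- s) ht_map K p.1 p.2).
Proof.
by have := sum_bop_left_le (ht_flip K) T [seq (p.2, p.1) | p <- s]; rewrite !big_map.
Qed.

(** On the dense span of elementary tensors S ⊗ T is bounded as (S ⊗ 1)(1 ⊗ T). *)
Lemma op_tensor_ex S T : exists U : bop K,
  (forall x y, U (ht_map K x y) = ht_map K (S x) (T y)) /\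
  forall z, rnorm (U z) <= opnorm S * opnorm T * rnorm z.
Proof.
pose G (z w : K) := exists s, z = \sum_(p <- s) ht_map K p.1 p.2 /\
  w = \sum_(p <- s) ht_map K (S p.1) (T p.2).
have [|c z w z' w'|z w|z e e0|U [UG UM]] := @bounded_extension _ K G (opnorm S * opnorm T).
- by rewrite mulr_ge0 ?opnorm_ge0.
- move=> [s [-> ->]] [s' [-> ->]].
  exists ([seq (c *: p.1, p.2) | p <- s] ++ s'); rewrite !big_cat !big_map !scaler_sumr.
  by split; congr (_ + _); apply: eq_bigr => p _; rewrite ?linearZ/= linearZl_LR.
- move=> [s [-> ->]]; rewrite -mulrA.
  have := sum_bop_left_le K S [seq (p.1, T p.2) | p <- s]; rewrite !big_map /= => le1.
  by apply: le_trans le1 _; rewrite ler_wpM2l ?opnorm_ge0 ?sum_bop_right_le.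
- move: z e e0; apply/dense_rnormP => z e e0.
  have [_ [s _ <-] zs] := (dense_rnormP _).2 (@dense_ht_map _ _ _ K) z e e0.
  by exists (\sum_(p <- s) ht_map K p.1 p.2) => //; eexists; exists s.
exists U; split=> // x y; apply: UG; exists [:: (x, y)]; by rewrite !big_seq1.
Qed.

Lemma op_tensorE S T x y : op_tensor K S T (ht_map K x y) = ht_map K (S x) (T y).
Proof.
have [U [UE _]] := op_tensor_ex S T.
have : [set U : bop K | forall x y, U (ht_map K x y) = ht_map K (S x) (T y)] !=set0.
  by exists U.
by move=> /getPex; exact.
Qed.

Lemma bop_sum_ht (U : bop K) s :
  U (\sum_(p <- s) ht_map K p.1 p.2) = \sum_(p <- s) U (ht_map K p.1 p.2).
Proof. by rewrite linear_sum. Qed.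

Lemma bop_ht_le (U : bop K) (M : R) : 0 <= M ->
    (forall s, rnorm (\sum_(p <- s) U (ht_map K p.1 p.2)) <=
               M * rnorm (\sum_(p <- s) ht_map K p.1 p.2)) ->
  opnorm U <= M.
Proof.
move=> M0 UM; apply: opnorm_le => // z; apply/ler_addgt0Pr => e e0.
pose d := e / (opnorm U + M + 1).
have uM : 0 < opnorm U + M + 1 by rewrite ltr_wpDl// addr_ge0 ?opnorm_ge0.
have d0 : 0 < d by rewrite divr_gt0.
have [_ [s _ <-] zs] := (dense_rnormP _).2 (@dense_ht_map _ _ _ K) z d d0.
set v := \sum_(p <- s) _ in zs.
have Uv : rnorm (U v) <= M * rnorm v by rewrite bop_sum_ht UM.
have Uzv : rnorm (U z - U v) <= opnorm U * d.
  by rewrite -linearB (le_trans (rnorm_bop _ _))// ler_wpM2l ?opnorm_ge0// ltW.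
have vz : rnorm v <= rnorm z + d.
  by rewrite -[v](subrK z) (le_trans (rnormD _ _))// addrC lerD2l rnormB ltW.
rewrite -(subrK (U v) (U z)) (le_trans (rnormD _ _))//.
have Mv : M * rnorm v <= M * (rnorm z + d) by rewrite ler_wpM2l.
have dE : d * (opnorm U + M + 1) = e by rewrite divfK// gt_eqF.
have := ltW d0; nra.
Qed.

Lemma bop_ht_eq (U V : bop K) :
  (forall x y, U (ht_map K x y) = V (ht_map K x y)) -> U = V.
Proof.
move=> UV; apply/eqP; rewrite -subr_eq0; apply/eqP/rnorm_eq0.
apply/le_anti; rewrite rnorm_ge0 andbT bop_rnormE; apply: bop_ht_le => // s.
rewrite mul0r big1 ?rnorm0// => p _.
by rewrite bop_addE bop_oppE UV subrr.
Qed.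

Lemma opnorm_tensor S T : opnorm (op_tensor K S T) <= opnorm S * opnorm T.
Proof.
have [U [UE UM]] := op_tensor_ex S T.
have -> : op_tensor K S T = U by apply: bop_ht_eq => x y; rewrite op_tensorE UE.
by apply: opnorm_le => //; rewrite mulr_ge0 ?opnorm_ge0.
Qed.

Lemma op_tensor_mul S S' T T' :
  amul (op_tensor K S T) (op_tensor K S' T') = op_tensor K (amul S S') (amul T T').
Proof.
apply: bop_ht_eq => x y; rewrite op_tensorE.
by rewrite -[LHS]/(op_tensor K S T (op_tensor K S' T' _)) !op_tensorE.
Qed.

Lemma op_tensor_splitE S T :
  amul (op_tensor K S (bop_id H2)) (op_tensor K (bop_id H1) T) = op_tensor K S T.
Proof.
by rewrite op_tensor_mul; congr op_tensor; exact: bopE.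
Qed.

Lemma op_tensorDl S S' T : op_tensor K (S + S') T = op_tensor K S T + op_tensor K S' T.
Proof.
by apply: bop_ht_eq => x y; rewrite bop_addE !op_tensorE bop_addE linearDl.
Qed.

Lemma op_tensorDr S T T' : op_tensor K S (T + T') = op_tensor K S T + op_tensor K S T'.
Proof.
by apply: bop_ht_eq => x y; rewrite bop_addE !op_tensorE bop_addE linearDr.
Qed.

Lemma op_tensorZl c S T : op_tensor K (c *: S) T = c *: op_tensor K S T.
Proof.
by apply: bop_ht_eq => x y; rewrite bop_scaleE !op_tensorE bop_scaleE linearZl_LR.
Qed.

Lemma op_tensorZr c S T : op_tensor K S (c *: T) = c *: op_tensor K S T.
Proof.
by apply: bop_ht_eq => x y; rewrite bop_scaleE !op_tensorE bop_scaleE linearZr_LR.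
Qed.

Lemma op_tensor0l T : op_tensor K 0 T = 0.
Proof. by rewrite -(scale0r 0) op_tensorZl scale0r. Qed.

Lemma op_tensorBl S S' T : op_tensor K (S - S') T = op_tensor K S T - op_tensor K S' T.
Proof. by rewrite op_tensorDl -scaleN1r op_tensorZl scaleN1r. Qed.

End op_tensor_theory.

(** * C*-algebras: norms and contractivity of representations *)

Section cstar_basics.
Context {R : realType} {B : cstarAlgebra R}.
Implicit Types (x y z : B).

Lemma rnormM x y : rnorm (amul x y) <= rnorm x * rnorm y.
Proof. by rewrite -lecR rmorphM /= -!rnormE ler_normM. Qed.

Lemma rnorm_cstar x : rnorm (amul (astar x) x) = rnorm x ^+ 2.
Proof. by apply: (@complexI R); rewrite -rnormE norm_cstar rnormE rmorphXn. Qed.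

Lemma rnorm_star_le x : rnorm x <= rnorm (astar x).
Proof.
have [->|x0] := eqVneq (rnorm x) 0; first exact: rnorm_ge0.
have {}x0 : 0 < rnorm x by rewrite lt_neqAle eq_sym x0 rnorm_ge0.
by rewrite -(ler_pM2r x0) -expr2 -rnorm_cstar rnormM.
Qed.

Lemma rnorm_star x : rnorm (astar x) = rnorm x.
Proof.
apply/le_anti; rewrite rnorm_star_le andbT.
by have := rnorm_star_le (astar x); rewrite astarK.
Qed.

Lemma astarN x : astar (- x) = - astar x.
Proof. by rewrite -scaleN1r astarZ rmorphN rmorph1 scaleN1r. Qed.

Lemma astarB x y : astar (x - y) = astar x - astar y.
Proof. by rewrite astarD astarN. Qed.

Lemma amulNl x y : amul (- x) y = - amul x y.
Proof. by rewrite -scaleN1r amulZl scaleN1r. Qed.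

Lemma amulNr x y : amul x (- y) = - amul x y.
Proof. by rewrite -scaleN1r amulZr scaleN1r. Qed.

Lemma amulBl x y z : amul (x - y) z = amul x z - amul y z.
Proof. by rewrite amulDl amulNl. Qed.

Lemma amulBr x y z : amul z (x - y) = amul z x - amul z y.
Proof. by rewrite amulDr amulNr. Qed.

Lemma amul_suml (J : Type) (r : seq J) (P : pred J) (F : J -> B) x :
  amul (\sum_(i <- r | P i) F i) x = \sum_(i <- r | P i) amul (F i) x.
Proof.
by apply: (big_morph (fun y => amul y x)) => [y z|]; rewrite ?amulDl ?amul0l.
Qed.

Lemma amul_sumr (J : Type) (r : seq J) (P : pred J) (F : J -> B) x :
  amul x (\sum_(i <- r | P i) F i) = \sum_(i <- r | P i) amul x (F i).
Proof.
by apply: (big_morph (amul x)) => [y z|]; rewrite ?amulDr ?amul0r.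
Qed.

Lemma astar_sum (J : Type) (r : seq J) (P : pred J) (F : J -> B) :
  astar (\sum_(i <- r | P i) F i) = \sum_(i <- r | P i) astar (F i).
Proof.
by apply: (big_morph (@astar R B)) => [y z|]; rewrite ?astarD ?astar0.
Qed.

End cstar_basics.

Lemma bop_sum_apply (R : realType) (H : hilbertSpace R) (J : Type) (r : seq J) (P : pred J)
    (F : J -> bop H) (u : H) :
  (\sum_(j <- r | P j) F j) u = \sum_(j <- r | P j) F j u.
Proof. by apply: (big_morph (fun f : bop H => f u)). Qed.

Lemma rnorm_sum (R : realType) (V : normedModType R[i]) (J : Type) (r : seq J)
    (P : pred J) (F : J -> V) :
  rnorm (\sum_(i <- r | P i) F i) <= \sum_(i <- r | P i) rnorm (F i).
Proof.
apply: (big_ind2 (fun (x : V) (y : R) => rnorm x <= y)) => //.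
  by rewrite rnorm0.
by move=> x a y b xa yb; rewrite (le_trans (rnormD _ _))// lerD.
Qed.

Section geometric.
Context {R : realType} {V : normedModType R[i]}.

Lemma geometric_small (rho : R) (e : R) : 0 <= rho < 1 -> 0 < e ->
  exists N, forall n, (N <= n)%N -> rho ^+ n < e.
Proof.
move=> /andP[r0 r1] e0.
have rho1 : `|rho| < 1 by rewrite ger0_norm.
have /cvgrPdist_lt/(_ e e0)[N _ NE] := cvg_expr rho1.
by exists N => n Nn; have := NE n Nn; rewrite /= sub0r normrN ger0_norm ?exprn_ge0.
Qed.

Lemma geometric_cauchy_seq (u : nat -> V) (rho C : R) : 0 <= rho < 1 ->
  (forall n, rnorm (u n.+1 - u n) <= C * rho ^+ n) -> cauchy_seq u.
Proof.
move=> rho01 uC; have /andP[r0 r1] := rho01.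
have C0 : 0 <= C by have := uC 0%N; rewrite expr0 mulr1; apply: le_trans; exact: rnorm_ge0.
have r1' : 0 < 1 - rho by rewrite subr_gt0.
have dist n k : rnorm (u (n + k)%N - u n) <= C * rho ^+ n * (1 - rho ^+ k) / (1 - rho).
  elim: k => [|k IHk]; first by rewrite addn0 subrr rnorm0 expr0 subrr mulr0 mul0r.
  rewrite addnS -(subrKA (u (n + k)%N)) (le_trans (rnormD _ _))//.
  apply: (le_trans (lerD (uC _) IHk)).
  rewrite -subr_ge0 (_ : _ - _ = 0)// exprD exprS; field; by rewrite gt_eqF.
have distN n m : (n <= m)%N -> rnorm (u m - u n) <= C / (1 - rho) * rho ^+ n.
  move=> /subnKC <-; apply: le_trans (dist _ _) _.
  rewrite mulrAC [C / _ * _]mulrAC ler_piMr ?mulr_ge0 ?exprn_ge0 ?invr_ge0 ?(ltW r1')//.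
  by rewrite gerBl exprn_ge0.
move=> e e0; have C1 : 0 < C / (1 - rho) + 1 by rewrite ltr_wpDl// divr_ge0// ltW.
have [N NE] := geometric_small rho01 (divr_gt0 e0 C1).
have est n m : (N <= n)%N -> (n <= m)%N -> rnorm (u m - u n) < e.
  move=> Nn nm; apply: le_lt_trans (distN _ _ nm) _.
  have := NE n Nn; rewrite ltr_pdivlMr// => le1; apply: le_lt_trans le1.
  by rewrite mulrC ler_wpM2l ?exprn_ge0// lerDl.
exists N => m n Nm Nn; have [mn|/ltnW nm] := leqP m n; last exact: est.
by rewrite rnormB est.
Qed.

End geometric.

Section quadratic.
Context {R : realType} {B : cstarAlgebra R}.

(** The square root of 1 - z, written 1 - c so as to stay inside a non-unital algebra. *)
Lemma quadratic_root (z : B) : astar z = z -> rnorm z < 1 ->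
  exists c : B, astar c = c /\ c + c = z + amul c c.
Proof.
move=> zz z1; set q := rnorm z in z1.
have q0 : 0 <= q by exact: rnorm_ge0.
pose rho := 1 - Num.sqrt (1 - q).
have sq : Num.sqrt (1 - q) ^+ 2 = 1 - q by rewrite sqr_sqrtr ?subr_ge0 ?ltW.
have s0 : 0 < Num.sqrt (1 - q) by rewrite sqrtr_gt0 subr_gt0.
have s1 : Num.sqrt (1 - q) <= 1.
  by rewrite -[leRHS]sqrtr1 ler_wsqrtr// gerBl.
have rho0 : 0 <= rho by rewrite subr_ge0.
have rho1 : rho < 1 by rewrite /rho gtrBl.
have rhoE : 2^-1 * (q + rho * rho) = rho.
  rewrite /rho; move: (Num.sqrt _) sq => s sE.
  have -> : q = 1 - s ^+ 2 by rewrite sE; ring.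
  by field.
pose f (c : B) : B := (2^-1 : R)%:C *: (z + amul c c).
have rn (x : B) : rnorm ((2^-1 : R)%:C *: x) = 2^-1 * rnorm x.
  by rewrite rnormZ normc_RC ?invr_ge0.
pose u n := iter n f 0.
have u_le n : rnorm (u n) <= rho.
  elim: n => [|n IHn]; first by rewrite rnorm0.
  rewrite [u _]/(f (u n)) rn -[leRHS]rhoE ler_wpM2l ?invr_ge0//.
  rewrite (le_trans (rnormD _ _))// lerD2l (le_trans (rnormM _ _))//.
  by rewrite ler_pM ?rnorm_ge0.
have u_star n : astar (u n) = u n.
  elim: n => [|n IHn]; first by rewrite /= astar0.
  by rewrite [u _]/(f (u n)) astarZ astarD astarM IHn zz [X in X *: _]conj_RC.
have f_dist x y : rnorm x <= rho -> rnorm y <= rho ->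
    rnorm (f x - f y) <= rho * rnorm (x - y).
  move=> xr yr; rewrite /f -scalerBr opprD addrACA subrr add0r rn.
  have -> : amul x x - amul y y = amul x (x - y) + amul (x - y) y.
    by rewrite amulBr amulBl addrA subrK.
  rewrite ler_pdivrMl// (le_trans (rnormD _ _))//.
  have := rnormM x (x - y); have := rnormM (x - y) y.
  have := rnorm_ge0 (x - y); nra.
have uC : cauchy_seq u.
  apply: (@geometric_cauchy_seq _ _ u rho (rnorm (f 0))); first by rewrite rho0.
  elim=> [|n IHn]; first by rewrite expr0 mulr1 /= subr0.
  apply: (le_trans (f_dist (u n.+1) (u n) (u_le _) (u_le _))).
  by rewrite exprS mulrCA ler_wpM2l.
have [c uc] := cauchy_seq_cvg uC.
have c_le : rnorm c <= rho.
  apply/ler_addgt0Pr => e e0; have [N NE] := uc _ e0.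
  rewrite -(subrK (u N) c) (le_trans (rnormD _ _))// addrC lerD//.
  by rewrite rnormB ltW// NE.
have c_star : astar c = c.
  apply: (tends_to_unique _ uc) => e /uc[N NE]; exists N => n /NE.
  by rewrite -[in X in _ -> X]u_star -astarB rnorm_star.
have cf : f c = c.
  apply: (@tends_to_unique _ _ (fun n => u n.+1)) => e e0.
    have [N NE] := uc _ e0; exists N => n Nn; apply: le_lt_trans (NE n Nn).
    apply: (le_trans (f_dist (u n) c (u_le _) c_le)).
    by rewrite ler_piMl ?rnorm_ge0// ltW.
  by have [N NE] := uc _ e0; exists N => n Nn; apply: NE; exact: leqW.
exists c; split=> //; rewrite -[in LHS]cf /f -scalerDl.
rewrite (_ : _ + _ = 1) ?scale1r//.
by rewrite -rmorphD (_ : _ + _ = 1)//; field.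
Qed.

End quadratic.

Lemma innerBl (R : realType) (H : hilbertSpace R) (x y z : H) :
  inner (x - y) z = inner x z - inner y z.
Proof. by rewrite linearBl. Qed.

Section representations.
Context {R : realType} {B : cstarAlgebra R} {H : hilbertSpace R} (pi : B -> bop H).
Hypothesis pi_hom : star_hom pi.

Lemma star_homD x y : pi (x + y) = pi x + pi y.
Proof. by case: pi_hom => piL _ _; have := piL 1 x y; rewrite !scale1r. Qed.

Lemma star_hom0 : pi 0 = 0.
Proof. by case: pi_hom => piL _ _; have := piL (-1) 0 0; rewrite scaler0 addr0 scaleN1r addNr. Qed.

Lemma star_homZ c x : pi (c *: x) = c *: pi x.
Proof. by case: pi_hom => piL _ _; have := piL c x 0; rewrite star_hom0 !addr0. Qed.

Lemma star_homM x y : pi (amul x y) = amul (pi x) (pi y).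
Proof. by case: pi_hom. Qed.

Lemma star_homS x : pi (astar x) = astar (pi x).
Proof. by case: pi_hom. Qed.

Lemma star_hom_sum (J : Type) (r : seq J) (P : pred J) (F : J -> B) :
  pi (\sum_(i <- r | P i) F i) = \sum_(i <- r | P i) pi (F i).
Proof. by apply: (big_morph pi) => [x y|]; rewrite ?star_homD ?star_hom0. Qed.

Lemma rnorm_star_hom_sq x v :
  rnorm (pi x v) ^+ 2 = complex.Re (inner (pi (amul (astar x) x) v) v).
Proof.
rewrite star_homM star_homS -[bop_fun (amul _ _) v]/(adjoint (pi x) (pi x v)).
by rewrite adjointE [adjoint (adjoint _)](astarK (pi x)) inner_rnorm.
Qed.

(** With c as in quadratic_root for z = x^* x / M^2, the number M^2 |v|^2 exceeds
    |pi x v|^2 by M^2 |v - pi c v|^2. *)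
Lemma star_hom_contractive x v : rnorm (pi x v) <= rnorm x * rnorm v.
Proof.
suff bound (M : R) : rnorm x < M -> rnorm (pi x v) <= M * rnorm v.
  have [v0|v0] := eqVneq (rnorm v) 0.
    by have := bound (rnorm x + 1); rewrite v0 !mulr0; apply; rewrite ltrDl.
  have {}v0 : 0 < rnorm v by rewrite lt_neqAle eq_sym v0 rnorm_ge0.
  rewrite -ler_pdivrMr//; apply/ler_addgt0Pr => e e0.
  by rewrite ler_pdivrMr// bound// ltrDl.
move=> xM; have M0 : 0 < M by apply: le_lt_trans xM; exact: rnorm_ge0.
pose z := (M ^- 2)%:C *: amul (astar x) x.
have zz : astar z = z by rewrite astarZ astarM astarK [X in X *: _]conj_RC.
have z1 : rnorm z < 1.
  rewrite rnormZ normc_RC ?invr_ge0 ?exprn_ge0 ?ltW//.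
  by rewrite rnorm_cstar mulrC ltr_pdivrMr ?exprn_gt0// mul1r ltr_pXn2r// ?nnegrE ?rnorm_ge0// ltW.
have [c [cc cE]] := quadratic_root zz z1.
have xz : amul (astar x) x = (M ^+ 2)%:C *: z.
  by rewrite /z scalerA -rmorphM mulfV ?scale1r// expf_neq0// gt_eqF.
rewrite -ler_sqr ?nnegrE ?mulr_ge0 ?rnorm_ge0 ?(ltW M0)// rnorm_star_hom_sq xz.
rewrite star_homZ bop_scaleE innerZl ReZ exprMn ler_pM2l ?exprn_gt0//.
have -> : z = c + c - amul c c by rewrite cE addrK.
have piB a b : pi (a - b) = pi a - pi b.
  by rewrite -scaleN1r star_homD star_homZ scaleN1r.
have -> : inner (pi (c + c - amul c c) v) v =
    inner (pi c v) v + inner (pi c v) v - inner (pi c v) (pi c v).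
  rewrite piB star_homD star_homM bop_addE bop_oppE bop_addE innerBl innerDl.
  congr (_ - _); rewrite -[bop_fun (amul _ _) v]/(pi c (pi c v)) adjointE.
  by rewrite -[adjoint _]/(astar (pi c)) -star_homS cc.
have := sqr_ge0 (rnorm (v - pi c v)).
rewrite -scaleN1r rnormD_sqr innerZr rmorphN rmorph1 scaleN1r rnormN.
rewrite (innerC (pi c v) v) inner_rnorm mulN1r.
case: (inner (pi c v) v) => [a b] /=; lra.
Qed.

Lemma rep_projection_le p v : amul p p = p -> astar p = p -> rnorm (pi p v) <= rnorm v.
Proof.
move=> pp ps; have := rnorm_star_hom_sq p v; rewrite ps pp => E.
have := cauchy_schwarz (pi p v) v; rewrite -E expr2.
have [->|n0] := eqVneq (rnorm (pi p v)) 0; first by rewrite rnorm_ge0.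
by rewrite ler_pM2l// lt_neqAle eq_sym n0 rnorm_ge0.
Qed.

Lemma rep_partial_isometry_le x p v :
  amul (astar x) x = p -> amul p p = p -> astar p = p -> rnorm (pi x v) <= rnorm v.
Proof.
move=> xx pp ps; rewrite -ler_sqr ?nnegrE ?rnorm_ge0// rnorm_star_hom_sq xx.
apply: le_trans (cauchy_schwarz _ _) _.
by rewrite expr2 ler_wpM2r ?rnorm_ge0// rep_projection_le.
Qed.

End representations.

(** * The C*-subalgebra generated by a sequence *)

Definition ratc_nth (R : realType) (k : nat) : R[i] :=
  if choice.unpickle k is Some q then ratc q else 0.

Section generated.
Context {R : realType} {B : cstarAlgebra R} (g : nat -> B).
Implicit Types (x y : B) (c : R[i]) (t : GenTree.tree nat).

(** Trees encode the countably many *-polynomials in the g n with rational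
    coefficients. *)
Fixpoint eval_tree t : B :=
  match t with
  | GenTree.Leaf n => g n
  | GenTree.Node 0 [:: a; b] => eval_tree a + eval_tree b
  | GenTree.Node 1 [:: a; b] => amul (eval_tree a) (eval_tree b)
  | GenTree.Node 2 [:: a] => astar (eval_tree a)
  | GenTree.Node k.+3 [:: a] => ratc_nth R k *: eval_tree a
  | _ => 0
  end.

(** The closure of the countable set of rational *-polynomials is already a C*-algebra,
    and it is separable by construction. *)
Definition generated : {pred B} := fun x =>
  `[< forall e : R, 0 < e -> exists t, rnorm (x - eval_tree t) < e >].

Lemma generated_gen n : g n \in generated.
Proof. by apply/asboolP => e e0; exists (GenTree.Leaf n); rewrite subrr rnorm0. Qed.

Lemma generated0 : 0 \in generated.
Proof. by apply/asboolP => e e0; exists (GenTree.Node 0 [::]); rewrite subrr rnorm0. Qed.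

Lemma generatedD x y : x \in generated -> y \in generated -> x + y \in generated.
Proof.
move=> /asboolP xA /asboolP yA; apply/asboolP => e e0.
have e2 : 0 < e / 2 by rewrite divr_gt0.
have [s sx] := xA _ e2; have [t ty] := yA _ e2; exists (GenTree.Node 0 [:: s; t]) => /=.
by rewrite opprD addrACA (le_lt_trans (rnormD _ _))// [ltRHS]splitr ltrD.
Qed.

Lemma generatedZ c x : x \in generated -> c *: x \in generated.
Proof.
move=> /asboolP xA; apply/asboolP => e e0; have e2 : 0 < e / 2 by rewrite divr_gt0.
have x1 : 0 < rnorm x + 1 by rewrite ltr_wpDl ?rnorm_ge0.
have [q qc] := ratc_dense c (divr_gt0 e2 x1).
have q1 : 0 < Normc.normc (ratc q : R[i]) + 1 by rewrite ltr_wpDl ?normc_ge0.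
have [t tx] := xA _ (divr_gt0 e2 q1).
exists (GenTree.Node (choice.pickle q).+3 [:: t]); rewrite /= /ratc_nth choice.pickleK.
rewrite -(subrKA (ratc q *: x)) -scalerBl -scalerBr (le_lt_trans (rnormD _ _))//.
rewrite [ltRHS]splitr ler_ltD// rnormZ.
  apply: (@le_trans _ _ (Normc.normc (c - ratc q) * (rnorm x + 1))).
    by rewrite ler_wpM2l ?normc_ge0// lerDl.
  by rewrite -ler_pdivlMr// ltW.
apply: (@le_lt_trans _ _ ((Normc.normc (ratc q : R[i]) + 1) * rnorm (x - eval_tree t))).
  by rewrite ler_wpM2r ?rnorm_ge0// lerDl.
by rewrite mulrC -ltr_pdivlMr.
Qed.

Lemma generatedM x y : x \in generated -> y \in generated -> amul x y \in generated.
Proof.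
move=> /asboolP xA /asboolP yA; apply/asboolP => e e0; have e2 : 0 < e / 2 by rewrite divr_gt0.
have y1 : 0 < rnorm y + 1 by rewrite ltr_wpDl ?rnorm_ge0.
have [s sx] := xA _ (divr_gt0 e2 y1).
have s1 : 0 < rnorm (eval_tree s) + 1 by rewrite ltr_wpDl ?rnorm_ge0.
have [t ty] := yA _ (divr_gt0 e2 s1).
exists (GenTree.Node 1 [:: s; t]) => /=.
rewrite -(subrKA (amul (eval_tree s) y)) -amulBl -amulBr (le_lt_trans (rnormD _ _))//.
rewrite [ltRHS]splitr ler_ltD// (le_trans (rnormM _ _), le_lt_trans (rnormM _ _))//.
  apply: (@le_trans _ _ (rnorm (x - eval_tree s) * (rnorm y + 1))).
    by rewrite ler_wpM2l ?rnorm_ge0// lerDl.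
  by rewrite -ler_pdivlMr// ltW.
apply: (@le_lt_trans _ _ ((rnorm (eval_tree s) + 1) * rnorm (y - eval_tree t))).
  by rewrite ler_wpM2r ?rnorm_ge0// lerDl.
by rewrite mulrC -ltr_pdivlMr.
Qed.

Lemma generatedS x : x \in generated -> astar x \in generated.
Proof.
move=> /asboolP xA; apply/asboolP => e /xA[t tx]; exists (GenTree.Node 2 [:: t]) => /=.
by rewrite -astarB rnorm_star.
Qed.

Lemma generated_closed x :
  (forall e : R, 0 < e -> exists2 y, y \in generated & rnorm (x - y) < e) ->
  x \in generated.
Proof.
move=> xA; apply/asboolP => e e0; have e2 : 0 < e / 2 by rewrite divr_gt0.
have [y /asboolP yA xy] := xA _ e2; have [t ty] := yA _ e2; exists t.
by rewrite -(subrKA y) (le_lt_trans (rnormD _ _))// [ltRHS]splitr ltrD.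
Qed.

Lemma generated_ind (P : B -> Prop) :
  P 0 -> (forall n, P (g n)) -> (forall x y, P x -> P y -> P (x + y)) ->
  (forall c x, P x -> P (c *: x)) -> (forall x y, P x -> P y -> P (amul x y)) ->
  (forall x, P x -> P (astar x)) ->
  (forall x, (forall e : R, 0 < e -> exists2 y, P y & rnorm (x - y) < e) -> P x) ->
  forall x, x \in generated -> P x.
Proof.
move=> P0 Pg PD PZ PM PS Pcl x /asboolP xA; apply: Pcl => e /xA[t tx].
exists (eval_tree t) => //; move: {x xA e tx}t; fix IH 1 => -[n|]/=; first exact: Pg.
move=> [|[|[|k]]] [|a [|b [|? ?]]] //=.
- by apply: PD; exact: IH.
- by apply: PM; exact: IH.
- by apply: PS; exact: IH.
- by apply: PZ; exact: IH.
Qed.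

Lemma generated_submod : GRing.submod_closed generated.
Proof. by split=> [|c x y xA yA]; [exact: generated0|rewrite generatedD// generatedZ]. Qed.

HB.instance Definition _ := GRing.isSubmodClosed.Build R[i] B generated generated_submod.

End generated.

Record calg (R : realType) (B : cstarAlgebra R) (g : nat -> B) :=
  Calg { calg_val :> B; calg_subproof : calg_val \in generated g }.

Section calg.
Context {R : realType} {B : cstarAlgebra R} (g : nat -> B).
Local Notation A := (calg g).

HB.instance Definition _ := [isSub for @calg_val R B g].
HB.instance Definition _ := [Choice of A by <:].
HB.instance Definition _ := [SubChoice_isSubLmodule of A by <:].

Implicit Types (x y : A) (c : R[i]).

Lemma calgE x y : calg_val x = calg_val y -> x = y.
Proof. exact: val_inj. Qed.

Let norm x : R[i] := `|calg_val x|.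

Let normD x y : norm (x + y) <= norm x + norm y.
Proof. exact: ler_normD. Qed.

Let normZ c x : norm (c *: x) = `|c| * norm x.
Proof. exact: normrZ. Qed.

Let norm0_eq0 x : norm x = 0 -> x = 0.
Proof. by move=> /normr0_eq0 x0; apply: calgE. Qed.

HB.instance Definition _ := Lmodule_isNormed.Build R[i] A normD normZ norm0_eq0.

Lemma calg_rnorm x : rnorm x = rnorm (calg_val x).
Proof. by []. Qed.

Lemma calg_cauchy_seq (u : nat -> A) : cauchy_seq u -> exists l, tends_to u l.
Proof.
move=> uc; have [l ul] : exists l, tends_to (fun n => calg_val (u n)) l.
  by apply: cauchy_seq_cvg => e /uc[N NE]; exists N.
have lA : l \in generated g.
  apply: generated_closed => e /ul[N NE]; exists (calg_val (u N)).
    exact: calg_subproof.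
  by rewrite rnormB NE.
by exists (Calg lA) => e /ul[N NE]; exists N.
Qed.

HB.instance Definition _ := Uniform_isComplete.Build A
  (complete_of_cauchy_seq calg_cauchy_seq).

Definition calg_mul x y : A := Calg (generatedM (calg_subproof x) (calg_subproof y)).
Definition calg_star x : A := Calg (generatedS (calg_subproof x)).

Let mulA : associative calg_mul.
Proof. by move=> x y z; apply: calgE; exact: amulA. Qed.

Let mulDl : left_distributive calg_mul +%R.
Proof. by move=> x y z; apply: calgE; exact: amulDl. Qed.

Let mulDr : right_distributive calg_mul +%R.
Proof. by move=> x y z; apply: calgE; exact: amulDr. Qed.

Let mulZl c x y : calg_mul (c *: x) y = c *: calg_mul x y.
Proof. by apply: calgE; exact: amulZl. Qed.

Let mulZr c x y : calg_mul x (c *: y) = c *: calg_mul x y.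
Proof. by apply: calgE; exact: amulZr. Qed.

Let starK : involutive calg_star.
Proof. by move=> x; apply: calgE; exact: astarK. Qed.

Let starD : {morph calg_star : x y / x + y}.
Proof. by move=> x y; apply: calgE; exact: astarD. Qed.

Let starZ c x : calg_star (c *: x) = c^* *: calg_star x.
Proof. by apply: calgE; exact: astarZ. Qed.

Let starM x y : calg_star (calg_mul x y) = calg_mul (calg_star y) (calg_star x).
Proof. by apply: calgE; exact: astarM. Qed.

HB.instance Definition _ := isStarAlgebra.Build R A
  mulA mulDl mulDr mulZl mulZr starK starD starZ starM.

Let norm_mul x y : `|amul x y| <= `|x| * `|y|.
Proof. exact: (ler_normM (calg_val x) (calg_val y)). Qed.

Let norm_star x : `|amul (astar x) x| = `|x| ^+ 2.
Proof. exact: (norm_cstar (calg_val x)). Qed.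

HB.instance Definition _ := isCStarAlgebra.Build R A norm_mul norm_star.

Definition calg_gen n : A := Calg (generated_gen g n).

Lemma calg_valD x y : calg_val (x + y) = calg_val x + calg_val y. Proof. by []. Qed.
Lemma calg_valN x : calg_val (- x) = - calg_val x. Proof. by []. Qed.
Lemma calg_valZ c x : calg_val (c *: x) = c *: calg_val x. Proof. by []. Qed.
Lemma calg_valM x y : calg_val (amul x y) = amul (calg_val x) (calg_val y). Proof. by []. Qed.
Lemma calg_valS x : calg_val (astar x) = astar (calg_val x). Proof. by []. Qed.

Lemma calg_val_sum (J : Type) (r : seq J) (P : pred J) (F : J -> A) :
  calg_val (\sum_(i <- r | P i) F i) = \sum_(i <- r | P i) calg_val (F i).
Proof. exact: (big_morph _ calg_valD). Qed.

Lemma calg_separable : separable A.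
Proof.
pose F (t : GenTree.tree nat) : A := if pselect (eval_tree g t \in generated g) is left h
  then Calg h else 0.
exists (range F); first by apply: sub_countable (card_image_le _ _) _; exact: countableP.
apply/dense_rnormP => x e e0; have /asboolP/(_ e e0)[t tx] := calg_subproof x.
exists (F t); first by exists t.
rewrite calg_rnorm calg_valD calg_valN /F; case: pselect => // -[].
by apply/asboolP => d d0; exists t; rewrite subrr rnorm0.
Qed.

End calg.

Lemma calg_val_hom (R : realType) (H : hilbertSpace R) (g : nat -> bop H) :
  star_hom (@calg_val R (bop H) g).
Proof. by split. Qed.

(** * Bounded paths modulo paths vanishing at infinity *)

Section locally_finite.
Context {R : realType} {V : normedModType R[i]}.
Variable d : nat -> R -> V.
Hypothesis d_cont : forall k, continuous (d k).
Hypothesis d_supp : forall k t, t <= k%:R -> d k t = 0.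

(** The sum of all the d k: those with k > t vanish at t. *)
Definition lf_sum (t : R) : V := \sum_(k < Num.bound `|t|) d k t.

Lemma lf_sumE N t : t <= N%:R -> lf_sum t = \sum_(k < N) d k t.
Proof.
have E (m n : nat) : t <= m%:R -> (m <= n)%N -> \sum_(k < n) d k t = \sum_(k < m) d k t.
  move=> tm /subnKC <-; rewrite big_split_ord /= [X in _ + X]big1 ?addr0// => k _.
  by rewrite d_supp// (le_trans tm)// ler_nat leq_addr.
have tB : t <= (Num.bound `|t|)%:R.
  by apply: le_trans (ler_norm t) (ltW (archi_boundP _)).
move=> tN; rewrite /lf_sum; have [NB|/ltnW BN] := leqP N (Num.bound `|t|).
  exact: E.
by apply/esym/E.
Qed.

Lemma lf_sum_cont : continuous lf_sum.
Proof.
move=> t; pose N := Num.bound (`|t| + 1).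
have tN : t + 1 < N%:R.
  apply: le_lt_trans (archi_boundP _); last by rewrite addr_ge0.
  by rewrite lerD2r ler_norm.
suff : (fun s => \sum_(k < N) d k s) @ t --> lf_sum t.
  apply: cvg_trans; apply: near_eq_cvg.
  have : \forall s \near t, s < t + 1 
    by apply/nbhs_ballP; exists 1 => //= s; rewrite /ball/= ltr_norml => /andP[+ _]; lra.
  by apply: filterS => s st; rewrite (@lf_sumE N)// ltW// (lt_trans st).
rewrite (@lf_sumE N); last by rewrite ltW// (lt_trans _ tN)// ltrDl.
elim: N {tN} => [|N IHN].
  by rewrite big_ord0; under eq_fun do rewrite big_ord0; exact: cvg_cst.
by rewrite big_ord_recr/=; under eq_fun do rewrite big_ord_recr/=; apply: cvgD => //; exact: d_cont.
Qed.

End locally_finite.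

Section clamp.
Context {R : realType}.

Definition clamp (t : R) : R := Num.min 1 (Num.max 0 t).

Lemma clamp_cont : continuous clamp.
Proof.
move=> t; apply: continuous_min; first exact: cvg_cst.
by apply: continuous_max; [exact: cvg_cst|exact: cvg_id].
Qed.

Lemma clamp_ge0 t : 0 <= clamp t. Proof. by rewrite le_min ler01 le_max lexx. Qed.
Lemma clamp_le1 t : clamp t <= 1. Proof. by rewrite ge_min lexx. Qed.
Lemma clamp0 t : t <= 0 -> clamp t = 0.
Proof. by move=> t0; rewrite /clamp (max_idPl t0); apply/min_idPr. Qed.
Lemma clamp1 t : 1 <= t -> clamp t = 1.
Proof. by move=> t1; apply/min_idPl; rewrite le_max t1 orbT. Qed.
Lemma clamp_id t : 0 <= t -> t <= 1 -> clamp t = t.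
Proof. by move=> t0 t1; rewrite /clamp (max_idPr t0); apply/min_idPr. Qed.

Lemma continuous_rnormP (V : normedModType R[i]) (f : R -> V) :
  continuous f <->
  forall t (e : R), 0 < e -> \forall s \near t, rnorm (f t - f s) < e.
Proof.
by split=> fc t; [exact: (cvg_rnormP _ f (f t)).1 (fc t)|exact: (cvg_rnormP _ f (f t)).2 (fc t)].
Qed.

Lemma cvg_scale (V : normedModType R[i]) (T : Type) (F : set_system T) (FF : Filter F)
    (r : T -> R) (f : T -> V) (a : R) (l : V) :
  r @ F --> a -> f @ F --> l -> (fun t => (r t)%:C *: f t) @ F --> a%:C *: l.
Proof.
move=> ra /cvg_rnormP fl; apply/cvg_rnormP => e e0.
have f1 : 0 < rnorm l + 1 by rewrite ltr_wpDl ?rnorm_ge0.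
have r1 : 0 < `|a| + 1 by rewrite ltr_wpDl.
have e2 : 0 < e / 2 by rewrite divr_gt0.
have re : F [set s | `|a - r s| < e / 2 / (rnorm l + 1)].
  by have /cvgrPdist_lt := ra; apply; rewrite divr_gt0.
have rb : F [set s | `|a - r s| < 1] by have /cvgrPdist_lt := ra; apply.
apply: filterS (filterI (filterI re rb) (fl _ (divr_gt0 e2 r1))) => s [[h1 h2] h3] /=.
have nr (b : R) : Normc.normc b%:C = `|b| by rewrite nsq_normc nsq_RC sqrtr_sqr.
rewrite -(subrKA ((r s)%:C *: l)) -scalerBl -scalerBr -rmorphB.
rewrite (le_lt_trans (rnormD _ _))// !rnormZ !nr [ltRHS]splitr ler_ltD//.
  apply: (@le_trans _ _ (`|a - r s| * (rnorm l + 1))).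
    by rewrite ler_wpM2l// lerDl.
  by rewrite -ler_pdivlMr// ltW.
apply: (@le_lt_trans _ _ ((`|a| + 1) * rnorm (l - f s))).
  rewrite ler_wpM2r ?rnorm_ge0// -[r s](subrK a) (le_trans (ler_normD _ _))//.
  by rewrite addrC lerD2l distrC ltW.
by rewrite mulrC -ltr_pdivlMr.
Qed.

Lemma continuous_scale (V : normedModType R[i]) (r : R -> R) (f : R -> V) :
  continuous r -> continuous f -> continuous (fun t => (r t)%:C *: f t).
Proof. by move=> rc fc t; apply: cvg_scale; [exact: rc|exact: fc]. Qed.

End clamp.

Section path_algebra.
Context {R : realType} {B : cstarAlgebra R}.
Implicit Types (f g h : R -> B) (c : R[i]).

Lemma continuous_amul f g : continuous f -> continuous g ->
  continuous (fun t => amul (f t) (g t)).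
Proof.
move=> /continuous_rnormP fc /continuous_rnormP gc; apply/continuous_rnormP => t e e0.
have f1 : 0 < rnorm (f t) + 1 by rewrite ltr_wpDl ?rnorm_ge0.
have g1 : 0 < rnorm (g t) + 1 by rewrite ltr_wpDl ?rnorm_ge0.
have e2 : 0 < e / 2 by rewrite divr_gt0.
apply: filterS (filterI (filterI (fc t _ (divr_gt0 e2 g1)) (fc t 1 ltr01))
  (gc t _ (divr_gt0 e2 f1))) => s [[h1 h2] h3].
rewrite -(subrKA (amul (f s) (g t))) -amulBl -amulBr.
rewrite (le_lt_trans (rnormD _ _))// [ltRHS]splitr ler_ltD//.
  rewrite (le_trans (rnormM _ _))//.
  apply: (@le_trans _ _ (rnorm (f t - f s) * (rnorm (g t) + 1))).
    by rewrite ler_wpM2l ?rnorm_ge0// lerDl.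
  by rewrite -ler_pdivlMr// ltW.
rewrite (le_lt_trans (rnormM _ _))//.
apply: (@le_lt_trans _ _ ((rnorm (f t) + 1) * rnorm (g t - g s))).
  rewrite ler_wpM2r ?rnorm_ge0// -[f s](subrK (f t)) (le_trans (rnormD _ _))//.
  by rewrite addrC lerD2l rnormB ltW.
by rewrite mulrC -ltr_pdivlMr.
Qed.

Lemma continuous_astar f : continuous f -> continuous (fun t => astar (f t)).
Proof.
move=> /continuous_rnormP fc; apply/continuous_rnormP => t e /(fc t).
by apply: filterS => s; rewrite -astarB rnorm_star.
Qed.

(** Paths on the whole line, since the quotient below only sees the behaviour at
    infinity. *)
Definition bounded_path : {pred R -> B} := fun f =>
  `[< continuous f /\ exists M : R, \forall t \near +oo, rnorm (f t) <= M >].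

Lemma bounded_path_submod : GRing.submod_closed bounded_path.
Proof.
split=> [|c f g /asboolP[fc [M fM]] /asboolP[gc [N gN]]]; apply/asboolP.
  split; first by move=> t; exact: cvg_cst.
  by exists 0; apply: nearW => t; rewrite rnorm0.
split.
  by move=> t; apply: cvgD; [apply: cvgZl_tmp|]; [exact: fc|exact: gc].
exists (Normc.normc c * M + N); apply: filterS (filterI fM gN) => t [h1 h2].
by rewrite (le_trans (rnormD _ _))// lerD// rnormZ ler_wpM2l ?normc_ge0.
Qed.

HB.instance Definition _ :=
  GRing.isSubmodClosed.Build R[i] (R -> B) bounded_path bounded_path_submod.

Lemma bounded_path_mul f g : f \in bounded_path -> g \in bounded_path ->
  (fun t => amul (f t) (g t)) \in bounded_path.
Proof.
move=> /asboolP[fc [M fM]] /asboolP[gc [N gN]]; apply/asboolP.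
split; first exact: continuous_amul.
exists (M * N); apply: filterS (filterI fM gN) => t [h1 h2].
by rewrite (le_trans (rnormM _ _))// ler_pM ?rnorm_ge0.
Qed.

Lemma bounded_path_star f : f \in bounded_path -> (fun t => astar (f t)) \in bounded_path.
Proof.
move=> /asboolP[fc [M fM]]; apply/asboolP; split; first exact: continuous_astar.
by exists M; apply: filterS fM => t; rewrite rnorm_star.
Qed.

End path_algebra.
Arguments bounded_path {R} B.

Record path (R : realType) (B : cstarAlgebra R) :=
  Path { path_fun :> R -> B; path_subproof : path_fun \in bounded_path B }.

HB.instance Definition _ (R : realType) (B : cstarAlgebra R) :=
  [isSub for @path_fun R B].
HB.instance Definition _ (R : realType) (B : cstarAlgebra R) :=
  [Choice of path B by <:].
HB.instance Definition _ (R : realType) (B : cstarAlgebra R) :=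
  [SubChoice_isSubLmodule of path B by <:].

Section path_norm.
Context {R : realType} {B : cstarAlgebra R}.
Implicit Types (f g h : path B) (c : R[i]) (M : R).

Lemma pathE f g : f =1 g -> f = g.
Proof. by move=> fg; apply: val_inj; apply/funext. Qed.

Lemma path_addE f g t : (f + g : path B) t = f t + g t. Proof. by []. Qed.
Lemma path_oppE f t : (- f : path B) t = - f t. Proof. by []. Qed.
Lemma path_scaleE c f t : (c *: f : path B) t = c *: f t. Proof. by []. Qed.

Definition path_mul f g : path B := Path (bounded_path_mul (path_subproof f) (path_subproof g)).
Definition path_star f : path B := Path (bounded_path_star (path_subproof f)).
Definition path_cst (b : B) : path B.
Proof.
by apply: (@Path _ _ (fun=> b)); apply/asboolP; split;
  [move=> t; exact: cvg_cst|exists (rnorm b); apply: nearW].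
Defined.

Lemma path_cont f : continuous f.
Proof. by have /asboolP[] := path_subproof f. Qed.

Definition path_bounds f : set R :=
  [set M | 0 <= M /\ \forall t \near +oo, rnorm (f t) <= M].

(** The upper limit of the norm at infinity, which is the norm of the class of f modulo
    the paths that vanish at infinity. *)
Definition path_norm f : R := inf (path_bounds f).

Lemma path_bounds_inf f : has_inf (path_bounds f).
Proof.
split; last by exists 0 => M [].
have /asboolP[_ [M fM]] := path_subproof f; exists `|M|; split=> //.
by apply: filterS fM => t tM; rewrite (le_trans tM)// ler_norm.
Qed.

Lemma path_norm_ge0 f : 0 <= path_norm f.
Proof. by apply: lb_le_inf; [case: (path_bounds_inf f)|move=> M []]. Qed.

Lemma path_norm_lt f M : path_norm f < M -> \forall t \near +oo, rnorm (f t) < M.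
Proof.
move=> fM; have [N [_ fN] NM] := inf_lt (path_bounds_inf f).1 fM.
by apply: filterS fN => t tN; exact: le_lt_trans NM.
Qed.

Lemma path_norm_le f M : (forall e, 0 < e -> \forall t \near +oo, rnorm (f t) <= M + e) ->
  path_norm f <= M.
Proof.
move=> fM; apply/ler_addgt0Pr => e e0; apply: (ge_inf (path_bounds_inf f).2).
split; last exact: fM.
have [t tM] := filter_ex (fM e e0); exact: le_trans (rnorm_ge0 _) tM.
Qed.

Lemma path_norm_near f (e : R) : 0 < e -> \forall t \near +oo, rnorm (f t) < path_norm f + e.
Proof. by move=> e0; apply: path_norm_lt; rewrite ltrDl. Qed.

Lemma path_normD f g : path_norm (f + g) <= path_norm f + path_norm g.
Proof.
apply: path_norm_le => e e0; have e2 : 0 < e / 2 by rewrite divr_gt0.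
apply: filterS (filterI (path_norm_near f e2) (path_norm_near g e2)) => t [h1 h2].
by rewrite path_addE (le_trans (rnormD _ _))//; lra.
Qed.

Lemma path_norm_cstE f M : (forall t, rnorm (f t) = M) -> path_norm f = M.
Proof.
move=> fM; apply/le_anti/andP; split.
  by apply: path_norm_le => e e0; apply: nearW => t; rewrite fM lerDl ltW.
apply/ler_addgt0Pr => e e0; have [t] := filter_ex (path_norm_near f e0).
by rewrite fM => /ltW.
Qed.

Lemma path_norm0 : path_norm 0 = 0.
Proof. by apply: path_norm_cstE => t; rewrite rnorm0. Qed.

Lemma path_normZ_le c f : path_norm (c *: f) <= Normc.normc c * path_norm f.
Proof.
apply: path_norm_le => e e0; have c1 : 0 < Normc.normc c + 1 by rewrite ltr_wpDl ?normc_ge0.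
apply: filterS (path_norm_near f (divr_gt0 e0 c1)) => t h.
rewrite path_scaleE rnormZ.
apply: (@le_trans _ _ (Normc.normc c * (path_norm f + e / (Normc.normc c + 1)))).
  by rewrite ler_wpM2l ?normc_ge0// ltW.
rewrite mulrDr lerD2l mulrA ler_pdivrMr// mulrC ler_wpM2l ?ltW//.
by rewrite ltrDl.
Qed.

Lemma path_normZ c f : path_norm (c *: f) = Normc.normc c * path_norm f.
Proof.
apply/le_anti; rewrite path_normZ_le/=.
have [->|c0] := eqVneq c 0; first by rewrite Normc.normc0 mul0r path_norm_ge0.
have := path_normZ_le c^-1 (c *: f).
rewrite scalerA mulVf// scale1r Normc.normcV mulrC ler_pdivlMr 1?mulrC//.
rewrite lt_neqAle normc_ge0 andbT eq_sym.
by apply: contraNN c0 => /eqP/Normc.eq0_normc/eqP.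
Qed.

Lemma path_normM f g : path_norm (path_mul f g) <= path_norm f * path_norm g.
Proof.
apply: path_norm_le => e e0.
pose d := Num.min 1 (e / (path_norm f + path_norm g + 1)).
have s0 : 0 < path_norm f + path_norm g + 1.
  by rewrite ltr_wpDl// addr_ge0 ?path_norm_ge0.
have d0 : 0 < d by rewrite lt_min ltr01 divr_gt0.
have d1 : d <= 1 by rewrite ge_min lexx.
have de : d * (path_norm f + path_norm g + 1) <= e.
  by rewrite -ler_pdivlMr// ge_min lexx orbT.
apply: filterS (filterI (path_norm_near f d0) (path_norm_near g d0)) => t [h1 h2].
rewrite (le_trans (rnormM _ _))//.
apply: (@le_trans _ _ ((path_norm f + d) * (path_norm g + d))).
  by rewrite ler_pM ?rnorm_ge0 ?ltW.
have := path_norm_ge0 f; have := path_norm_ge0 g; nra.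
Qed.

Lemma path_norm_cstar f : path_norm (path_mul (path_star f) f) = path_norm f ^+ 2.
Proof.
set n := path_norm (path_mul _ _); have n0 : 0 <= n by exact: path_norm_ge0.
have fE t : rnorm (path_mul (path_star f) f t) = rnorm (f t) ^+ 2.
  exact: rnorm_cstar.
apply/le_anti/andP; split.
  apply: (le_trans (path_normM _ _)); rewrite expr2 ler_wpM2r ?path_norm_ge0//.
  by apply: path_norm_le => e /(path_norm_near f); apply: filterS => t /ltW; rewrite /= rnorm_star.
rewrite -[leRHS]sqr_sqrtr// lerXn2r ?nnegrE ?path_norm_ge0 ?sqrtr_ge0//.
apply: path_norm_le => e e0; have e2 : 0 < e ^+ 2 by rewrite exprn_gt0.
apply: filterS (path_norm_near (path_mul (path_star f) f) e2) => t.
rewrite fE -/n => h; rewrite -ler_sqr ?nnegrE ?rnorm_ge0 ?addr_ge0 ?sqrtr_ge0 ?(ltW e0)//.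
apply: (le_trans (ltW h)); rewrite sqrrD sqr_sqrtr// lerD2r lerDl mulrn_wge0//.
by rewrite mulr_ge0 ?sqrtr_ge0// ltW.
Qed.

Lemma path_normB f g : path_norm (f - g) = path_norm (g - f).
Proof.
have -> : g - f = (-1) *: (f - g) by rewrite scaleN1r opprB.
rewrite path_normZ (_ : Normc.normc (-1) = 1) ?mul1r//.
by rewrite /= sqrrN expr1n oppr0 expr0n addr0 sqrtr1.
Qed.

Definition path_eqv f g := path_norm (f - g) == 0.

Let path_eqv_refl : reflexive path_eqv.
Proof. by move=> f; rewrite /path_eqv subrr path_norm0. Qed.

Let path_eqv_sym : symmetric path_eqv.
Proof. by move=> f g; rewrite /path_eqv path_normB. Qed.

Lemma path_eqvP f g : reflect (path_norm (f - g) <= 0) (path_eqv f g).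
Proof.
by apply: (iffP eqP) => [->//|fg]; apply/le_anti; rewrite fg path_norm_ge0.
Qed.

Let path_eqv_trans : transitive path_eqv.
Proof.
move=> g f h /path_eqvP fg /path_eqvP gh; apply/path_eqvP.
by rewrite -(subrKA g) (le_trans (path_normD _ _))//; lra.
Qed.

Canonical path_equiv := EquivRel path_eqv path_eqv_refl path_eqv_sym path_eqv_trans.

End path_norm.

Definition corona (R : realType) (B : cstarAlgebra R) : Type :=
  {eq_quot (@path_equiv R B)}%qT.

HB.instance Definition _ (R : realType) (B : cstarAlgebra R) := Choice.on (corona B).
HB.instance Definition _ (R : realType) (B : cstarAlgebra R) := EqQuotient.on (corona B).

Section corona_algebra.
Context {R : realType} {B : cstarAlgebra R}.
Local Notation Q := (corona B).
Implicit Types (f g h : path B) (x y z : Q) (c : R[i]).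

Definition pclass f : Q := (\pi f)%qT.

Lemma pclassP f g : pclass f = pclass g <-> path_norm (f - g) <= 0.
Proof.
by split=> [/eqquotP/path_eqvP//|fg]; apply/eqquotP/path_eqvP.
Qed.

Lemma pclass_repr x : pclass (repr x) = x.
Proof. exact: reprK. Qed.

Lemma repr_pclass f : path_norm (repr (pclass f) - f) <= 0.
Proof. by apply/pclassP; rewrite pclass_repr. Qed.

Lemma pclass_ind (P : Q -> Prop) : (forall f, P (pclass f)) -> forall x, P x.
Proof. by move=> Pf x; rewrite -(pclass_repr x). Qed.

Definition cor_add x y : Q := pclass (repr x + repr y).
Definition cor_scale c x : Q := pclass (c *: repr x).
Definition cor_mul x y : Q := pclass (path_mul (repr x) (repr y)).
Definition cor_star x : Q := pclass (path_star (repr x)).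
Definition cor_norm x : R := path_norm (repr x).

Lemma pclassD f g : pclass (f + g) = cor_add (pclass f) (pclass g).
Proof.
apply/esym/pclassP; rewrite opprD addrACA (le_trans (path_normD _ _))//.
by rewrite -[leRHS]addr0 lerD ?repr_pclass.
Qed.

Lemma pclassZ c f : pclass (c *: f) = cor_scale c (pclass f).
Proof.
apply/esym/pclassP; rewrite -scalerBr path_normZ.
by rewrite mulr_ge0_le0 ?normc_ge0 ?repr_pclass.
Qed.

Lemma pclassM f g : pclass (path_mul f g) = cor_mul (pclass f) (pclass g).
Proof.
apply/esym/pclassP; set f' := repr (pclass f); set g' := repr (pclass g).
have -> : path_mul f' g' - path_mul f g = path_mul (f' - f) g' + path_mul f (g' - g).
  apply: pathE => t; rewrite !(path_addE, path_oppE).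
  rewrite -![path_fun (path_mul _ _) t]/(amul (path_fun _ t) (path_fun _ t)).
  by rewrite !(path_addE, path_oppE) amulBl amulBr addrA subrK.
rewrite (le_trans (path_normD _ _))// -[leRHS]addr0.
apply: lerD; apply: (le_trans (path_normM _ _)).
  by rewrite mulr_le0_ge0 ?path_norm_ge0 ?repr_pclass.
by rewrite mulr_ge0_le0 ?path_norm_ge0 ?repr_pclass.
Qed.

Lemma path_norm_star_le f : path_norm (path_star f) <= path_norm f.
Proof.
by apply: path_norm_le => e /(path_norm_near f); apply: filterS => t /ltW; rewrite /= rnorm_star.
Qed.

Lemma pclassS f : pclass (path_star f) = cor_star (pclass f).
Proof.
apply/esym/pclassP; set f' := repr (pclass f).
have -> : path_star f' - path_star f = path_star (f' - f).
  by apply: pathE => t; apply: esym; exact: astarB.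
by rewrite (le_trans (path_norm_star_le _))// repr_pclass.
Qed.

Lemma cor_norm_pclass f : cor_norm (pclass f) = path_norm f.
Proof.
have le (f' g' : path B) : path_norm (f' - g') <= 0 -> path_norm f' <= path_norm g'.
  move=> fg; rewrite -(subrK g' f') (le_trans (path_normD _ _))//.
  by rewrite -[leRHS]add0r lerD2r.
have rf := repr_pclass f; apply/le_anti.
by rewrite !le// path_normB.
Qed.

Let addA : associative cor_add.
Proof.
by elim/pclass_ind => f; elim/pclass_ind => g; elim/pclass_ind => h; rewrite -!pclassD addrA.
Qed.

Let addC : commutative cor_add.
Proof. by elim/pclass_ind => f; elim/pclass_ind => g; rewrite -!pclassD addrC. Qed.

Let add0 : left_id (pclass 0) cor_add.
Proof. by elim/pclass_ind => f; rewrite -pclassD add0r. Qed.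

Let addN : left_inverse (pclass 0) (fun x => cor_scale (-1) x) cor_add.
Proof.
by elim/pclass_ind => f; rewrite -pclassZ -pclassD scaleN1r addNr.
Qed.

HB.instance Definition _ := GRing.isZmodule.Build Q addA addC add0 addN.

Let scaleA b c x : cor_scale b (cor_scale c x) = cor_scale (b * c) x.
Proof. by elim/pclass_ind: x => f; rewrite -!pclassZ scalerA. Qed.

Let scale1 : left_id 1 cor_scale.
Proof. by elim/pclass_ind => f; rewrite -pclassZ scale1r. Qed.

Let scaleDr : right_distributive cor_scale +%R.
Proof.
move=> c; elim/pclass_ind => f; elim/pclass_ind => g.
by rewrite -[_ + _]pclassD -!pclassZ scalerDr [LHS]pclassD.
Qed.

Let scaleDl x : {morph cor_scale^~ x : b c / b + c}.
Proof.
elim/pclass_ind: x => f b c.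
by rewrite -!pclassZ scalerDl [LHS]pclassD.
Qed.

HB.instance Definition _ := GRing.Zmodule_isLmodule.Build R[i] Q scaleA scale1 scaleDr scaleDl.

Lemma pclass_addE f g : pclass (f + g) = pclass f + pclass g.
Proof. exact: pclassD. Qed.

Lemma pclass_scaleE c f : pclass (c *: f) = c *: pclass f.
Proof. exact: pclassZ. Qed.

Let norm x : R[i] := (cor_norm x)%:C.

Let normD x y : norm (x + y) <= norm x + norm y.
Proof.
elim/pclass_ind: x => f; elim/pclass_ind: y => g.
by rewrite -pclass_addE /norm -rmorphD lecR !cor_norm_pclass path_normD.
Qed.

Let normZ c x : norm (c *: x) = `|c| * norm x.
Proof.
elim/pclass_ind: x => f; rewrite -pclass_scaleE /norm !cor_norm_pclass path_normZ.
by rewrite rmorphM.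
Qed.

Let norm0_eq0 x : norm x = 0 -> x = 0.
Proof.
elim/pclass_ind: x => f; rewrite /norm cor_norm_pclass => -[f0].
by apply/pclassP; rewrite subr0 f0.
Qed.

HB.instance Definition _ := Lmodule_isNormed.Build R[i] Q normD normZ norm0_eq0.

Lemma rnorm_pclass f : rnorm (pclass f) = path_norm f.
Proof. exact: cor_norm_pclass. Qed.

Lemma pclass_oppE f : pclass (- f) = - pclass f.
Proof. by rewrite -scaleN1r pclass_scaleE scaleN1r. Qed.

(** Telescoping along a fast subsequence: each increment is cut off below the time
    after which it is small, so that the corrected increments are summable. *)
Lemma path_telescope (f : nat -> path B) :
    (forall k, path_norm (f k.+1 - f k) < 2^-1 ^+ k) ->
  exists F : path B, forall k, path_norm (F - f k) <= 2 * 2^-1 ^+ k.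
Proof.
move=> fk.
have /choice[T0 T0E] : forall k, exists T : R, forall t, T <= t ->
    rnorm (f k.+1 t - f k t) <= 2^-1 ^+ k.
  move=> k; have [T [_ TE]] := path_norm_lt (fk k).
  by exists (T + 1) => t Tt; rewrite ltW//; apply: TE; rewrite (lt_le_trans _ Tt)// ltrDl.
pose T k := Num.max k%:R (T0 k).
pose d k t : B := (clamp (t - T k))%:C *: (f k.+1 t - f k t).
have d_cont k : continuous (d k).
  apply: continuous_scale; last by move=> t; apply: cvgB; exact: path_cont.
  move=> t; apply: (@continuous_comp _ _ _ (fun s => s - T k) clamp t).
    by apply: cvgB; [exact: cvg_id|exact: cvg_cst].
  exact: clamp_cont.
have d0 k t : t <= T k -> d k t = 0.
  by move=> tT; rewrite /d clamp0 ?subr_le0// scale0r.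
have d_supp k t : t <= k%:R -> d k t = 0.
  by move=> tk; apply: d0; rewrite (le_trans tk)// le_max lexx.
have d1 k t : T k + 1 <= t -> d k t = f k.+1 t - f k t.
  by move=> Tt; rewrite /d clamp1 ?scale1r// lerBrDl.
have half0 n : 0 <= 2^-1 ^+ n :> R by rewrite exprn_ge0// invr_ge0.
have d_le k t : rnorm (d k t) <= 2^-1 ^+ k.
  have [tT|/ltW Tt] := leP t (T k); first by rewrite d0// rnorm0.
  rewrite rnormZ normc_RC ?clamp_ge0//.
  rewrite -[leRHS]mul1r ler_pM ?clamp_ge0 ?rnorm_ge0 ?clamp_le1//.
  by apply: T0E; rewrite (le_trans _ Tt)// le_max lexx orbT.
pose F t := f 0%N t + lf_sum d t.
have tail n m t : rnorm (\sum_(n <= k < n + m) d k t) <= 2 * 2^-1 ^+ n.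
  have : rnorm (\sum_(n <= k < n + m) d k t) <= 2 * 2^-1 ^+ n * (1 - 2^-1 ^+ m).
    elim: m => [|m IHm]; first by rewrite addn0 big_geq// rnorm0 expr0 subrr mulr0.
    rewrite addnS big_nat_recr ?leq_addr//= (le_trans (rnormD _ _))//.
    apply: (le_trans (lerD IHm (d_le _ _))).
    by rewrite exprD exprS -subr_ge0 (_ : _ - _ = 0)//; field.
  by move=> /le_trans; apply; rewrite ler_piMr ?mulr_ge0// gerBl.
have FE N n m t : N = (n + m)%N -> t <= N%:R ->
    F t = f 0%N t + \sum_(0 <= k < n) d k t + \sum_(n <= k < N) d k t.
  move=> -> tN; rewrite /F (lf_sumE d_supp tN) -addrA; congr (_ + _).
  by rewrite -(big_mkord xpredT (fun k => d k t)) (@big_cat_nat _ _ _ n)// leq_addr.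
have diff k : \forall t \near +oo, rnorm (F t - f k t) <= 2 * 2^-1 ^+ k.
  have late n : \forall t \near +oo, f 0%N t + \sum_(0 <= k < n) d k t = f n t.
    elim: n => [|n IHn]; first by apply: nearW => t; rewrite big_geq// addr0.
    have : \forall t \near +oo, T n + 1 <= t by apply: nbhs_pinfty_ge; rewrite num_real.
    apply: filterS2 IHn => t IHt Tt.
    by rewrite big_nat_recr//= addrA IHt d1// addrC subrK.
  apply: filterS (late k) => t kt.
  pose m := Num.bound `|t|.
  have tm : t <= (k + m)%:R.
    rewrite natrD (le_trans (ler_norm t))// (le_trans (ltW (archi_boundP _)))//.
    by rewrite lerDr.
  by rewrite (FE _ _ _ _ erefl tm) kt addrAC subrr add0r tail.
have Fb : F \in bounded_path B.
  apply/asboolP; split.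
    by move=> t; apply: cvgD; [exact: path_cont|exact: lf_sum_cont].
  have /asboolP[_ [M fM]] := path_subproof (f 0%N).
  exists (2 * 2^-1 ^+ 0 + M); apply: filterS2 (diff 0%N) fM => t h1 h2.
  by rewrite -(subrK (f 0%N t) (F t)) (le_trans (rnormD _ _))// lerD.
exists (Path Fb) => k; apply: path_norm_le => e e0.
by apply: filterS (diff k) => t h; rewrite path_addE path_oppE (le_trans h)// lerDl ltW.
Qed.

(** Completeness: a subsequence with summable increments is lifted to paths and summed
    there. *)
Lemma corona_cauchy_seq (u : nat -> Q) : cauchy_seq u -> exists l, tends_to u l.
Proof.
move=> uc.
have half n : 0 < 2^-1 ^+ n :> R by rewrite exprn_gt0// invr_gt0.
have /choice[N NE] : forall k, exists N, forall m n, (N <= m)%N -> (N <= n)%N ->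
    rnorm (u m - u n) < 2^-1 ^+ k by move=> k; exact: uc.
pose M k := (\sum_(j < k.+1) N j)%N.
have NM k : (N k <= M k)%N by rewrite /M big_ord_recr /= leq_addl.
have MS k : (M k <= M k.+1)%N by rewrite [leqRHS]/M big_ord_recr /= leq_addr.
pose f k := repr (u (M k)).
have [F FE] : exists F : path B, forall k, path_norm (F - f k) <= 2 * 2^-1 ^+ k.
  apply: path_telescope => k.
  rewrite -rnorm_pclass pclass_addE pclass_oppE !pclass_repr NE// (leq_trans (NM _))//.
exists (pclass F) => e e0.
have e3 : 0 < e / 3 by lra.
have h01 : (0 <= (2^-1 : R)) && ((2^-1 : R) < 1) by rewrite invr_ge0 ler0n invf_lt1 ?ltr1n ?ltr0n.
have [K KE] := geometric_small h01 e3.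
exists (M K) => n Mn; rewrite -(subrKA (u (M K))) (le_lt_trans (rnormD _ _))//.
have h1 : rnorm (u n - u (M K)) < 2^-1 ^+ K by rewrite NE// (leq_trans (NM _)).
have h2 : rnorm (u (M K) - pclass F) <= 2 * 2^-1 ^+ K.
  by rewrite rnormB -(pclass_repr (u (M K))) -pclass_oppE -pclass_addE rnorm_pclass FE.
have := KE K (leqnn K); lra.
Qed.

HB.instance Definition _ := Uniform_isComplete.Build Q
  (complete_of_cauchy_seq corona_cauchy_seq).

Let mulA : associative cor_mul.
Proof.
elim/pclass_ind => f; elim/pclass_ind => g; elim/pclass_ind => h.
by rewrite -!pclassM; congr pclass; apply: pathE => t; exact: amulA.
Qed.

Let mulDl : left_distributive cor_mul +%R.
Proof.
elim/pclass_ind => f; elim/pclass_ind => g; elim/pclass_ind => h.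
by rewrite -pclass_addE -!pclassM -pclass_addE; congr pclass; apply: pathE => t; exact: amulDl.
Qed.

Let mulDr : right_distributive cor_mul +%R.
Proof.
elim/pclass_ind => f; elim/pclass_ind => g; elim/pclass_ind => h.
by rewrite -pclass_addE -!pclassM -pclass_addE; congr pclass; apply: pathE => t; exact: amulDr.
Qed.

Let mulZl c x y : cor_mul (c *: x) y = c *: cor_mul x y.
Proof.
elim/pclass_ind: x => f; elim/pclass_ind: y => g.
by rewrite -pclass_scaleE -!pclassM -pclass_scaleE; congr pclass; apply: pathE => t; exact: amulZl.
Qed.

Let mulZr c x y : cor_mul x (c *: y) = c *: cor_mul x y.
Proof.
elim/pclass_ind: x => f; elim/pclass_ind: y => g.
by rewrite -pclass_scaleE -!pclassM -pclass_scaleE; congr pclass; apply: pathE => t; exact: amulZr.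
Qed.

Let starK : involutive cor_star.
Proof.
by elim/pclass_ind => f; rewrite -!pclassS; congr pclass; apply: pathE => t; exact: astarK.
Qed.

Let starD : {morph cor_star : x y / x + y}.
Proof.
elim/pclass_ind => f; elim/pclass_ind => g.
by rewrite -pclass_addE -!pclassS -pclass_addE; congr pclass; apply: pathE => t; exact: astarD.
Qed.

Let starZ c x : cor_star (c *: x) = c^* *: cor_star x.
Proof.
elim/pclass_ind: x => f.
by rewrite -pclass_scaleE -!pclassS -pclass_scaleE; congr pclass; apply: pathE => t; exact: astarZ.
Qed.

Let starM x y : cor_star (cor_mul x y) = cor_mul (cor_star y) (cor_star x).
Proof.
elim/pclass_ind: x => f; elim/pclass_ind: y => g.
by rewrite -[cor_mul (pclass f) _]pclassM -!pclassS -pclassM; congr pclass; apply: pathE => t; exact: astarM.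
Qed.

HB.instance Definition _ := isStarAlgebra.Build R Q
  mulA mulDl mulDr mulZl mulZr starK starD starZ starM.

Lemma pclass_mulE f g : pclass (path_mul f g) = amul (pclass f) (pclass g).
Proof. exact: pclassM. Qed.

Lemma pclass_starE f : pclass (path_star f) = astar (pclass f).
Proof. exact: pclassS. Qed.

Let norm_mul x y : `|amul x y| <= `|x| * `|y|.
Proof.
elim/pclass_ind: x => f; elim/pclass_ind: y => g.
by rewrite -pclass_mulE !rnormE -rmorphM lecR !rnorm_pclass path_normM.
Qed.

Let norm_star x : `|amul (astar x) x| = `|x| ^+ 2.
Proof.
elim/pclass_ind: x => f.
by rewrite -pclass_starE -pclass_mulE !rnormE -rmorphXn !rnorm_pclass path_norm_cstar.
Qed.

HB.instance Definition _ := isCStarAlgebra.Build R Q norm_mul norm_star.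

End corona_algebra.

(** * Amplification: testing a tensor sum on scalar matrices *)

Section bessel.
Context {R : realType} {H : hilbertSpace R} (k : nat) (e : nat -> H).
Hypothesis oe : orthonormal k e.

Lemma onb_sum_sq (c : nat -> R[i]) :
  rnorm (\sum_(j < k) c j *: e j) ^+ 2 = \sum_(j < k) nsq (c j).
Proof.
apply: (@complexI R); rewrite -inner_rnorm rmorph_sum inner_suml.
apply: eq_bigr => i _; rewrite innerZl inner_sumr (bigD1 i)//= innerZr oe// eqxx mulr1.
rewrite big1 ?addr0 ?mulJ_nsq// => j ji.
by rewrite innerZr oe// eq_sym (negbTE (ji : (j : nat) != i)) mulr0.
Qed.

Lemma bessel (w : H) : \sum_(l < k) nsq (inner w (e l)) <= rnorm w ^+ 2.
Proof.
pose v := \sum_(l < k) inner w (e l) *: e l.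
have wv : inner w v = (\sum_(l < k) nsq (inner w (e l)))%:C.
  rewrite inner_sumr rmorph_sum; apply: eq_bigr => l _.
  by rewrite innerZr mulrC mulJ_nsq.
have vv : rnorm v ^+ 2 = \sum_(l < k) nsq (inner w (e l)).
  exact: (onb_sum_sq (fun l => inner w (e l))).
have := sqr_ge0 (rnorm (w - v)).
rewrite -scaleN1r rnormD_sqr innerZr wv scaleN1r rnormN vv rmorphN rmorph1 mulN1r.
rewrite /=; lra.
Qed.

End bessel.

Section amplification.
Context {R : realType} {B : cstarAlgebra R} (e : nat -> B) (p : B) (n : nat) (a : 'I_n -> B).
Hypothesis e_orth : forall j l, amul (astar (e j)) (e l) = if j == l then p else 0.
Hypothesis pp : amul p p = p.
Hypothesis p_star : astar p = p.
Hypothesis pa : forall i, amul p (a i) = a i.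
Hypothesis ap : forall i, amul (a i) p = a i.

(** The matrix units e_j with corner p turn the element Σ a_i ⊗ t_i of B ⊗ M_k into an
    element of B itself. *)
Definition ampl (k : nat) (t : 'I_n -> nat -> nat -> R[i]) : B :=
  \sum_i \sum_(l < k) \sum_(j < k) t i l j *: amul (e l) (amul (a i) (astar (e j))).

Definition contractive_coeffs (k : nat) (t : 'I_n -> nat -> nat -> R[i]) := forall i (c : nat -> R[i]),
  \sum_(l < k) nsq (\sum_(j < k) t i l j * c j) <= \sum_(j < k) nsq (c j).

Section representation.
Context {H : hilbertSpace R} (pi : B -> bop H).
Hypothesis pi_hom : star_hom pi.

Lemma inner_pi_e j l (x y : H) :
  inner (pi (e j) x) (pi (e l) y) = if j == l then inner (pi p x) (pi p y) else 0.
Proof.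
have piE (b : B) (u v : H) : inner (pi b u) v = inner u (pi (astar b) v).
  by rewrite adjointE (star_homS pi_hom).
have piM (b c : B) u : pi (amul b c) u = pi b (pi c u) by rewrite (star_homM pi_hom).
rewrite piE -piM e_orth; have [_|_] := eqVneq j l.
  by rewrite piE p_star -piM pp.
by rewrite (star_hom0 pi_hom) linear0r.
Qed.

(** The matrix units turn a k-tuple of vectors into a single one, on which ampl k t
    acts as the matrix t applied to the operators pi (a i). *)
Lemma ampl_bound k t (C : R) (xi : nat -> H) : rnorm (ampl k t) <= C ->
  \sum_(l < k) rnorm (\sum_i \sum_(j < k) t i l j *: pi (a i) (xi j)) ^+ 2 <=
  C ^+ 2 * \sum_(j < k) rnorm (xi j) ^+ 2.
Proof.
move=> yC; have piM (b c : B) u : pi (amul b c) u = pi b (pi c u).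
  by rewrite (star_homM pi_hom).
have pythag (v : nat -> H) : rnorm (\sum_(l < k) pi (e l) (v l)) ^+ 2 =
    \sum_(l < k) rnorm (pi p (v l)) ^+ 2.
  apply: (@complexI R); rewrite -inner_rnorm rmorph_sum inner_suml.
  apply: eq_bigr => l _; rewrite inner_sumr (bigD1 l)//= inner_pi_e eqxx.
  rewrite big1 ?addr0 ?inner_rnorm// => j jl.
  by rewrite inner_pi_e eq_sym (negbTE (jl : (j : nat) != l)).
pose zeta := \sum_(j < k) pi (e j) (xi j).
pose v l := \sum_i \sum_(j < k) t i l j *: pi (a i) (xi j).
have zE (j : 'I_k) : pi (astar (e j)) zeta = pi p (xi j).
  rewrite /zeta linear_sum (bigD1 j)//= -piM e_orth eqxx big1 ?addr0// => j' j'j.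
  by rewrite -piM e_orth eq_sym (negbTE (j'j : (j' : nat) != j)) (star_hom0 pi_hom).
have yz : pi (ampl k t) zeta = \sum_(l < k) pi (e l) (v l).
  rewrite /ampl (star_hom_sum pi_hom) bop_sum_apply.
  under eq_bigr => i _.
    rewrite (star_hom_sum pi_hom) bop_sum_apply; under eq_bigr => l _.
      rewrite (star_hom_sum pi_hom) bop_sum_apply; under eq_bigr => j _.
        rewrite (star_homZ pi_hom) bop_scaleE !piM zE -(piM (a i) p) ap.
        over.
      over.
    over.
  rewrite exchange_big; apply: eq_bigr => l _; rewrite /v linear_sum; apply: eq_bigr => i _.
  by rewrite linear_sum; apply: eq_bigr => j _; rewrite linearZ.
have vE l : pi p (v l) = v l.
  rewrite /v linear_sum; apply: eq_bigr => i _; rewrite linear_sum; apply: eq_bigr => j _.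
  by rewrite linearZ /= -piM pa.
have C0 : 0 <= C by apply: le_trans yC; exact: rnorm_ge0.
have : rnorm (pi (ampl k t) zeta) ^+ 2 <= C ^+ 2 * rnorm zeta ^+ 2.
  rewrite -exprMn lerXn2r ?nnegrE ?mulr_ge0 ?rnorm_ge0//.
  by rewrite (le_trans (star_hom_contractive pi_hom _ _))// ler_wpM2r ?rnorm_ge0.
rewrite yz !pythag; under eq_bigr => l _ do rewrite vE.
move=> /le_trans; apply; rewrite ler_wpM2l ?exprn_ge0//; apply: ler_sum => j _.
by rewrite lerXn2r ?nnegrE ?rnorm_ge0// (rep_projection_le pi_hom).
Qed.

(** Expand the second components of the tensor, and their images under the T_i, in one
    orthonormal system of length k. There each T_i becomes a contractive k-by-k matrix,
    so that Σ pi(a_i) ⊗ T_i acts as the amplification of these matrices. *)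
Lemma tensor_sum_bound (H' : hilbertSpace R) (K : hilbertTensor H H') (T : 'I_n -> bop H')
    (C : R) (s : seq (H * H')) :
  (forall k t, contractive_coeffs k t -> rnorm (ampl k t) <= C) ->
  (forall i v, rnorm (T i v) <= rnorm v) ->
  rnorm (\sum_(q <- s) \sum_i ht_map K (pi (a i) q.1) (T i q.2)) <=
  C * rnorm (\sum_(q <- s) ht_map K q.1 q.2).
Proof.
move=> yC T1.
have [k [eps [oeps sE]]] :=
  gram_schmidt (map snd s ++ [seq T i q.2 | i <- enum 'I_n, q <- s]).
pose xi j := \sum_(q <- s) inner q.2 (eps j) *: q.1.
pose t i l j := inner (T i (eps j)) (eps l).
have tC : contractive_coeffs k t.
  move=> i c; pose v := \sum_(j < k) c j *: eps j.
  have E (l : 'I_k) : \sum_(j < k) t i l j * c j = inner (T i v) (eps l).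
    rewrite linear_sum inner_suml; apply: eq_bigr => j _.
    by rewrite linearZ innerZl mulrC.
  under eq_bigr => l _ do rewrite E.
  rewrite -(onb_sum_sq oeps) (le_trans (bessel oeps _))//.
  by rewrite lerXn2r ?nnegrE ?rnorm_ge0.
have s2 q : q \in s -> q.2 = \sum_(j < k) inner q.2 (eps j) *: eps j.
  by move=> qs; apply: sE; rewrite mem_cat map_f.
have Ts i q : q \in s -> T i q.2 = \sum_(l < k) \sum_(j < k)
    (inner q.2 (eps j) * t i l j) *: eps l.
  move=> qs; rewrite [LHS]sE; last first.
    rewrite mem_cat; apply/orP; right; apply/allpairsP; exists (i, q).
    by rewrite /= mem_enum.
  apply: eq_bigr => l _; rewrite -scaler_suml; congr (_ *: _).
  rewrite {1}(s2 q qs) linear_sum inner_suml; apply: eq_bigr => j _.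
  by rewrite linearZ innerZl.
have evE : \sum_(q <- s) ht_map K q.1 q.2 = \sum_(j < k) ht_map K (xi j) (eps j).
  transitivity (\sum_(q <- s) \sum_(j < k) inner q.2 (eps j) *: ht_map K q.1 (eps j)).
    rewrite big_seq [RHS]big_seq; apply: eq_bigr => q qs.
    by rewrite {1}(s2 q qs) linear_sumr; apply: eq_bigr => j _; rewrite linearZr.
  rewrite exchange_big; apply: eq_bigr => j _; rewrite /xi linear_sumlz.
  by apply: eq_bigr => q _; rewrite linearZl_LR.
have imE : \sum_(q <- s) \sum_i ht_map K (pi (a i) q.1) (T i q.2) =
    \sum_(l < k) ht_map K (\sum_i \sum_(j < k) t i l j *: pi (a i) (xi j)) (eps l).
  transitivity (\sum_(q <- s) \sum_i \sum_(l < k) \sum_(j < k)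
      (inner q.2 (eps j) * t i l j) *: ht_map K (pi (a i) q.1) (eps l)).
    rewrite big_seq [RHS]big_seq; apply: eq_bigr => q qs; apply: eq_bigr => i _.
    rewrite (Ts i q qs) linear_sumr; apply: eq_bigr => l _.
    by rewrite linear_sumr; apply: eq_bigr => j _; rewrite linearZr.
  rewrite exchange_big /=.
  under eq_bigr => i _ do rewrite exchange_big /=.
  rewrite exchange_big /=; apply: eq_bigr => l _.
  rewrite linear_sumlz; apply: eq_bigr => i _.
  rewrite exchange_big linear_sumlz; apply: eq_bigr => j _.
  rewrite linearZl_LR /xi linear_sum linear_sumlz scaler_sumr.
  by apply: eq_bigr => q _; rewrite linearZ linearZl_LR scalerA mulrC.
have C0 : 0 <= C by apply: le_trans (yC k t tC); exact: rnorm_ge0.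
rewrite imE evE -ler_sqr ?nnegrE ?mulr_ge0 ?rnorm_ge0// exprMn.
rewrite (ht_onb_sq K (fun l => \sum_i \sum_(j < k) t i l j *: pi (a i) (xi j)) oeps).
by rewrite (ht_onb_sq K xi oeps); apply: ampl_bound; exact: yC.
Qed.

End representation.
End amplification.

Section tensor_bounds.
Context {R : realType} {B : cstarAlgebra R} (e : nat -> B) (p : B) (n : nat) (a : 'I_n -> B).
Hypothesis e_orth : forall j l, amul (astar (e j)) (e l) = if j == l then p else 0.
Hypothesis pp : amul p p = p.
Hypothesis p_star : astar p = p.
Hypothesis pa : forall i, amul p (a i) = a i.
Hypothesis ap : forall i, amul (a i) p = a i.
Context (C : R) (yC : forall k t, contractive_coeffs k t -> rnorm (ampl e a k t) <= C).
Context {H H' : hilbertSpace R} (pi : B -> bop H) (pi_hom : star_hom pi).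

Let C0 : 0 <= C.
Proof.
apply: le_trans (yC (_ : contractive_coeffs 0 (fun _ _ _ => 0))); first exact: rnorm_ge0.
by move=> i c; rewrite !big_ord0.
Qed.

Lemma tensor_bound_left (K : hilbertTensor H H') (T : 'I_n -> bop H') :
  (forall i v, rnorm (T i v) <= rnorm v) ->
  opnorm (\sum_i op_tensor K (pi (a i)) (T i)) <= C.
Proof.
move=> T1; apply: bop_ht_le => // s.
under eq_bigr => q _.
  rewrite bop_sum_apply; under eq_bigr => i _ do rewrite op_tensorE.
  over.
exact: (tensor_sum_bound e_orth pp p_star pa ap pi_hom K).
Qed.

Lemma tensor_bound_right (K : hilbertTensor H' H) (T : 'I_n -> bop H') (tau : R) : 0 < tau ->
  (forall i v, rnorm (T i v) <= tau * rnorm v) ->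
  opnorm (\sum_i op_tensor K (T i) (pi (a i))) <= C * tau.
Proof.
move=> tau0 T1; have nt : Normc.normc (tau^-1)%:C = tau^-1.
  by rewrite normc_RC// invr_ge0 ltW.
have T1' i v : rnorm (((tau^-1)%:C *: T i) v) <= rnorm v.
  by rewrite bop_scaleE rnormZ nt ler_pdivrMl.
apply: bop_ht_le => [|s]; first by rewrite mulr_ge0// ltW.
have := tensor_sum_bound e_orth pp p_star pa ap pi_hom (ht_flip K)
  (T := fun i => (tau^-1)%:C *: T i) [seq (q.2, q.1) | q <- s] yC T1'.
rewrite !big_map /= => le1.
have -> : \sum_(q <- s) (\sum_i op_tensor K (T i) (pi (a i))) (ht_map K q.1 q.2) =
   tau%:C *: \sum_(q <- s) \sum_i flip_map K (pi (a i) q.2) (((tau^-1)%:C *: T i) q.1).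
  rewrite scaler_sumr; apply: eq_bigr => q _; rewrite scaler_sumr bop_sum_apply.
  apply: eq_bigr => i _; rewrite op_tensorE bop_scaleE /flip_map linearZl_LR scalerA.
  by rewrite -rmorphM mulfV ?gt_eqF// scale1r.
rewrite rnormZ normc_RC ?(ltW tau0)// mulrAC [leRHS]mulrC.
by rewrite ler_pM2l.
Qed.

End tensor_bounds.

(** * Evaluating tensor norms on a chosen representative *)

Section representatives.
Context {R : realType} {A D : cstarAlgebra R}.
Implicit Types (s t : seq (A * D)).

Lemma tensor_eqv_sum (V : nmodType) (F : A -> D -> V) s t :
    (forall a a' d, F (a + a') d = F a d + F a' d) ->
    (forall a d d', F a (d + d') = F a d + F a d') ->
    (forall c a d, F (c *: a) d = F a (c *: d)) -> (forall d, F 0 d = 0) ->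
  tensor_eqv s t -> \sum_(p <- s) F p.1 p.2 = \sum_(p <- t) F p.1 p.2.
Proof.
move=> FDl FDr FZ F0; elim=> {s t}//.
- by move=> s t u _ -> _ ->.
- by move=> s t st; exact: perm_big.
- by move=> s s' t t' _ ss' _ tt'; rewrite !big_cat /= ss' tt'.
- by move=> a a' d; rewrite !big_cons !big_nil !addr0 FDl.
- by move=> a d d'; rewrite !big_cons !big_nil !addr0 FDr.
- by move=> c a d; rewrite !big_seq1 FZ.
- by move=> d; rewrite big_seq1 big_nil F0.
Qed.

(** The same computation up to errors that vanish at infinity. *)
Lemma tensor_eqv_near (V : normedModType R[i]) (F : R -> A -> D -> V) s t :
    let small (u : R -> V) := forall e : R, 0 < e -> \forall r \near +oo, rnorm (u r) < e in
    (forall a a' d, small (fun r => F r (a + a') d - F r a d - F r a' d)) ->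
    (forall a d d', small (fun r => F r a (d + d') - F r a d - F r a d')) ->
    (forall c a d, small (fun r => F r (c *: a) d - F r a (c *: d))) ->
    (forall d, small (fun r => F r 0 d)) ->
  tensor_eqv s t ->
  small (fun r => \sum_(p <- s) F r p.1 p.2 - \sum_(p <- t) F r p.1 p.2).
Proof.
move=> small FDl FDr FZ F0; have ext u v : u =1 v -> small u -> small v.
  by move=> uv su e /su; apply: filterS => r; rewrite uv.
have smallD u v : small u -> small v -> small (fun r => u r + v r).
  move=> su sv e e0; have e2 : 0 < e / 2 by rewrite divr_gt0.
  apply: filterS (filterI (su _ e2) (sv _ e2)) => r [h1 h2].
  by rewrite (le_lt_trans (rnormD _ _))// [ltRHS]splitr ltrD.
have small0 u : (forall r, u r = 0) -> small u.
  by move=> u0 e e0; apply: nearW => r; rewrite u0 rnorm0.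
elim=> {s t}.
- by move=> s; apply: small0 => r; rewrite subrr.
- move=> s t _ st e /st; apply: filterS => r; by rewrite rnormB.
- move=> t s u _ st _ tu; apply: ext (smallD _ _ st tu) => r; by rewrite addrA subrK.
- by move=> s t st; apply: small0 => r; rewrite (perm_big t)//= subrr.
- move=> s s' t t' _ ss' _ tt'; apply: ext (smallD _ _ ss' tt') => r.
  by rewrite !big_cat /= opprD addrACA.
- move=> a a' d; apply: ext (FDl a a' d) => r.
  by rewrite !big_cons !big_nil !addr0 opprD addrA.
- move=> a d d'; apply: ext (FDr a d d') => r.
  by rewrite !big_cons !big_nil !addr0 opprD addrA.
- by move=> c a d; apply: ext (FZ c a d) => r; rewrite !big_seq1.
- by move=> d; apply: ext (F0 d) => r; rewrite big_seq1 big_nil subr0.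
Qed.

Context {H1 H2 : hilbertSpace R} (K : hilbertTensor H1 H2).

Lemma spatial_tensor_tclass (pi : A -> bop H1) (rho : D -> bop H2) s :
  star_hom pi -> star_hom rho ->
  spatial_tensor K pi rho (tclass s) = \sum_(p <- s) op_tensor K (pi p.1) (rho p.2).
Proof.
move=> hpi hrho; have := repr_class s.
apply: (@tensor_eqv_sum _ (fun a d => op_tensor K (pi a) (rho d))).
- by move=> a a' d; rewrite (star_homD hpi) op_tensorDl.
- by move=> a d d'; rewrite (star_homD hrho) op_tensorDr.
- by move=> c a d; rewrite (star_homZ hpi) (star_homZ hrho) op_tensorZl op_tensorZr.
- by move=> d; rewrite (star_hom0 hpi) op_tensor0l.
Qed.

Lemma asymptotic_small (C : cstarAlgebra R) (u : R -> C) :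
  (rnorm (u t) @[t --> +oo] --> (0 : R)) ->
  forall e : R, 0 < e -> \forall t \near +oo, rnorm (u t) < e.
Proof.
move=> /cvgrPdist_lt u0 e /u0; apply: filterS => t.
by rewrite sub0r normrN ger0_norm ?rnorm_ge0.
Qed.

Lemma asymptotic_tensor_tclass (mu : R -> A -> bop H1) (nu : D -> bop H2) s :
  asymptotic_hom mu -> star_hom nu ->
  forall e : R, 0 < e -> \forall t \near +oo,
    rnorm (asymptotic_tensor K mu (fun=> nu) (tclass s) t -
           \sum_(p <- s) op_tensor K (mu t p.1) (nu p.2)) < e.
Proof.
move=> hmu hnu; have scale_small (u : R -> bop H1) d :
    (forall e : R, 0 < e -> \forall t \near +oo, rnorm (u t) < e) ->
    forall e : R, 0 < e -> \forall t \near +oo, rnorm (op_tensor K (u t) (nu d)) < e.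
  move=> u0 e e0; have n1 : 0 < opnorm (nu d) + 1 by rewrite ltr_wpDl ?opnorm_ge0.
  apply: filterS (u0 _ (divr_gt0 e0 n1)) => t h.
  rewrite bop_rnormE (le_lt_trans (opnorm_tensor _ _ _))// -bop_rnormE.
  apply: (@le_lt_trans _ _ (rnorm (u t) * (opnorm (nu d) + 1))).
    by rewrite ler_wpM2l ?rnorm_ge0// lerDl.
  by rewrite -ltr_pdivlMr.
have mu0 e : 0 < e -> \forall t \near +oo, rnorm (mu t 0) < e.
  move=> /(asymptotic_small (asymptotic_linear hmu 0 0 (-1))); apply: filterS => t.
  by rewrite scaler0 addr0 scaleN1r opprK subrr add0r.
have muZ c a e : 0 < e -> \forall t \near +oo, rnorm (mu t (c *: a) - c *: mu t a) < e.
  move=> e0; have e2 : 0 < e / 2 by rewrite divr_gt0.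
  apply: filterS (filterI (mu0 _ e2) (asymptotic_small (asymptotic_linear hmu 0 a c) e2)).
  move=> t [h1]; rewrite add0r => h2.
  have -> : mu t (c *: a) - c *: mu t a = mu t (c *: a) - mu t 0 - c *: mu t a + mu t 0.
    by rewrite [RHS]addrAC subrK.
  by rewrite (le_lt_trans (rnormD _ _))// [ltRHS]splitr ltrD.
have E (r : R) : asymptotic_tensor K mu (fun=> nu) (tclass s) r =
    \sum_(p <- repr (tclass s)) op_tensor K (mu r p.1) (nu p.2).
  by apply: eq_bigr => p _; rewrite op_tensor_splitE.
move=> e e0; under eq_near do rewrite E.
have near_eqv := @tensor_eqv_near _ (fun r a d => op_tensor K (mu r a) (nu d))
  (repr (tclass s)) s.
apply: (near_eqv _ _ _ _ (repr_class s) e e0) => {near_eqv e e0}.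
- move=> a a' d e e0.
  have := scale_small _ d (asymptotic_small (asymptotic_linear hmu a a' 1)) e e0.
  by apply: filterS => t; rewrite !scale1r !op_tensorBl.
- move=> a d d' e e0; apply: nearW => t.
  by rewrite (star_homD hnu) op_tensorDr -addrA -opprD subrr rnorm0.
- move=> c a d e e0; apply: filterS (scale_small _ d (muZ c a) e e0) => t.
  by rewrite op_tensorBl op_tensorZl (star_homZ hnu) op_tensorZr.
- by move=> d e e0; apply: filterS (scale_small _ d mu0 e e0).
Qed.

End representatives.

Section quotient_norm.
Context {R : realType} {B : cstarAlgebra R}.
Local Notation half_line := [set t : R | t \in `[0, +oo[].

(** A vanishing function cannot lower values that recur at arbitrarily late times. *)
Lemma quotient_norm_ge (f : R -> B) (c : R) :
  (forall T : R, exists2 t, T <= t & c <= rnorm (f t)) -> (c%:E <= quotient_norm f)%E.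
Proof.
move=> fc; apply: le_ereal_inf_tmp => _ [g [_ g0] <-].
apply/lee_addgt0Pr => e e0; have [T [_ TE]] := asymptotic_small g0 e0.
have [t Tt ct] := fc (Num.max 0 (T + 1)).
have t0 : 0 <= t by rewrite (le_trans _ Tt)// le_max lexx.
have {}Tt : T < t by rewrite (lt_le_trans _ Tt)// lt_max ltrDl ltr01 orbT.
apply: (@le_trans _ _ ((rnorm (f t - g t))%:E + e%:E)%E); last first.
  apply: leeD => //; apply: ereal_sup_ubound; exists t => //=.
  by rewrite in_itv /= t0.
rewrite -EFinD lee_fin (le_trans ct)// -[X in rnorm X](subrK (g t)).
by rewrite (le_trans (rnormD _ _))// lerD2l ltW// TE.
Qed.

Lemma within_rnormP (V W : normedModType R[i]) (f : R -> V) (g : R -> W) (M : R) :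
  (forall s t, rnorm (g s - g t) <= M * rnorm (f s - f t)) ->
  {within half_line, continuous f} -> {within half_line, continuous g}.
Proof.
move=> gf fc t; apply/cvg_rnormP => e e0.
have M1 : 0 < `|M| + 1 by rewrite ltr_wpDl.
have /cvg_rnormP/(_ _ (divr_gt0 e0 M1)) := fc t; apply: filterS => s h.
apply: le_lt_trans (gf _ _) _.
apply: (@le_lt_trans _ _ ((`|M| + 1) * rnorm (f t - f s))).
  by rewrite ler_wpM2r ?rnorm_ge0// (le_trans (ler_norm M))// lerDl.
by rewrite mulrC -ltr_pdivlMr.
Qed.

Lemma within_sum (V : normedModType R[i]) (J : Type) (r : seq J) (f : J -> R -> V) :
  (forall j, {within half_line, continuous (f j)}) ->
  {within half_line, continuous (fun t => \sum_(j <- r) f j t)}.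
Proof.
move=> fc; elim: r => [|j r IHr].
  have -> : (fun t => \sum_(j <- [::]) f j t) = (fun=> 0 : V).
    by apply/funext => t; rewrite big_nil.
  by move=> t; exact: cvg_cst.
have -> : (fun t => \sum_(i <- j :: r) f i t) = (fun t => f j t + \sum_(i <- r) f i t).
  by apply/funext => t; rewrite big_cons.
by move=> t; apply: cvgD; [exact: fc|exact: IHr].
Qed.

(** Subtracting from f its product with a continuous cut-off that is 1 up to time T and 0
    after T + 1 removes the early values. *)
Lemma quotient_norm_le (f : R -> B) (c : R) : 0 <= c ->
    {within half_line, continuous f} ->
    (forall e : R, 0 < e -> \forall t \near +oo, rnorm (f t) <= c + e) ->
  (quotient_norm f <= c%:E)%E.
Proof.
move=> c0 fc fle; apply/lee_addgt0Pr => e e0; rewrite -EFinD.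
have [T0 [_ TE]] := fle e e0; pose T := T0 + 1.
have {}TE t : T <= t -> rnorm (f t) <= c + e.
  by move=> Tt; apply: TE; rewrite (lt_le_trans _ Tt)// ltrDl.
pose r t : R := 1 - clamp (t - T).
have rc : continuous r.
  move=> t; apply: cvgB; first exact: cvg_cst.
  apply: (@continuous_comp _ _ _ (fun s => s - T) clamp t); last exact: clamp_cont.
  by apply: cvgB; [exact: cvg_id|exact: cvg_cst].
pose g t := (r t)%:C *: f t.
have gv : vanishing g.
  split.
    move=> t; apply: cvg_scale; last exact: fc.
    exact: (continuous_subspaceT rc).
  apply/cvgrPdist_lt => d d0.
  have : \forall t \near +oo, T + 1 <= t by apply: nbhs_pinfty_ge; rewrite num_real.
  apply: filterS => t Tt; rewrite /g /r clamp1 ?subrr ?scale0r ?rnorm0 ?subrr ?normr0//.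
  by rewrite lerBrDl.
apply: (le_trans (ereal_inf_lbound _)); first by exists g.
apply: ge_ereal_sup => _ [t t0 <-]; rewrite lee_fin.
have -> : f t - g t = (clamp (t - T))%:C *: f t.
  by rewrite /g /r rmorphB scalerBl scale1r opprB addrCA subrr addr0.
rewrite rnormZ normc_RC ?clamp_ge0//.
have [tT|/ltW Tt] := leP t T.
  by rewrite clamp0 ?subr_le0// mul0r addr_ge0// ltW.
rewrite (le_trans _ (TE _ Tt))// ler_piMl ?rnorm_ge0 ?clamp_le1//.
Qed.

End quotient_norm.

Section asymptotic_tensor_bounds.
Context {R : realType} {A D : cstarAlgebra R} {H1 H2 : hilbertSpace R}.
Context (K : hilbertTensor H1 H2) (mu : R -> A -> bop H1) (nu : D -> bop H2).
Hypothesis hmu : asymptotic_hom mu.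
Hypothesis hnu : star_hom nu.
Implicit Types (s : seq (A * D)).

Lemma asymptotic_tensor_cont x :
  {within [set t : R | t \in `[0, +oo[], continuous (asymptotic_tensor K mu (fun=> nu) x)}.
Proof.
have -> : asymptotic_tensor K mu (fun=> nu) x =
    (fun t => \sum_(p <- repr x) op_tensor K (mu t p.1) (nu p.2)).
  by apply/funext => t; apply: eq_bigr => p _; rewrite op_tensor_splitE.
apply: within_sum => p.
apply: (@within_rnormP _ _ _ (fun t => mu t p.1) (fun t => op_tensor K (mu t p.1) (nu p.2)) (opnorm (nu p.2))).
  move=> r t; rewrite -op_tensorBl bop_rnormE mulrC.
  exact: opnorm_tensor.
exact: asymptotic_continuous hmu _.
Qed.

Lemma quotient_norm_tclass_le s (c : R) : 0 <= c ->
  (forall e : R, 0 < e -> \forall t \near +oo,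
     rnorm (\sum_(p <- s) op_tensor K (mu t p.1) (nu p.2)) <= c + e) ->
  (quotient_norm (asymptotic_tensor K mu (fun=> nu) (tclass s)) <= c%:E)%E.
Proof.
move=> c0 sc; apply: quotient_norm_le => //; first exact: asymptotic_tensor_cont.
move=> e e0; have e2 : 0 < e / 2 by rewrite divr_gt0.
apply: filterS (filterI (sc _ e2) (asymptotic_tensor_tclass K s hmu hnu e2)) => t [h1 h2].
rewrite -[X in rnorm X](subrK (\sum_(p <- s) op_tensor K (mu t p.1) (nu p.2))).
by rewrite (le_trans (rnormD _ _))//; lra.
Qed.

Lemma quotient_norm_tclass_ge s (c : R) :
  (forall T e : R, 0 < e -> exists2 t, T <= t &
     c - e <= rnorm (\sum_(p <- s) op_tensor K (mu t p.1) (nu p.2))) ->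
  (c%:E <= quotient_norm (asymptotic_tensor K mu (fun=> nu) (tclass s)))%E.
Proof.
move=> sc; apply/lee_subgt0Pr => e e0; rewrite -EFinB; apply: quotient_norm_ge => T.
have e2 : 0 < e / 2 by rewrite divr_gt0.
have [T1 [_ TE]] := asymptotic_tensor_tclass K s hmu hnu e2.
have [t Tt ct] := sc (Num.max T (T1 + 1)) _ e2.
exists t; first by rewrite (le_trans _ Tt)// le_max lexx.
have /TE : T1 < t by rewrite (lt_le_trans _ Tt)// lt_max ltrDl ltr01 orbT.
set u := \sum_(p <- s) _ in ct *; set v := asymptotic_tensor _ _ _ _ _.
have : rnorm u <= rnorm (v - u) + rnorm v.
  by rewrite rnormB -{1}(subrK v u) rnormD.
lra.
Qed.

End asymptotic_tensor_bounds.

(** * Square-root cancellation for tree-like involutions *)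

Section orthogonal_projections.
Context {R : realType} {H : hilbertSpace R} {n : nat} (E : 'I_n -> bop H).
Hypothesis E_star : forall i, astar (E i) = E i.
Hypothesis E_orth : forall i j, amul (E i) (E j) = if i == j then E i else 0.

Lemma inner_proj i j v w : inner (E i v) (E j w) = if i == j then inner (E i v) w else 0.
Proof.
rewrite adjointE -[adjoint (E i)]/(astar (E i)) E_star.
rewrite -[E i (E j w)]/(amul (E i) (E j) w) E_orth; have [->|_] := eqVneq i j.
  by rewrite adjointE -[adjoint (E j)]/(astar (E j)) E_star.
by rewrite linear0r.
Qed.

Lemma pythagoras (w : 'I_n -> H) :
  rnorm (\sum_i E i (w i)) ^+ 2 = \sum_i rnorm (E i (w i)) ^+ 2.
Proof.
apply: (@complexI R); rewrite -inner_rnorm rmorph_sum inner_suml.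
apply: eq_bigr => i _; rewrite inner_sumr (bigD1 i)//= -inner_rnorm.
rewrite big1 ?addr0// => j ji.
by rewrite inner_proj eq_sym (negbTE ji).
Qed.

(** Bessel's inequality for the orthogonal projections E_i. *)
Lemma sum_proj_le v : \sum_i rnorm (E i v) ^+ 2 <= rnorm v ^+ 2.
Proof.
have := pythagoras (fun=> v); set u := \sum_i E i v => uE.
have uv : inner u v = (rnorm u ^+ 2)%:C.
  rewrite uE /u inner_suml rmorph_sum; apply: eq_bigr => i _.
  by rewrite /= -inner_rnorm inner_proj eqxx.
have := sqr_ge0 (rnorm (u - v)).
rewrite -scaleN1r rnormD_sqr innerZr uv scaleN1r rnormN rmorphN rmorph1 mulN1r -uE /=.
lra.
Qed.

Lemma proj_le i v : rnorm (E i v) <= rnorm v.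
Proof.
rewrite -ler_sqr ?nnegrE ?rnorm_ge0// (le_trans _ (sum_proj_le v))//.
by rewrite (bigD1 i)//= lerDl sumr_ge0// => j _; rewrite exprn_ge0 ?rnorm_ge0.
Qed.

Lemma coproj_le i v : rnorm (v - E i v) <= rnorm v.
Proof.
have vE : inner v (E i v) = (rnorm (E i v) ^+ 2)%:C.
  have Ei : inner (E i v) (E i v) = inner v (E i v).
    rewrite adjointE -[adjoint (E i)]/(astar (E i)) E_star.
    by rewrite -[E i (E i v)]/(amul (E i) (E i) v) E_orth eqxx.
  by rewrite -Ei inner_rnorm.
rewrite -ler_sqr ?nnegrE ?rnorm_ge0// -scaleN1r rnormD_sqr innerZr vE scaleN1r rnormN.
rewrite rmorphN rmorph1 mulN1r /=; have := sqr_ge0 (rnorm (E i v)); lra.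
Qed.

Lemma sqr_sum_le (c : 'I_n -> R) : (\sum_i c i) ^+ 2 <= n%:R * \sum_i c i ^+ 2.
Proof.
have : 0 <= \sum_i \sum_j (c i - c j) ^+ 2.
  by do 2![apply: sumr_ge0 => ? _]; exact: sqr_ge0.
under eq_bigr => i _.
  under eq_bigr => j _ do rewrite sqrrB.
  rewrite big_split /= sumrB sumr_const card_ord -mulr_natl.
  under [X in _ - X]eq_bigr => j _ do rewrite -mulr_natl.
  rewrite -mulr_sumr -mulr_sumr; over.
rewrite big_split /= sumrB sumr_const card_ord -!mulr_sumr -mulr_suml.
rewrite -mulr_natl expr2; lra.
Qed.

(** Each term splits as E_i U_i w_i, whose ranges are orthogonal, plus
    (1 - E_i) U_i E_i w_i, whose sources are. *)
Lemma two_projections_bound (U t : 'I_n -> bop H) (tau : R) v : 0 <= tau ->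
  (forall i w, rnorm (U i w) <= rnorm w) ->
  (forall i w, rnorm (t i w) <= tau * rnorm w) ->
  (forall i w, E i (t i w) = t i (E i w)) ->
  (forall i, U i (t i v) - E i (U i (t i v)) = U i (E i (t i v)) - E i (U i (E i (t i v)))) ->
  rnorm (\sum_i U i (t i v)) ^+ 2 <= 4 * n%:R * tau ^+ 2 * rnorm v ^+ 2.
Proof.
move=> tau0 U1 t1 Et UE.
pose u1 := \sum_i E i (U i (t i v)); pose u2 := \sum_i (U i (t i v) - E i (U i (t i v))).
have -> : \sum_i U i (t i v) = u1 + u2.
  by rewrite -big_split; apply: eq_bigr => i _; rewrite /= [RHS]addrC subrK.
have Ut i w : rnorm (U i (t i w)) <= tau * rnorm w by rewrite (le_trans (U1 _ _)).
have sqr2 (a b : R) : 0 <= a -> a <= b -> a ^+ 2 <= b ^+ 2.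
  by move=> a0 ab; rewrite lerXn2r ?nnegrE// (le_trans a0 ab).
have h1 : rnorm u1 ^+ 2 <= n%:R * tau ^+ 2 * rnorm v ^+ 2.
  rewrite pythagoras -mulrA -exprMn.
  rewrite [leRHS](_ : _ = \sum_(i < n) (tau * rnorm v) ^+ 2); last first.
    by rewrite sumr_const card_ord mulr_natl.
  by apply: ler_sum => i _; apply: sqr2; rewrite ?rnorm_ge0// (le_trans (proj_le _ _)).
have h2 : rnorm u2 ^+ 2 <= n%:R * tau ^+ 2 * rnorm v ^+ 2.
  apply: (@le_trans _ _ ((\sum_i tau * rnorm (E i v)) ^+ 2)).
    apply: sqr2; first exact: rnorm_ge0.
    rewrite (le_trans (rnorm_sum _ _ _))//; apply: ler_sum => i _.
    by rewrite UE (le_trans (coproj_le _ _))// Et.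
  apply: (le_trans (sqr_sum_le _)); rewrite -mulrA ler_wpM2l//.
  under eq_bigr => i _ do rewrite exprMn.
  by rewrite -mulr_sumr ler_wpM2l ?exprn_ge0// sum_proj_le.
have : rnorm (u1 + u2) ^+ 2 <= (rnorm u1 + rnorm u2) ^+ 2.
  by apply: sqr2; rewrite ?rnorm_ge0 ?rnormD.
have := sqr_ge0 (rnorm u1 - rnorm u2); rewrite sqrrB sqrrD; lra.
Qed.

End orthogonal_projections.

Section matrix_units.
Context {R : realType} {X : choiceType}.
Local Notation I := (X * nat)%type.

Lemma plift_subproof (u : pbij X) (x y : I) :
  omap (fun z => (z, x.2)) (u x.1) = Some y <-> omap (fun z => (z, y.2)) (pinv u y.1) = Some x.
Proof.
case: x y => [x l] [y m] /=; split.
  by case ux : (pbij_fun u x) => [z|]//= [<- <-]; have /pbijP := ux => ->.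
by case uy : (pbij_inv u y) => [z|]//= [<- <-]; have /pbijP := uy => ->.
Qed.

Definition plift (u : pbij X) : pbij I := PBij (plift_subproof u).

Lemma munit_subproof (j : nat) (x y : I) :
  (if x.2 == j then Some (x.1, 0%N) else None) = Some y <->
  (if y.2 == 0%N then Some (y.1, j) else None) = Some x.
Proof.
by case: x y => [x l] [y m] /=; split; case: eqP => // -> [<- <-]; rewrite eqxx.
Qed.

(** The partial isometry from level 0 onto level j. *)
Definition munit (j : nat) : pbij I := PBij (munit_subproof j).

Definition pe j : bop (ell2 R I) := pop R (munit j).
Definition lift_op (u : pbij X) : bop (ell2 R I) := pop R (plift u).

Lemma pe_orth j l : amul (astar (pe j)) (pe l) = if j == l then pe 0 else 0.
Proof.
rewrite /pe pop_star pop_comp; case: eqP => [->|jl].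
  by apply: eq_pop => -[x m] /=; case: (m =P 0%N) => //= _; rewrite eqxx.
apply: bopE => f; apply: ell2E => -[x m]; rewrite popE /=.
by case: (m =P 0%N) => //= _; rewrite (introF eqP jl).
Qed.

Lemma pe0_star : astar (pe 0) = pe 0.
Proof. by rewrite /pe pop_star; apply: eq_pop. Qed.

Lemma pe_pe0 j : amul (pe j) (pe 0) = pe j.
Proof.
by rewrite /pe pop_comp; apply: eq_pop => -[x m] /=; case: (m =P j).
Qed.

Lemma pe0_pe_star j : amul (pe 0) (astar (pe j)) = astar (pe j).
Proof. by rewrite -[in RHS](pe_pe0 j) astarM pe0_star. Qed.

Lemma lift_pe u j : amul (lift_op u) (pe j) = amul (pe j) (lift_op u).
Proof.
rewrite /lift_op /pe !pop_comp; apply: eq_pop => -[x m] /=.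
by case: (m =P j) => [->|mj] /=; case: (pbij_fun u x) => [y|]//=;
  rewrite ?eqxx// (introF eqP mj).
Qed.

Lemma lift_pe_star u j : amul (lift_op u) (astar (pe j)) = amul (astar (pe j)) (lift_op u).
Proof.
have lift_star v : astar (lift_op v) = lift_op (pinv v).
  by rewrite /lift_op pop_star; apply: eq_pop.
apply: (can_inj (@astarK R _)); rewrite !astarM astarK lift_star.
by rewrite lift_pe.
Qed.

(** The scalar k-by-k matrix c acting on the levels below k. *)
Definition level_mx (k : nat) (c : nat -> nat -> R[i]) : bop (ell2 R I) :=
  \sum_(l < k) \sum_(j < k) c l j *: amul (pe l) (astar (pe j)).

(** Operators that move the first coordinate commute with matrices on the levels. *)
Lemma lift_level_mx u k c : amul (lift_op u) (level_mx k c) = amul (level_mx k c) (lift_op u).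
Proof.
rewrite /level_mx amul_sumr amul_suml; apply: eq_bigr => l _.
rewrite amul_sumr amul_suml; apply: eq_bigr => j _.
by rewrite amulZr amulZl amulA lift_pe -!amulA lift_pe_star.
Qed.

Lemma level_pythag k (w : nat -> ell2 R I) :
  rnorm (\sum_(l < k) pe l (w l)) ^+ 2 = \sum_(l < k) rnorm (pe 0 (w l)) ^+ 2.
Proof.
apply: (@complexI R); rewrite -inner_rnorm rmorph_sum inner_suml.
have E (l j : nat) x y : inner (pe l x) (pe j y) = if l == j then inner (pe 0 x) (pe 0 y) else 0.
  rewrite adjointE -[adjoint _]/(astar (pe l)).
  rewrite -[astar (pe l) (pe j y)]/(amul (astar (pe l)) (pe j) y) pe_orth.
  case: eqP => _; last by rewrite linear0r.
  rewrite adjointE -[adjoint _]/(astar (pe 0)) pe0_star.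
  by rewrite -[pe 0 (pe 0 y)]/(amul (pe 0) (pe 0) y) pe_pe0.
apply: eq_bigr => l _; rewrite inner_sumr (bigD1 l)//= E eqxx inner_rnorm big1 ?addr0// => j jl.
by rewrite E eq_sym (negbTE (jl : (j : nat) != l)).
Qed.

Lemma level_coord_le k v : \sum_(j < k) rnorm (astar (pe j) v) ^+ 2 <= rnorm v ^+ 2.
Proof.
pose u := \sum_(j < k) pe j (astar (pe j) v).
have uE : rnorm u ^+ 2 = \sum_(j < k) rnorm (astar (pe j) v) ^+ 2.
  rewrite (level_pythag k (fun j => astar (pe j) v)); apply: eq_bigr => j _.
  by rewrite -[pe 0 _]/(amul (pe 0) (astar (pe j)) v) pe0_pe_star.
have uv : inner u v = (rnorm u ^+ 2)%:C.
  rewrite uE inner_suml rmorph_sum; apply: eq_bigr => j _.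
  by rewrite adjointE; exact: inner_rnorm.
rewrite -uE; have := sqr_ge0 (rnorm (u - v)).
rewrite -scaleN1r rnormD_sqr innerZr uv scaleN1r rnormN rmorphN rmorph1 mulN1r /=.
lra.
Qed.

Lemma level_mxE k c v :
  level_mx k c v = \sum_(l < k) pe l (\sum_(j < k) c l j *: astar (pe j) v).
Proof.
rewrite /level_mx bop_sum_apply; apply: eq_bigr => l _.
rewrite bop_sum_apply linear_sum; apply: eq_bigr => j _.
by rewrite bop_scaleE linearZ.
Qed.

Lemma pe_le j v : rnorm (pe j v) <= rnorm v.
Proof. exact: rnorm_pop. Qed.

Lemma level_mx_le k (c : nat -> nat -> R[i]) (tau : R) v : 0 <= tau ->
  (forall z : nat -> R[i], \sum_(l < k) nsq (\sum_(j < k) c l j * z j) <=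
     tau ^+ 2 * \sum_(j < k) nsq (z j)) ->
  rnorm (level_mx k c v) <= tau * rnorm v.
Proof.
move=> tau0 cz; rewrite -ler_sqr ?nnegrE ?mulr_ge0 ?rnorm_ge0// exprMn level_mxE.
rewrite (level_pythag k (fun l => \sum_(j < k) c l j *: astar (pe j) v)).
pose w j : ell2 R I := astar (pe j) v.
apply: (@le_trans _ _ (tau ^+ 2 * \sum_(j < k) rnorm (w j) ^+ 2)); last first.
  by rewrite ler_wpM2l ?exprn_ge0// level_coord_le.
apply: (@le_trans _ _ (\sum_(l < k) rnorm (\sum_(j < k) c l j *: w j) ^+ 2)).
  by apply: ler_sum => l _; rewrite lerXn2r ?nnegrE ?rnorm_ge0// pe_le.
under eq_bigr => l _ do rewrite ell2_rnorm_sq.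
under [X in _ <= _ * X]eq_bigr => j _ do rewrite ell2_rnorm_sq.
have cv : \sum_(l < k) psq (\sum_(j < k) c l j *: w j : ell2 R I) A @[A --> @finsets I] -->
    \sum_(l < k) ell2_sq (\sum_(j < k) c l j *: w j).
  by apply: cvg_sum_seq => l; exact: psq_cvg.
apply: (cvgr_to_le cv); apply: nearW => A.
have sumE l x : (\sum_(j < k) c l j *: w j : ell2 R I) x = \sum_(j < k) c l j * w j x.
  by apply: (big_morph (fun f : ell2 R I => f x)).
apply: (@le_trans _ _ (tau ^+ 2 * \sum_(j < k) psq (w j) A)); last first.
  by rewrite ler_wpM2l ?exprn_ge0//; apply: ler_sum => j _; exact: psq_le.
rewrite /psq exchange_big /= [X in _ <= _ * X]exchange_big /= mulr_sumr.
apply: ler_sum => x _; apply: le_trans (cz (fun j => w j x)).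
by apply: ler_sum => l _; rewrite sumE.
Qed.

End matrix_units.

Section tree_like.
Context {R : realType} {X : choiceType} {n : nat} (sigma : 'I_n -> X -> X).
Hypothesis sigmaK : forall i, involutive (sigma i).
Local Notation H := (ell2 R (X * nat)%type).

Lemma pinvol_subproof i (x y : X) : Some (sigma i x) = Some y <-> Some (sigma i y) = Some x.
Proof. by split=> -[<-]; rewrite sigmaK. Qed.

Definition pinvol i : pbij X := PBij (pinvol_subproof i).

Lemma prest_subproof (P : pred X) (x y : X) :
  (if P x then Some x else None) = Some y <-> (if P y then Some y else None) = Some x.
Proof. by split; case: ifP => // Px [<-]; rewrite Px. Qed.

Definition prest (P : pred X) : pbij X := PBij (prest_subproof P).

Definition shift_op i : bop H := lift_op (pinvol i).
Definition rest_op (P : pred X) : bop H := lift_op (prest P).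

Lemma shift_opE i v x l : shift_op i v (x, l) = v (sigma i x, l).
Proof. by []. Qed.

Lemma rest_opE P v x l : rest_op P v (x, l) = if P x then v (x, l) else 0.
Proof. by rewrite popE /=; case: (P x). Qed.

Lemma shift_star i : astar (shift_op i) = shift_op i.
Proof. by rewrite /shift_op /lift_op pop_star; apply: eq_pop. Qed.

Lemma shift_sq i : amul (shift_op i) (shift_op i) = bop_id H.
Proof.
rewrite /shift_op /lift_op pop_comp -pop_id; apply: eq_pop => -[x l] /=.
by rewrite sigmaK.
Qed.

Lemma shift_pe i j : amul (shift_op i) (pe j) = amul (pe j) (shift_op i).
Proof. exact: lift_pe. Qed.

Lemma shift_delta i x l : shift_op i (delta R (x, l)) = delta R (sigma i x, l).
Proof. by rewrite /shift_op /lift_op pop_delta. Qed.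

Lemma rnorm_shift i v : rnorm (shift_op i v) <= rnorm v.
Proof. exact: rnorm_pop. Qed.

Definition tree_sum k (t : 'I_n -> nat -> nat -> R[i]) : bop H :=
  \sum_i amul (shift_op i) (level_mx k (t i)).

(** With the matrix units pe, amplifications of the corners U_i p are the sums of
    translations with matrix coefficients. *)
Lemma ampl_tree_sum k t :
  ampl (@pe R X) (fun i => amul (shift_op i) (pe 0)) k t = tree_sum k t.
Proof.
apply: eq_bigr => i _; rewrite /level_mx amul_sumr; apply: eq_bigr => l _.
rewrite amul_sumr; apply: eq_bigr => j _; rewrite amulZr; congr (_ *: _).
by rewrite amulA amulA -shift_pe -(amulA (shift_op i)) pe_pe0 amulA.
Qed.

(** On a regular tree, label every vertex by the colour of its first edge towards a
    root. An edge is then the first edge of exactly one of its two ends, which is the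
    hypothesis on s: it holds at every vertex where v does not vanish. *)
Lemma tree_sum_le (s : X -> option 'I_n) k t (tau : R) (v : H) : 0 <= tau ->
  (forall i (w : H), rnorm (level_mx k (t i) w) <= tau * rnorm w) ->
  (forall i x l, s x != Some i -> s (sigma i x) != Some i -> v (x, l) = 0) ->
  rnorm (tree_sum k t v) ^+ 2 <= 4 * n%:R * tau ^+ 2 * rnorm v ^+ 2.
Proof.
move=> tau0 t1 sv; pose E i := rest_op (fun x => s x == Some i).
have E_star i : astar (E i) = E i by rewrite /E /rest_op /lift_op pop_star; apply: eq_pop.
have E_orth i j : amul (E i) (E j) = if i == j then E i else 0.
  have [<-|ij] := eqVneq i j; apply: bopE => w; apply: ell2E => -[x l].
    by rewrite -[LHS]/(E i (E i w) (x, l)) !rest_opE; case: (s x == Some i).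
  rewrite -[LHS]/(E i (E j w) (x, l)) !rest_opE; case: eqP => // ->.
  by case: eqP => // -[ij']; rewrite ij' eqxx in ij.
have comm P i (w : H) : rest_op P (level_mx k (t i) w) = level_mx k (t i) (rest_op P w).
  have := lift_level_mx (prest P) k (t i); rewrite -/(rest_op P).
  by move=> /(congr1 (fun f : bop H => f w)).
rewrite /tree_sum bop_sum_apply.
apply: (two_projections_bound E_star E_orth (U := shift_op)
  (t := fun i => level_mx k (t i))) => //.
- exact: rnorm_shift.
- by move=> i w; exact: comm.
move=> i; pose P x := (s x != Some i) && (s (sigma i x) != Some i).
have Pv : rest_op P (level_mx k (t i) v) = 0.
  rewrite comm (_ : rest_op P v = 0) ?linear0//.
  by apply: ell2E => -[x l]; rewrite rest_opE /P; case: ifP => // /andP[h1 h2];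
    exact: (sv i x l h1 h2).
apply: ell2E => -[x l]; rewrite !(ell2_addE, ell2_oppE) !rest_opE !shift_opE !rest_opE.
case: (eqVneq (s x) (Some i)) => sx; first by rewrite !subrr.
rewrite !subr0; case: (eqVneq (s (sigma i x)) (Some i)) => // ssx.
have := congr1 (fun f : H => f (sigma i x, l)) Pv; rewrite rest_opE /P sigmaK ssx sx /=.
exact.
Qed.

End tree_like.

(** * Reduced words *)

Section words.
Context {n : nat}.
Implicit Types (w : seq 'I_n) (i : 'I_n).

(** Alternating words, the elements of a free product of n groups of order 2. *)
Definition reduced w := sorted (fun i j => i != j) w.

(** Left multiplication by the generator i, truncated to words of length at most m
    when m is finite. *)
Definition step (m : option nat) i w : seq 'I_n :=
  if ohead w == Some i then behead w
  else if oapp (fun k => size w < k)%N true m then i :: w else w.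

Definition word m : pred (seq 'I_n) :=
  fun w => reduced w && oapp (fun k => size w <= k)%N true m.

Lemma step_word m i w : word m w -> word m (step m i w).
Proof.
rewrite /word /step => /andP[rw sw]; case: w rw sw => [|j w] /= rw sw.
  by case: m sw => [[|k]|].
case: ifP => [_|/negbT ji].
  apply/andP; split; first exact: path_sorted rw.
  by case: m sw => //= k; apply: ltnW.
case: ifP => jm; last by rewrite /reduced /= rw.
rewrite /reduced /= rw andbT; apply/andP; split; last by case: m jm sw.
by apply: contraNN ji => /eqP ->.
Qed.

Lemma stepK m i w : word m w -> step m i (step m i w) = w.
Proof.
rewrite /word => /andP[rw sw]; rewrite [step m i w]/step.
have [hw|hw] := eqVneq (ohead w) (Some i).
  case: w hw rw sw => //= j w [->] rw sw; rewrite /step.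
  have -> : ohead w == Some i = false.
    case: w rw {sw} => //= j' w /andP[ij _]; apply/negbTE; apply: contraNN ij.
    by move=> /eqP[->].
  by case: m sw => [k|] //= ->.
case jm : (oapp _ true m); first by rewrite /step /= eqxx.
by rewrite /step (negbTE hw) jm.
Qed.

Lemma step_size m i w : (size (step m i w) <= (size w).+1)%N.
Proof.
rewrite /step; case: ifP => _; first by rewrite size_behead (leq_trans (leq_pred _)).
by case: ifP => _ //=; exact: leqW.
Qed.

Lemma step_head m i w : oapp (fun k => size w < k)%N true m ->
  ohead w != Some i -> ohead (step m i w) = Some i.
Proof. by rewrite /step => -> /negbTE ->. Qed.

End words.

(** * The left asymptotic norm may be smaller than the maximal norm *)

Section generators.
Context {R : realType} {B : cstarAlgebra R} {J : countType} (f : J -> B).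

Definition gens (k : nat) : B := if choice.unpickle k is Some j then f j else 0.

Lemma gensE j : gens (choice.pickle j) = f j.
Proof. by rewrite /gens choice.pickleK. Qed.

Definition calg_of (j : J) : calg gens := calg_gen gens (choice.pickle j).

Lemma calg_ofE j : calg_val (calg_of j) = f j.
Proof. exact: gensE. Qed.

Lemma gens_ind (P : B -> Prop) : P 0 -> (forall j, P (f j)) -> forall k, P (gens k).
Proof. by move=> P0 Pf k; rewrite /gens; case: choice.unpickle. Qed.

End generators.

(** Commutation with the generators passes to *-polynomials and to limits, first in y
    and then in x. *)
Lemma calg_commute (R : realType) (B : cstarAlgebra R) (f g : nat -> B) :
  (forall i j, amul (f i) (g j) = amul (g j) (f i)) ->
  (forall i j, amul (f i) (astar (g j)) = amul (astar (g j)) (f i)) ->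
  forall (x : calg f) (y : calg g),
    amul (calg_val x) (calg_val y) = amul (calg_val y) (calg_val x).
Proof.
move=> fg fgs.
pose comm (x y : B) := amul x y = amul y x.
have commD x y z : comm x z -> comm y z -> comm (x + y) z.
  by rewrite /comm => xz yz; rewrite amulDl amulDr xz yz.
have commZ c x z : comm x z -> comm (c *: x) z.
  by rewrite /comm => xz; rewrite amulZl amulZr xz.
have commM x y z : comm x z -> comm y z -> comm (amul x y) z.
  by rewrite /comm => xz yz; rewrite -amulA yz amulA xz -amulA.
have comm0 z : comm 0 z by rewrite /comm amul0l amul0r.
have commC x y : comm x y -> comm y x by [].
have comm_closed z x : (forall e : R, 0 < e -> exists2 y, comm y z & rnorm (x - y) < e) -> comm x z.
  move=> xz; apply/eqP; rewrite -subr_eq0; apply/eqP/rnorm_eq0/le_anti.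
  rewrite rnorm_ge0 andbT; apply/ler_addgt0Pr => e e0; rewrite add0r.
  have z1 : 0 < 2 * rnorm z + 1 by rewrite ltr_wpDl// mulr_ge0 ?rnorm_ge0.
  have [y yz xy] := xz _ (divr_gt0 e0 z1).
  have -> : amul x z - amul z x = amul (x - y) z - amul z (x - y).
    by rewrite amulBl amulBr yz opprB addrA subrK.
  rewrite (le_trans (rnormD _ _))// rnormN.
  have := rnormM (x - y) z; have := rnormM z (x - y).
  have := rnorm_ge0 z; move: xy; rewrite ltr_pdivlMr//; have := rnorm_ge0 (x - y); nra.
have commS x z : comm x z -> comm (astar x) (astar z).
  by rewrite /comm => xz; rewrite -!astarM xz.
move=> x y.
have yP i : comm (calg_val y) (f i) /\ comm (astar (calg_val y)) (f i).
  apply: (@generated_ind _ _ g (fun b => comm b (f i) /\ comm (astar b) (f i)));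
    last exact: calg_subproof.
  - by rewrite astar0.
  - by move=> n; split; apply: commC; [exact: fg|exact: fgs].
  - by move=> a b [? ?] [? ?]; rewrite astarD; split; exact: commD.
  - by move=> c a [? ?]; rewrite astarZ; split; exact: commZ.
  - by move=> a b [? ?] [? ?]; rewrite astarM; split; exact: commM.
  - by move=> a [? ?]; rewrite astarK.
  - move=> a ab; split; apply: comm_closed => e /ab[b [b1 b2] ab'].
      by exists b.
    by exists (astar b) => //; rewrite -astarB rnorm_star.
have xP : comm (calg_val x) (calg_val y) /\ comm (astar (calg_val x)) (calg_val y).
  apply: (@generated_ind _ _ f (fun b => comm b (calg_val y) /\ comm (astar b) (calg_val y)));
    last exact: calg_subproof.
  - by rewrite astar0.
  - move=> n; have [y1 y2] := yP n; split; first exact: commC.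
    by apply: commC; have := commS _ _ y2; rewrite astarK.
  - by move=> a b [? ?] [? ?]; rewrite astarD; split; exact: commD.
  - by move=> c a [? ?]; rewrite astarZ; split; exact: commZ.
  - by move=> a b [? ?] [? ?]; rewrite astarM; split; exact: commM.
  - by move=> a [? ?]; rewrite astarK.
  - move=> a ab; split; apply: comm_closed => e /ab[b [b1 b2] ab'].
      by exists b.
    by exists (astar b) => //; rewrite -astarB rnorm_star.
by case: xP.
Qed.

Section commuting_representation.
Context {R : realType} {H : hilbertSpace R} (f g : nat -> bop H).
Local Notation A := (calg f).
Local Notation D := (calg g).
Hypothesis comm : forall (x : A) (y : D),
  amul (calg_val x) (calg_val y) = amul (calg_val y) (calg_val x).

(** The representation x ⊗ y |-> x y of the tensor product of two commuting algebras. *)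
Definition product_rep (x : A ⊙ D) : bop H :=
  \sum_(p <- repr x) amul (calg_val p.1) (calg_val p.2).

Lemma product_rep_tclass (s : seq (A * D)) :
  product_rep (tclass s) = \sum_(p <- s) amul (calg_val p.1) (calg_val p.2).
Proof.
apply: (@tensor_eqv_sum _ _ _ _ (fun a d => amul (calg_val a) (calg_val d))) (repr_class s).
- by move=> a a' d; rewrite calg_valD amulDl.
- by move=> a d d'; rewrite calg_valD amulDr.
- by move=> c a d; rewrite !calg_valZ amulZl amulZr.
- by move=> d; rewrite amul0l.
Qed.

Lemma product_rep_hom : star_hom product_rep.
Proof.
split.
- move=> c x y; have [s ->] := tclass_ex x; have [t ->] := tclass_ex y.
  rewrite -[c *: tclass s]class_scale -class_catE !product_rep_tclass big_cat big_map /=.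
  by rewrite scaler_sumr; congr (_ + _); apply: eq_bigr => p _; rewrite -amulZl.
- move=> x y; have [s ->] := tclass_ex x; have [t ->] := tclass_ex y.
  rewrite -[amul (tclass s) _]class_mul !product_rep_tclass big_allpairs_dep.
  rewrite amul_suml; apply: eq_bigr => p _; rewrite amul_sumr; apply: eq_bigr => q _.
  rewrite /tensor_mul !calg_valM -!amulA; congr amul.
  by rewrite !amulA comm.
- move=> x; have [s ->] := tclass_ex x.
  rewrite -[astar (tclass s)]class_star !product_rep_tclass big_map astar_sum.
  by apply: eq_bigr => p _; rewrite /tensor_star /= -!calg_valS comm -astarM.
Qed.

End commuting_representation.

Section asymptotic_isometry.
Context {R : realType} {A C : cstarAlgebra R} (mu : R -> A -> C).
Hypothesis hmu : asymptotic_hom mu.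

(** The C*-identity for mu_t a, up to errors that vanish at infinity. *)
Lemma asymptotic_cstar (a : A) (d : R) : 0 < d ->
  \forall t \near +oo,
    rnorm (mu t a) ^+ 2 <= rnorm (mu t (amul (astar a) a)) + d + d * rnorm (mu t a).
Proof.
move=> d0.
apply: filterS (filterI (asymptotic_small (asymptotic_mul hmu (astar a) a) d0)
  (asymptotic_small (asymptotic_star hmu a) d0)) => t [h1 h2].
rewrite -rnorm_cstar.
have -> : amul (astar (mu t a)) (mu t a) = mu t (amul (astar a) a)
    - (mu t (amul (astar a) a) - amul (mu t (astar a)) (mu t a))
    - amul (mu t (astar a) - astar (mu t a)) (mu t a).
  by rewrite subKr amulBl subKr.
rewrite (le_trans (rnormD _ _))// rnormN lerD//.
  by rewrite (le_trans (rnormD _ _))// rnormN lerD2l ltW.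
by rewrite (le_trans (rnormM _ _))// ler_wpM2r ?rnorm_ge0// ltW.
Qed.

Lemma asymptotic_projection_le (q : A) (e : R) : 0 < e -> astar q = q -> amul q q = q ->
  \forall t \near +oo, rnorm (mu t q) <= 1 + e.
Proof.
move=> e0 qs qq; have d0 : 0 < e / 2 by rewrite divr_gt0.
apply: filterS (asymptotic_cstar q d0) => t; rewrite qs qq.
have := rnorm_ge0 (mu t q); set x := rnorm _ => x0 h.
by rewrite leNgt; apply/negP => hx; nra.
Qed.

(** An asymptotic homomorphism need not be contractive at any given time; on elements
    whose modulus is a projection, the C*-identity makes it so in the limit. *)
Lemma asymptotic_isometry_le (a q : A) (e : R) : 0 < e -> amul (astar a) a = q ->
  astar q = q -> amul q q = q -> \forall t \near +oo, rnorm (mu t a) <= 1 + e.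
Proof.
move=> e0 aq qs qq; have d0 : 0 < e / 4 by rewrite divr_gt0.
apply: filterS (filterI (asymptotic_cstar a d0) (asymptotic_projection_le d0 qs qq)).
move=> t [+ h1]; rewrite aq.
have := rnorm_ge0 (mu t a); set x := rnorm (mu t a) => x0 h.
by rewrite leNgt; apply/negP => hx; nra.
Qed.

End asymptotic_isometry.

Section left_right.
Context {R : realType} (n : nat).

Definition free_word := {w : seq 'I_n | word None w}.

Definition free_step (i : 'I_n) (w : free_word) : free_word :=
  exist _ (step None i (sval w)) (step_word i (svalP w)).

Lemma free_stepK i : involutive (free_step i).
Proof. by move=> w; apply: val_inj; exact: stepK (svalP w). Qed.

Definition free_one : free_word := exist _ [::] isT.

(** The maps of the tree into itself carry two commuting families of involutions:
    composition with the generators after and before. *)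
Definition tree_map := (free_word -> free_word : choiceType).

Definition post_step i (x : tree_map) : tree_map := free_step i \o x.
Definition pre_step i (x : tree_map) : tree_map := x \o free_step i.

Lemma post_stepK i : involutive (post_step i).
Proof. by move=> x; apply/funext => w; exact: free_stepK. Qed.

Lemma pre_stepK i : involutive (pre_step i).
Proof. by move=> x; apply/funext => w; rewrite /pre_step /= free_stepK. Qed.

Definition tree_label (x : tree_map) : option 'I_n := ohead (sval (x free_one)).

Lemma tree_label_step i x : tree_label x != Some i -> tree_label (post_step i x) = Some i.
Proof. exact: step_head. Qed.

Local Notation H := (ell2 R (tree_map * nat)%type).
Local Notation L := (shift_op post_stepK).
Local Notation S := (shift_op pre_stepK).

Definition left_gen (j : nat + 'I_n) : bop H :=
  match j with inl j => pe j | inr i => amul (L i) (pe 0) end.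
Definition right_gen (i : 'I_n) : bop H := S i.

Local Notation A := (calg (gens right_gen)).
Local Notation D := (calg (gens left_gen)).

Lemma left_right_comm (x : A) (y : D) :
  amul (calg_val x) (calg_val y) = amul (calg_val y) (calg_val x).
Proof.
have SL i j : amul (S i) (L j) = amul (L j) (S i).
  by rewrite /shift_op /lift_op !pop_comp; apply: eq_pop.
have gS k : astar (gens right_gen k) = gens right_gen k.
  by apply: (gens_ind (P := fun b => astar b = b)) => [|i]; [exact: astar0|exact: shift_star].
have comm i j : amul (gens right_gen i) (gens left_gen j) = amul (gens left_gen j) (gens right_gen i).
  apply: (gens_ind (P := fun b => amul b (gens left_gen j) = amul (gens left_gen j) b)).
    by rewrite amul0l amul0r.
  move=> {}i; apply: (gens_ind (P := fun b => amul (right_gen i) b = amul b (right_gen i))).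
    by rewrite amul0l amul0r.
  case=> [{}j|{}j]; first exact: shift_pe.
  rewrite -[left_gen _]/(amul (L j) (pe 0)) -[right_gen i]/(S i).
  by rewrite amulA SL -!amulA shift_pe.
apply: calg_commute => // i j.
by apply: (can_inj (@astarK R _)); rewrite !astarM !astarK !gS comm.
Qed.

Definition unit_of j : D := calg_of left_gen (inl j).
Definition left_of i : D := calg_of left_gen (inr i).
Definition right_of i : A := calg_of right_gen i.

Lemma contractive_level_mx (X : choiceType) k (t : 'I_n -> nat -> nat -> R[i]) :
  contractive_coeffs k t ->
  forall i (w : ell2 R (X * nat)%type), rnorm (level_mx k (t i) w) <= 1 * rnorm w.
Proof.
move=> tk i w; apply: level_mx_le => // z.
by rewrite expr1n mul1r; exact: tk.
Qed.

(** The label of a map x is the first letter of the value of x at the empty word; a left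
    step that does not remove this letter prepends a new one. *)
Lemma left_ampl_le (C : R) k t : 0 <= C -> 4 * n%:R <= C ^+ 2 -> contractive_coeffs k t ->
  rnorm (ampl unit_of left_of k t) <= C.
Proof.
move=> C0 nC tk; rewrite calg_rnorm.
have -> : calg_val (ampl unit_of left_of k t) = tree_sum post_stepK k t.
  rewrite -ampl_tree_sum /ampl calg_val_sum; apply: eq_bigr => i _.
  rewrite calg_val_sum; apply: eq_bigr => l _; rewrite calg_val_sum; apply: eq_bigr => j _.
  rewrite calg_valZ !calg_valM calg_valS /unit_of /left_of.
  by rewrite (calg_ofE left_gen (inl (nat_of_ord l))) (calg_ofE left_gen (inr i))
    (calg_ofE left_gen (inl (nat_of_ord j))).
rewrite bop_rnormE; apply: opnorm_le => // v.
rewrite -ler_sqr ?nnegrE ?mulr_ge0 ?rnorm_ge0// exprMn.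
apply: (@le_trans _ _ (4 * n%:R * 1 ^+ 2 * rnorm v ^+ 2)); last first.
  by rewrite expr1n mulr1 ler_wpM2r ?exprn_ge0 ?rnorm_ge0.
apply: (tree_sum_le post_stepK (s := tree_label)) => //; first exact: contractive_level_mx.
by move=> i x l /(tree_label_step)->; rewrite eqxx.
Qed.

Definition left_right_tensor : A ⊙ D :=
  tclass [seq (right_of i, left_of i) | i <- enum 'I_n].

(** The unitaries S_i are mapped to asymptotic contractions, and the tensor bound applies
    to the genuine representation of D on the other side, at every late time. *)
Lemma lambda_left_right_le (C : R) : 0 <= C -> 4 * n%:R <= C ^+ 2 ->
  (lambda_norm A D left_right_tensor <= C%:E)%E.
Proof.
move=> C0 nC; apply: ge_ereal_sup => _ [H1 [H2 [K [mu [nu [_ _ hmu hnu ->]]]]]].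
apply: quotient_norm_tclass_le => // e e0.
have C1 : 0 < C + 1 by rewrite ltr_wpDl.
have d0 : 0 < e / (C + 1) by rewrite divr_gt0.
have near_contr i : \forall t \near +oo, rnorm (mu t (right_of i)) <= 1 + e / (C + 1).
  apply: (asymptotic_isometry_le hmu (q := amul (right_of i) (right_of i)) d0).
  - congr amul; apply: calgE; rewrite calg_valS /right_of.
    by rewrite (calg_ofE right_gen i); exact: shift_star.
  - apply: calgE; rewrite calg_valS calg_valM /right_of (calg_ofE right_gen i).
    by rewrite astarM; congr amul; exact: shift_star.
  - apply: calgE; rewrite !calg_valM /right_of (calg_ofE right_gen i).
    have -> : amul (right_gen i) (right_gen i) = bop_id H by exact: shift_sq.
    exact: bopE.
have near_all : \forall t \near +oo, forall i, rnorm (mu t (right_of i)) <= 1 + e / (C + 1).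
  by apply: filter_forall; exact: near_contr.
apply: filterS near_all => t mut.
rewrite big_map big_enum /= bop_rnormE.
apply: (@le_trans _ _ (C * (1 + e / (C + 1)))); last first.
  rewrite mulrDr mulr1 lerD2l mulrA ler_pdivrMr// mulrC ler_wpM2l ?ltW//.
  by rewrite ltrDl.
have t0 : 0 < 1 + e / (C + 1) by rewrite addr_gt0.
have val0 : calg_val (unit_of 0%N) = pe 0 by rewrite /unit_of (calg_ofE left_gen (inl 0%N)).
have vali i : calg_val (left_of i) = amul (L i) (pe 0).
  by rewrite /left_of (calg_ofE left_gen (inr i)).
apply: (@tensor_bound_right R D unit_of (unit_of 0%N) n left_of) => //.
- move=> j l; apply: calgE; rewrite calg_valM calg_valS /unit_of.
  rewrite (calg_ofE left_gen (inl j)) (calg_ofE left_gen (inl l)) /= pe_orth.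
  by case: eqP => // _; rewrite (calg_ofE left_gen (inl 0%N)).
- by apply: calgE; rewrite calg_valM val0 pe_pe0.
- by apply: calgE; rewrite calg_valS val0 pe0_star.
- by move=> i; apply: calgE; rewrite calg_valM val0 vali amulA -shift_pe -amulA pe_pe0.
- by move=> i; apply: calgE; rewrite calg_valM val0 vali -amulA pe_pe0.
- by move=> k u; exact: left_ampl_le.
- by move=> i v; rewrite (le_trans (rnorm_bop _ _))// -bop_rnormE ler_wpM2r ?rnorm_ge0.
Qed.

(** The identity map of the tree is fixed by a step after followed by the same step
    before, so that its basis vector has eigenvalue n. *)
Lemma max_left_right_ge : (n%:R%:E <= max_norm A D left_right_tensor)%E.
Proof.
pose P := product_rep (f := gens right_gen) (g := gens left_gen).
apply: (@le_trans _ _ (rnorm (P left_right_tensor))%:E); last first.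
  apply: ereal_sup_ubound; exists H, P; split=> //.
  exact: product_rep_hom left_right_comm.
rewrite lee_fin; pose d : H := delta R (id : tree_map, 0%N).
have Pd : P left_right_tensor d = n%:R *: d.
  rewrite /P product_rep_tclass big_map big_enum bop_sum_apply.
  rewrite (eq_bigr (fun=> d)) ?sumr_const ?card_ord ?scaler_nat// => i _.
  rewrite -[LHS]/(amul (calg_val (right_of i)) (calg_val (left_of i)) d).
  rewrite /right_of /left_of (calg_ofE right_gen i) (calg_ofE left_gen (inr i)).
  rewrite -[LHS]/(S i (L i (pe 0 d))).
  have -> : pe 0 d = d by rewrite /pe /d pop_delta.
  rewrite /d !shift_delta; congr delta; congr pair.
  by apply/funext => w; rewrite /pre_step /post_step /= free_stepK.
have := rnorm_bop (P left_right_tensor) d.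
rewrite Pd rnormZ rnorm_delta !mulr1 (_ : n%:R = n%:R%:C); last by rewrite rmorph_nat.
by rewrite normc_RC.
Qed.

End left_right.

Lemma lambda_neq_max (R : realType) : exists A D : cstarAlgebra R,
  [/\ separable A, separable D & lambda_norm A D <> max_norm A D].
Proof.
(* For n = 9 the bound 2 sqrt n is 6. *)
exists (calg (gens (@right_gen R 9))), (calg (gens (@left_gen R 9))).
split; [exact: calg_separable|exact: calg_separable|].
move=> /(congr1 (fun N => N (left_right_tensor 9))) eq_norms.
have := max_left_right_ge (R := R) 9; rewrite -eq_norms.
move=> /le_trans/(_ (lambda_left_right_le (C := 6) _ _)).
rewrite lee_fin => h; have : (9%:R : R) <= 6 by apply: h; lra.
by rewrite ler_nat.
Qed.

(** * Damping operators and moments *)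

Section accretive.
Context {R : realType} {H : hilbertSpace R}.

(** With Q = 1 + P and s small, v |-> v - s Q v is a contraction because Re Q >= 1; so
    the fixed point of g |-> s + (1 - s Q) g exists, and it inverts Q. *)
Lemma accretive_inverse (P : bop H) : (forall v, 0 <= complex.Re (inner (P v) v)) ->
  exists g : bop H, forall v, g v + P (g v) = v.
Proof.
move=> P0; pose l := opnorm P + 1; have l1 : 1 <= l by rewrite lerDr opnorm_ge0.
have l0 : 0 < l by apply: lt_le_trans l1.
pose s := l ^- 2; have s0 : 0 < s by rewrite invr_gt0 exprn_gt0.
have s1 : s <= 1 by rewrite invf_le1 ?exprn_gt0// exprn_ege1.
have sl : s * l ^+ 2 = 1 by rewrite mulVf// expf_neq0// gt_eqF.
pose Q := bop_id H + P; pose G : bop H := bop_id H - s%:C *: Q.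
pose rho := Num.sqrt (1 - s).
have rho0 : 0 <= rho by exact: sqrtr_ge0.
have rho1 : rho < 1 by rewrite -[ltRHS]sqrtr1 ltr_sqrt// gtrBl.
have QE v : Q v = v + P v by [].
have Ql v : rnorm (Q v) <= l * rnorm v.
  by rewrite QE /l mulrDl mul1r (le_trans (rnormD _ _))// addrC lerD2r rnorm_bop.
have Gl v : rnorm (G v) <= rho * rnorm v.
  rewrite -ler_sqr ?nnegrE ?mulr_ge0 ?rnorm_ge0// exprMn sqr_sqrtr ?subr_ge0//.
  have -> : G v = v + (- s)%:C *: Q v.
    by rewrite rmorphN scaleNr.
  rewrite rnormD_sqr rnormZR innerZr conj_RC ReZ -(Re_innerC v) QE innerDl ReD inner_rnorm -QE.
  have Qv : rnorm (Q v) ^+ 2 <= l ^+ 2 * rnorm v ^+ 2.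
    by rewrite -exprMn lerXn2r ?nnegrE ?mulr_ge0 ?rnorm_ge0 ?(ltW l0).
  have h1 : s ^+ 2 * rnorm (Q v) ^+ 2 <= s * rnorm v ^+ 2.
    rewrite expr2 -mulrA ler_wpM2l ?(ltW s0)//.
    apply: (@le_trans _ _ (s * (l ^+ 2 * rnorm v ^+ 2))); first by rewrite ler_wpM2l ?(ltW s0).
    by rewrite mulrA sl mul1r.
  have h2 : 0 <= s * complex.Re (inner (P v) v) by rewrite mulr_ge0 ?(ltW s0).
  rewrite sqrrN /=; have := P0 v; nra.
pose T (x : bop H) : bop H := s%:C *: bop_id H + amul G x.
pose u n := iter n T 0.
have Tn x y : rnorm (T x - T y) <= rho * rnorm (x - y).
  rewrite /T opprD addrACA subrr add0r -amulBr (le_trans (rnormM _ _))//.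
  by rewrite ler_wpM2r ?rnorm_ge0// bop_rnormE; apply: opnorm_le.
have uc : cauchy_seq u.
  apply: (@geometric_cauchy_seq _ _ u rho (rnorm (T 0))); first by rewrite rho0.
  elim=> [|n IHn]; first by rewrite expr0 mulr1 /u /= subr0.
  apply: (le_trans (Tn (u n.+1) (u n))).
  by rewrite exprS mulrCA ler_wpM2l.
have [g ug] := cauchy_seq_cvg uc.
have gT : T g = g.
  apply: (@tends_to_unique _ _ (fun n => u n.+1)) => e e0.
    have [N NE] := ug _ e0; exists N => n Nn; apply: le_lt_trans (NE n Nn).
    by apply: (le_trans (Tn (u n) g)); rewrite ler_piMl ?rnorm_ge0// ltW.
  by have [N NE] := ug _ e0; exists N => n Nn; apply: NE; exact: leqW.
exists g => v; have := congr1 (fun f : bop H => f v) gT.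
rewrite -[T g v]/(s%:C *: v + (g v - s%:C *: (g v + P (g v)))).
rewrite addrCA -[X in _ = X]addr0 => /addrI; rewrite -scalerBr.
have sC : s%:C != 0 :> R[i] by rewrite eq_complex /= eqxx andbT gt_eqF.
by move=> /eqP; rewrite scaler_eq0 (negbTE sC)/= subr_eq0 => /eqP <-.
Qed.

(** With F the sum of the Z^* Z, the inverse g of 1 + F / c damps every Z by the factor
    sqrt c and stays close to the identity where the Z are small. *)
Lemma damping (r : seq (bop H)) (c : R) : 0 < c -> exists g : bop H,
  [/\ forall v, rnorm (g v) <= rnorm v,
      forall v, \sum_(Z <- r) rnorm (Z (g v)) ^+ 2 <= c * rnorm v ^+ 2
    & forall v, rnorm v = 1 -> \sum_(Z <- r) rnorm (Z v) ^+ 2 <= c ->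
        3^-1 <= complex.Re (inner (g v) v)].
Proof.
move=> c0; pose F : bop H := \sum_(Z <- r) amul (astar Z) Z.
have FE v w : inner (F v) w = \sum_(Z <- r) inner (Z v) (Z w).
  rewrite /F bop_sum_apply inner_suml; apply: eq_bigr => Z _.
  rewrite -[bop_fun (amul _ _) v]/(adjoint Z (Z v)) adjointE.
  by rewrite [adjoint (adjoint Z)](astarK Z).
have FF v : complex.Re (inner (F v) v) = \sum_(Z <- r) rnorm (Z v) ^+ 2.
  by rewrite FE Re_sum; apply: eq_bigr => Z _; rewrite inner_rnorm.
have S0 v : 0 <= \sum_(Z <- r) rnorm (Z v) ^+ 2.
  by apply: sumr_ge0 => Z _; rewrite exprn_ge0 ?rnorm_ge0.
have [|g gE] := @accretive_inverse ((c^-1)%:C *: F).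
  by move=> v; rewrite bop_scaleE innerZl ReZ FF mulr_ge0 ?invr_ge0 ?(ltW c0).
have gI v w : complex.Re (inner v w) =
    complex.Re (inner (g v) w) + c^-1 * complex.Re (inner (F (g v)) w).
  by rewrite -{1}(gE v) innerDl ReD bop_scaleE innerZl ReZ.
have gg v : complex.Re (inner v (g v)) = rnorm (g v) ^+ 2 + c^-1 * \sum_(Z <- r) rnorm (Z (g v)) ^+ 2.
  by rewrite gI inner_rnorm FF.
have g1 v : rnorm (g v) <= rnorm v.
  have [->|n0] := eqVneq (rnorm (g v)) 0; first exact: rnorm_ge0.
  have {}n0 : 0 < rnorm (g v) by rewrite lt_neqAle eq_sym n0 rnorm_ge0.
  rewrite -(ler_pM2r n0) -expr2 (le_trans _ (cauchy_schwarz _ _))// gg lerDl.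
  by rewrite mulr_ge0 ?invr_ge0 ?(ltW c0).
exists g; split=> // v.
  rewrite -ler_pdivrMl//; apply: (@le_trans _ _ (complex.Re (inner v (g v)))).
    by rewrite gg lerDr exprn_ge0 ?rnorm_ge0.
  by rewrite (le_trans (cauchy_schwarz _ _))// expr2 ler_wpM2l ?rnorm_ge0.
move=> v1 vc; have := gI v v; rewrite inner_rnorm v1 expr1n /= => one.
have two := gg v; rewrite -(Re_innerC v) in two.
have three : complex.Re (inner (F (g v)) v) <=
    2^-1 * (\sum_(Z <- r) rnorm (Z (g v)) ^+ 2 + \sum_(Z <- r) rnorm (Z v) ^+ 2).
  rewrite FE Re_sum -big_split mulr_sumr; apply: ler_sum => Z _ /=.
  apply: le_trans (cauchy_schwarz _ _) _.
  by have := sqr_ge0 (rnorm (Z (g v)) - rnorm (Z v)); rewrite sqrrB; lra.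
have four : c^-1 * complex.Re (inner (F (g v)) v) <=
    2^-1 * (c^-1 * \sum_(Z <- r) rnorm (Z (g v)) ^+ 2 + 1).
  apply: (@le_trans _ _ (c^-1 * (2^-1 *
      (\sum_(Z <- r) rnorm (Z (g v)) ^+ 2 + \sum_(Z <- r) rnorm (Z v) ^+ 2)))).
    by rewrite ler_wpM2l ?invr_ge0 ?(ltW c0).
  rewrite mulrCA ler_wpM2l ?invr_ge0// mulrDr lerD2l.
  by rewrite ler_pdivrMl// mulr1.
have := sqr_ge0 (rnorm (g v)); lra.
Qed.

(** The numbers s_j = |M^(2^j) w| satisfy s_j^2 <= s_(j+1) z, since M is self-adjoint. A
    bound on a high power therefore bounds s_0, and with it |Y^* w|^2 = <M w, w>; the
    constant K enters only through its 2^p-th root, which is below 2. *)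
Lemma power_bound (Y : bop H) (w : H) (p : nat) (z b K : R) :
  let M := amul Y (astar Y) in
  0 <= z -> 0 <= b -> 0 <= K -> rnorm w <= z -> K < 2 ^+ (2 ^ p) ->
  rnorm (iter (2 ^ p) M w) <= K * b ^+ (2 ^ p) * z ->
  rnorm (astar Y w) ^+ 2 <= 2 * b * z ^+ 2.
Proof.
move=> M z0 b0 K0 wz Kp Mw.
have Msym x y : inner (M x) y = inner x (M y).
  by rewrite adjointE -[adjoint M]/(astar M) /M astarM astarK.
have Miter j x y : inner (iter j M x) y = inner x (iter j M y).
  by elim: j x y => // j IHj x y; rewrite iterS Msym IHj -iterSr.
pose s j := rnorm (iter (2 ^ j) M w).
have s0 j : 0 <= s j by exact: rnorm_ge0.
have sS j : s j ^+ 2 <= s j.+1 * z.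
  have -> : s j ^+ 2 = complex.Re (inner (iter (2 ^ j.+1) M w) w).
    by rewrite expnS mul2n -addnn iterD Miter inner_rnorm.
  by rewrite (le_trans (cauchy_schwarz _ _))// ler_wpM2l ?rnorm_ge0.
have a0 : rnorm (astar Y w) ^+ 2 <= s 0%N * z.
  have -> : rnorm (astar Y w) ^+ 2 = complex.Re (inner (M w) w).
    by rewrite -[M w]/(Y (astar Y w)) adjointE inner_rnorm.
  by rewrite (le_trans (cauchy_schwarz _ _))// ler_wpM2l ?rnorm_ge0.
have [z00|z00] := eqVneq z 0.
  by rewrite z00 expr0n /= mulr0; rewrite z00 mulr0 in a0.
have {z0 z00} z0 : 0 < z by rewrite lt_neqAle eq_sym z00.
have sp : s 0%N ^+ (2 ^ p) * z <= s p * z ^+ (2 ^ p).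
  elim: p {Kp Mw} => [|p IHp]; first by rewrite !expr1 lexx.
  rewrite -(ler_pM2r z0) expnS mul2n -addnn !exprD.
  apply: (@le_trans _ _ ((s p * z ^+ (2 ^ p)) ^+ 2)).
    apply: (@le_trans _ _ ((s 0%N ^+ (2 ^ p) * z) ^+ 2)).
      by rewrite le_eqVlt; apply/orP; left; apply/eqP; ring.
    by rewrite lerXn2r// nnegrE mulr_ge0 ?exprn_ge0// ltW.
  apply: (@le_trans _ _ (s p.+1 * z * (z ^+ (2 ^ p)) ^+ 2)).
    by rewrite exprMn ler_wpM2r// exprn_ge0// exprn_ge0// ltW.
  by rewrite le_eqVlt; apply/orP; left; apply/eqP; ring.
set a := rnorm (astar Y w) ^+ 2 in a0 *; set q := (2 ^ p)%N in Kp Mw sp *.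
have a00 : 0 <= a by rewrite exprn_ge0 ?rnorm_ge0.
have q0 : (0 < q)%N by rewrite expn_gt0.
have aq : a ^+ q <= K * (b * z ^+ 2) ^+ q.
  rewrite -(ler_pM2r z0); apply: (@le_trans _ _ ((s 0%N * z) ^+ q * z)).
    by rewrite ler_wpM2r ?(ltW z0)// lerXn2r ?nnegrE// mulr_ge0// ltW.
  rewrite exprMn mulrAC; apply: (@le_trans _ _ (s p * z ^+ q * z ^+ q)).
    by rewrite ler_wpM2r ?exprn_ge0 ?(ltW z0).
  apply: (@le_trans _ _ (K * b ^+ q * z * z ^+ q * z ^+ q)).
    by rewrite !ler_wpM2r ?exprn_ge0 ?(ltW z0).
  rewrite exprMn -exprM mul2n -addnn exprD le_eqVlt; apply/orP; left; apply/eqP.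
  ring.
rewrite leNgt; apply/negP => ab.
have bz0 : 0 <= b * z ^+ 2 by rewrite mulr_ge0// exprn_ge0// ltW.
have ab' : 2 * (b * z ^+ 2) <= a by rewrite mulrA ltW.
have : (2 * (b * z ^+ 2)) ^+ q <= a ^+ q by rewrite lerXn2r ?nnegrE// mulr_ge0.
move=> /le_trans/(_ aq); rewrite exprMn.
have [bz|bz] := eqVneq (b * z ^+ 2) 0.
  move: aq; rewrite bz expr0n (gtn_eqF q0) /= mulr0 => aq _.
  have : a ^+ q == 0 by rewrite eq_le aq exprn_ge0.
  rewrite expf_eq0 q0 /= => /eqP a0'.
  by move: ab; rewrite a0' -mulrA bz mulr0 ltxx.
have {}bz : 0 < (b * z ^+ 2) ^+ q by rewrite exprn_gt0// lt_neqAle eq_sym bz.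
by rewrite ler_pM2r// leNgt Kp.
Qed.

End accretive.

Lemma floor_ex (R : realType) (t : R) : 0 <= t ->
  exists k : nat, k%:R <= t /\ t <= k.+1%:R.
Proof.
move=> t0; have tB : t <= (Num.bound t)%:R by rewrite ltW// archi_boundP.
elim: (Num.bound t) tB => [|N IHN] tN.
  by exists 0%N; split=> //; rewrite (le_trans tN)// ler_nat.
by have [/IHN//|/ltW Nt] := leP t N%:R; exists N.
Qed.

Section interpolation.
Context {R : realType} {B : cstarAlgebra R} (f : nat -> B).

Let d k (t : R) : B := (clamp (t - k%:R))%:C *: (f k.+1 - f k).

(** The piecewise linear path with value f k at time k (see interpE). *)
Definition interp (t : R) : B := f 0%N + lf_sum d t.

Let d_cont k : continuous (d k).
Proof.
have rc : continuous (fun t : R => clamp (t - k%:R)).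
  move=> t; apply: (@continuous_comp _ _ _ (fun s : R => s - k%:R) clamp t).
    by apply: cvgB; [exact: cvg_id|exact: cvg_cst].
  exact: clamp_cont.
by apply: (continuous_scale rc) => t; exact: cvg_cst.
Qed.

Let d_supp k t : t <= k%:R -> d k t = 0.
Proof. by move=> tk; rewrite /d clamp0 ?subr_le0// scale0r. Qed.

Lemma interp_cont : continuous interp.
Proof. by move=> t; apply: cvgD; [exact: cvg_cst|exact: lf_sum_cont]. Qed.

Lemma interpE k t : k%:R <= t -> t <= k.+1%:R ->
  interp t = (1 - (t - k%:R))%:C *: f k + (t - k%:R)%:C *: f k.+1.
Proof.
move=> kt tk; rewrite /interp (lf_sumE d_supp tk) big_ord_recr /=.
have -> : \sum_(i < k) d i t = f k - f 0%N.
  have E m : (m <= k)%N -> \sum_(i < m) d i t = f m - f 0%N.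
    elim: m => [|m IHm] mk; first by rewrite big_ord0 subrr.
    rewrite big_ord_recr /= IHm ?(ltnW mk)// /d clamp1 ?scale1r.
      by rewrite addrC addrA subrK.
    by rewrite lerBrDr (le_trans _ kt)// addrC natr1 ler_nat.
  exact: E.
rewrite addrA addrCA subrr addr0 /d clamp_id ?subr_ge0//; last first.
  by rewrite lerBlDr addrC natr1.
move: (t - _) => r.
by rewrite rmorphB scalerBl scale1r scalerBr [RHS]addrAC addrA.
Qed.

Lemma interp_nat k : interp k%:R = f k.
Proof.
rewrite (@interpE k) ?lexx ?ler_nat// subrr subr0 scale1r scale0r addr0//.
Qed.

Lemma interp_bounded (M : R) : (forall k, rnorm (f k) <= M) -> interp \in bounded_path B.
Proof.
move=> fM; apply/asboolP; split; first exact: interp_cont.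
exists M; exists 0; split; first exact: num_real.
move=> t /ltW/floor_ex[k [kt tk]]; rewrite (interpE kt tk).
have r0 : 0 <= t - k%:R by rewrite subr_ge0.
have r1 : 0 <= 1 - (t - k%:R) by rewrite subr_ge0 lerBlDr addrC natr1.
rewrite (le_trans (rnormD _ _))// !rnormZ !normc_RC//.
have := fM k; have := fM k.+1; nra.
Qed.

End interpolation.

(** * Truncated trees *)

Section truncated.
Context {n : nat}.

Definition ball (m : nat) := {w : m.-bseq 'I_n | word (Some m) w}.

Lemma ball_step_subproof m i (w : ball m) : (size (step (Some m) i (sval w)) <= m)%N.
Proof. by have /andP[] := step_word i (svalP w). Qed.

Definition ball_step m i (w : ball m) : ball m :=
  exist _ (Bseq (ball_step_subproof i w)) (step_word i (svalP w)).

Lemma ball_stepK m i : involutive (@ball_step m i).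
Proof. by move=> w; do 2![apply: val_inj]; exact: stepK (svalP w). Qed.

Definition ball_perm (m : nat) := {x : {ffun ball m -> ball m} | injectiveb x}.

(** All permutations of all the balls of the tree, on which the generators act by
    composition: a single space with finite pieces that look like the tree up to any
    prescribed radius around every point. *)
Definition vertex := {m : nat & ball_perm m}.

Lemma perm_step_subproof m i (x : ball_perm m) :
  injectiveb [ffun w => ball_step i (sval x w)].
Proof.
apply/injectiveP => w w'; rewrite !ffunE => /(can_inj (@ball_stepK m i)).
exact/injectiveP/(svalP x).
Qed.

Definition perm_step m i (x : ball_perm m) : ball_perm m :=
  exist (fun y : {ffun ball m -> ball m} => injectiveb y) _ (perm_step_subproof i x).

Definition vertex_step i (y : vertex) : vertex := Tagged ball_perm (perm_step i (tagged y)).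

Lemma vertex_stepK i : involutive (vertex_step i).
Proof.
move=> [m x]; congr (Tagged ball_perm); apply: val_inj; apply/ffunP => w /=.
by rewrite !ffunE ball_stepK.
Qed.

(** The position of y in the tree rooted at a permutation that sends u to the empty
    word. *)
Definition position (u : seq 'I_n) (y : vertex) : seq 'I_n :=
  oapp (fun w : ball (tag y) => sval (sval (tagged y) w) : seq 'I_n) [::]
       (obind insub (insub u)).

Lemma positionE m (w : ball m) (x : ball_perm m) :
  position (sval w) (Tagged ball_perm x) = sval (sval x w) :> seq _.
Proof. by rewrite /position valK /= valK. Qed.

Definition near_root m (w : ball m) (r : nat) : pred vertex :=
  fun y => (tag y == m) && (size (position (sval w) y) <= r)%N.

Lemma near_root_step m (w : ball m) r i y :
  near_root w r y -> near_root w r.+1 (vertex_step i y).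
Proof.
case: y => m' x; rewrite /near_root /= => /andP[/eqP mm]; subst m'.
rewrite eqxx !positionE /= ffunE => xr.
by rewrite (leq_trans (step_size _ _ _)).
Qed.

Lemma near_root_head m (w : ball m) r i y : (r < m)%N -> near_root w r y ->
  ohead (position (sval w) y) != Some i ->
  ohead (position (sval w) (vertex_step i y)) = Some i.
Proof.
case: y => m' x rm; rewrite /near_root /= => /andP[/eqP mm]; subst m'.
rewrite !positionE /= ffunE => xr; apply: step_head => /=.
exact: leq_ltn_trans rm.
Qed.

(** Being injective on a finite ball, g takes the empty word as a value. *)
Lemma rootP (g : vertex) : exists w : ball (tag g), near_root w 0 g.
Proof.
case: g => m x /=; have nilm : word (Some m) (Bseq (isT : (size ([::] : seq 'I_n) <= m)%N)) by [].
pose o : ball m := exist (fun w : m.-bseq 'I_n => word (Some m) w) _ nilm.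
have : o \in codom (sval x) by exact/injF_onto/injectiveP/(svalP x).
by case/codomP => w ow; exists w; rewrite /near_root eqxx positionE -ow.
Qed.

End truncated.

Section local_bound.
Context {R : realType} {n : nat}.
Local Notation V := (@vertex n).
Local Notation H := (ell2 R (V * nat)%type).
Local Notation U := (shift_op (R := R) (@vertex_stepK n)).
Local Notation Y := (tree_sum (R := R) (@vertex_stepK n)).

Definition adjoint_coeffs (t : 'I_n -> nat -> nat -> R[i]) i l j : R[i] := ((t i j l)^*)%R.

Lemma level_mx_star (Z : choiceType) k (c : nat -> nat -> R[i]) :
  astar (level_mx k c : bop (ell2 R (Z * nat)%type)) = level_mx k (fun l j => ((c j l)^*)%R).
Proof.
rewrite /level_mx astar_sum; under eq_bigr => l _ do rewrite astar_sum.
rewrite exchange_big; apply: eq_bigr => j _; apply: eq_bigr => l _.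
by rewrite astarZ astarM astarK.
Qed.

Lemma tree_sum_star k t : astar (Y k t) = Y k (adjoint_coeffs t).
Proof.
rewrite /tree_sum astar_sum; apply: eq_bigr => i _.
by rewrite astarM shift_star level_mx_star /shift_op lift_level_mx.
Qed.

Section bounded_coefficients.
Context (k : nat) (tau : R).
Hypothesis tau0 : 0 <= tau.

(** Near the root, below radius m, the truncation is invisible and the vertices are
    labelled as in the tree; each application of Y enlarges the support by one step. *)
Lemma near_tree_sum m (w : ball m) r t (v : H) : (r < m)%N ->
  (forall i, rnorm (level_mx k (t i) : bop H) <= tau) ->
  rest_op (near_root w r) v = v ->
  rest_op (near_root w r.+1) (Y k t v) = Y k t v /\
  rnorm (Y k t v) ^+ 2 <= 4 * n%:R * tau ^+ 2 * rnorm v ^+ 2.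
Proof.
move=> rm tb vr; have supp (y : V) l : ~~ near_root w r y -> v (y, l) = 0.
  by move=> /negbTE yr; rewrite -vr rest_opE yr.
split; last first.
  apply: (tree_sum_le (@vertex_stepK n) (s := fun y => ohead (position (sval w) y))) => //.
    move=> i z; rewrite (le_trans (rnorm_bop _ _))// -bop_rnormE.
    by rewrite ler_wpM2r ?rnorm_ge0.
  move=> i y l yi; apply: contraNeq => vy.
  have yr : near_root w r y by apply: contraNT vy => /supp ->.
  by rewrite (near_root_head rm yr yi).
rewrite /tree_sum bop_sum_apply linear_sum; apply: eq_bigr => i _; apply: ell2E => -[y l].
rewrite rest_opE; case: ifP => // /negbT yr.
have {yr} /negbTE yr : ~~ near_root w r (vertex_step i y).
  by apply: contraNN yr => /(near_root_step i); rewrite vertex_stepK.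
rewrite -[RHS]/(shift_op (@vertex_stepK n) i (level_mx k (t i) v) (y, l)) shift_opE.
have := lift_level_mx (prest (near_root w r)) k (t i).
move=> /(congr1 (fun f : bop H => f v (vertex_step i y, l))).
rewrite -[LHS]/(rest_op (near_root w r) (level_mx k (t i) v) (vertex_step i y, l)).
rewrite -[RHS]/(level_mx k (t i) (rest_op (near_root w r) v) (vertex_step i y, l)).
by rewrite vr rest_opE yr.
Qed.

Lemma local_power_bound (g : V) q t l : (q.*2 <= tag g)%N ->
  (forall i, rnorm (level_mx k (t i) : bop H) <= tau) ->
  rnorm (iter q (amul (Y k t) (astar (Y k t))) (delta R (g, l))) ^+ 2 <=
  (4 * n%:R * tau ^+ 2) ^+ q.*2.
Proof.
move=> + tb; have [w wg] := rootP g.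
have tb' i : rnorm (level_mx k (adjoint_coeffs t i) : bop H) <= tau.
  by have := tb i; rewrite -(rnorm_star (level_mx k (t i) : bop H)) level_mx_star.
set C := 4 * _ * _; have C0 : 0 <= C by rewrite !mulr_ge0.
set M := amul _ _ => qm.
suff : rest_op (near_root w q.*2) (iter q M (delta R (g, l))) = iter q M (delta R (g, l)) /\
  rnorm (iter q M (delta R (g, l))) ^+ 2 <= C ^+ q.*2 by case.
elim: q qm => [|q IHq] qm.
  rewrite rnorm_delta !expr1n; split=> //.
  by rewrite /rest_op /lift_op pop_delta /= wg.
have [vr vC] := IHq (leq_trans (leqnSn _) (ltnW qm)).
have [vr1 vC1] := near_tree_sum (ltnW qm) tb' vr.
have [vr2 vC2] := near_tree_sum qm tb vr1.
rewrite iterS; set v := iter q M _ in vr vC vr1 vC1 vr2 vC2 *.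
have -> : M v = Y k t (Y k (adjoint_coeffs t) v) by rewrite -tree_sum_star.
split=> //.
apply: (le_trans vC2); rewrite -/C doubleS [leRHS]exprS ler_wpM2l//.
by apply: (le_trans vC1); rewrite -/C [leRHS]exprS ler_wpM2l.
Qed.

End bounded_coefficients.
End local_bound.

(** * Damped generators *)

Lemma rnorm_bop_le1 (R : realType) (H : hilbertSpace R) (T : bop H) :
  (forall v, rnorm (T v) <= rnorm v) -> rnorm T <= 1.
Proof. by move=> T1; rewrite bop_rnormE; apply: opnorm_le => // v; rewrite mul1r. Qed.

Lemma rnormM_le1 (R : realType) (B : cstarAlgebra R) (x y : B) :
  rnorm x <= 1 -> rnorm y <= 1 -> rnorm (amul x y) <= 1.
Proof.
move=> x1 y1; rewrite (le_trans (rnormM _ _))// (le_trans _ x1)//.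
by rewrite ler_piMr ?rnorm_ge0.
Qed.

Section damped.
Context {R : realType} {n : nat}.
Local Notation V := (@vertex n).
Local Notation H := (ell2 R (V * nat)%type).
Local Notation U := (shift_op (R := R) (@vertex_stepK n)).
Local Notation Y := (tree_sum (R := R) (@vertex_stepK n)).


Lemma iter_amul (M N : bop H) q v : iter q (amul M) N v = iter q M (N v).
Proof. by elim: q => // q IHq; rewrite !iterS -[LHS]/(M (iter q (amul M) N v)) IHq. Qed.

Lemma iter_linear_sum (M : bop H) q (J : Type) (r : seq J) (F : J -> H) :
  iter q M (\sum_(j <- r) F j) = \sum_(j <- r) iter q M (F j).
Proof.
elim: q => // q IHq; rewrite iterS IHq linear_sum.
by apply: eq_bigr => j _; rewrite -iterS.
Qed.

Section given_damping.
Context (g : bop H).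
Hypothesis g1 : forall v, rnorm (g v) <= rnorm v.

(** The adjoint g^* stands after U_i, so that in the adjoint of an amplification the
    damping g acts first. *)
Definition damped_gen i : bop H := amul (pe 0) (amul (astar g) (amul (U i) (pe 0))).
Local Notation b := damped_gen.

Definition levelwise k : bop H := \sum_(l < k) amul (pe l) (amul g (astar (pe l))).

Lemma pe0_damped i : amul (pe 0) (b i) = b i.
Proof. by rewrite /damped_gen amulA pe_pe0. Qed.

Lemma damped_pe0 i : amul (b i) (pe 0) = b i.
Proof. by rewrite /damped_gen -!amulA pe_pe0. Qed.

Lemma rnorm_damped i : rnorm (b i) <= 1.
Proof.
have p1 : rnorm (pe 0 : bop H) <= 1 by apply: rnorm_bop_le1; exact: pe_le.
apply: (rnormM_le1 p1); apply: rnormM_le1; first by rewrite rnorm_star rnorm_bop_le1.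
by apply: rnormM_le1; last exact: p1; apply: rnorm_bop_le1; exact: rnorm_shift.
Qed.

Lemma ampl_damped k t : ampl (@pe R V) b k t = amul (astar (levelwise k)) (Y k t).
Proof.
have lE (l : 'I_k) : amul (astar (levelwise k)) (pe l) = amul (pe l) (amul (astar g) (pe 0)).
  have tE (j : nat) : amul (astar (amul (pe j) (amul g (astar (pe j))))) (pe l) =
      if j == l then amul (pe l) (amul (astar g) (pe 0)) else 0.
    rewrite astarM astarM astarK -amulA pe_orth; case: eqP => [->|_]; last exact: amul0r.
    by rewrite -amulA.
  rewrite /levelwise astar_sum amul_suml.
  under eq_bigr => j _ do rewrite tE.
  by rewrite -big_mkcond (big_pred1 l).
have termE i (l j : 'I_k) : amul (pe l) (amul (b i) (astar (pe j))) =
    amul (astar (levelwise k)) (amul (U i) (amul (pe l) (astar (pe j)))).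
  rewrite (amulA (U i)) shift_pe -(amulA (pe l)) (amulA _ (pe l)) lE -(amulA (pe l)).
  rewrite /damped_gen -(amulA (pe 0)) (amulA (pe l) (pe 0)) pe_pe0; congr amul.
  rewrite -(amulA (astar g)) -(amulA (astar g)) -(amulA (U i)) (amulA (pe 0)) -shift_pe.
  by rewrite -(amulA (U i)) !pe0_pe_star.
rewrite /tree_sum amul_sumr; apply: eq_bigr => i _.
rewrite /level_mx !amul_sumr; apply: eq_bigr => l _.
rewrite !amul_sumr; apply: eq_bigr => j _; rewrite !amulZr; congr (_ *: _).
exact: termE.
Qed.

(** In the adjoint of ampl k t the damping comes first; it leaves vectors on which a
    high power of Y Y^* is under control, and then Y^* itself is. *)
Lemma ampl_damped_le k t p (D c : R) :
  let M := amul (Y k t) (astar (Y k t)) in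
  0 <= c -> 0 <= D -> k%:R * D < 2 ^+ (2 ^ p) ->
  (forall l v, (l < k)%N -> rnorm (iter (2 ^ p) M (pe l (g v))) <= D * c ^+ (2 ^ p) * rnorm v) ->
  rnorm (ampl (@pe R V) b k t) <= Num.sqrt (2 * c).
Proof.
move=> M c0 D0 Kp Mg; rewrite -rnorm_star ampl_damped astarM astarK bop_rnormE.
apply: opnorm_le => [|v]; first exact: sqrtr_ge0.
rewrite -ler_sqr ?nnegrE ?mulr_ge0 ?rnorm_ge0 ?sqrtr_ge0// exprMn (@sqr_sqrtr _ (2 * c)) ?mulr_ge0//.
pose z l := astar (pe l) v.
have wE : levelwise k v = \sum_(l < k) pe l (g (z l)) by rewrite bop_sum_apply.
have wv : rnorm (levelwise k v) <= rnorm v.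
  rewrite -ler_sqr ?nnegrE ?rnorm_ge0// wE (level_pythag k (fun l => g (z l))).
  apply: le_trans (level_coord_le k v); apply: ler_sum => l _.
  by rewrite lerXn2r ?nnegrE ?rnorm_ge0// (le_trans (pe_le _ _)).
have zv (l : 'I_k) : rnorm (z l) <= rnorm v.
  rewrite -ler_sqr ?nnegrE ?rnorm_ge0// (le_trans _ (level_coord_le k v))//.
  by rewrite (bigD1 l)//= lerDl sumr_ge0// => j _; rewrite exprn_ge0 ?rnorm_ge0.
apply: (@power_bound R H (Y k t) (levelwise k v) p (rnorm v) c (k%:R * D)) => //;
  rewrite ?rnorm_ge0 ?mulr_ge0//.
rewrite wE iter_linear_sum (le_trans (rnorm_sum _ _ _))//.
apply: (@le_trans _ _ (\sum_(l < k) D * c ^+ (2 ^ p) * rnorm v)).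
  apply: ler_sum => l _; rewrite (le_trans (Mg _ _ (ltn_ord l)))//.
  by rewrite ler_wpM2l ?zv// mulr_ge0// exprn_ge0.
by rewrite sumr_const card_ord -[leLHS]mulr_natl !mulrA.
Qed.

(** The sum of the delta_x tensor delta_x over one ball is fixed by all the U i
    tensor U i, and seen by it the damping is harmless. *)
Lemma damped_tensor_ge (K : hilbertTensor H H) r :
  (forall x : V, tag x = r -> 3^-1 <= complex.Re (inner (g (delta R (x, 0%N))) (delta R (x, 0%N)))) ->
  n%:R / 3 <= rnorm (\sum_i op_tensor K (b i) (U i)).
Proof.
move=> gr; set B := \sum_i _.
pose v (x : ball_perm r) : V := Tagged (@ball_perm n) x.
pose d (y : V) : H := delta R (y, 0%N).
pose xi := \sum_x ht_map K (d (v x)) (d (v x)).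
have dd y y' : inner (d y) (d y') = (y == y')%:R.
  by rewrite inner_delta deltaE xpair_eqE eqxx andbT eq_sym.
have vE x y : (v x == v y) = (x == y) by rewrite /v eq_Tagged.
pose N := #|{: @ball_perm n r}|.
have N0 : 0 < N%:R :> R.
  rewrite ltr0n; apply/card_gt0P.
  have id_inj : injectiveb [ffun w : @ball n r => w] by apply/injectiveP => w w'; rewrite !ffunE.
  by exists (exist (fun y : {ffun ball r -> ball r} => injectiveb y) _ id_inj).
have xi2 : rnorm xi ^+ 2 = N%:R.
  apply: (@complexI R); rewrite -inner_rnorm inner_suml rmorph_nat.
  rewrite (eq_bigr (fun=> 1)) ?sumr_const// => x _; rewrite inner_sumr (bigD1 x)//= big1 ?addr0.
    by rewrite inner_ht_map !dd eqxx mulr1.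
  by move=> y yx; rewrite inner_ht_map !dd vE eq_sym (negbTE yx) mulr0.
have Bxi : inner (B xi) xi = \sum_i \sum_x inner (b i (d (v x))) (d (v (perm_step i x))).
  rewrite bop_sum_apply inner_suml; apply: eq_bigr => i _.
  rewrite (linear_sum (op_tensor K (b i) (U i))) inner_suml; apply: eq_bigr => x _.
  rewrite /= op_tensorE.
  rewrite [U i _]shift_delta -[vertex_step i (v x)]/(v (perm_step i x)) -/(d _).
  rewrite inner_sumr (bigD1 (perm_step i x))//= big1 ?addr0.
    by rewrite inner_ht_map dd eqxx mulr1.
  by move=> y yx; rewrite inner_ht_map dd vE eq_sym (negbTE yx) mulr0.
have bE i x : inner (b i (d (v x))) (d (v (perm_step i x))) =
    inner (d (v (perm_step i x))) (g (d (v (perm_step i x)))).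
  have pd y : pe 0 (d y) = d y by rewrite /pe /d pop_delta.
  rewrite -[b i _]/(pe 0 (astar g (U i (pe 0 (d (v x)))))) pd.
  rewrite [U i _]shift_delta -[vertex_step i (v x)]/(v (perm_step i x)) -/(d _).
  rewrite adjointE -[adjoint _]/(astar (pe 0)) pe0_star pd.
  by rewrite adjointE [adjoint _](astarK g).
have : n%:R / 3 * N%:R <= complex.Re (inner (B xi) xi).
  have -> : n%:R / 3 * N%:R = \sum_(i < n) \sum_(x : @ball_perm n r) (3^-1 : R).
    by rewrite !sumr_const card_ord -/N -[RHS]mulr_natl -[X in _ = _ * X]mulr_natl; ring.
  rewrite Bxi Re_sum.
  apply: ler_sum => i _; rewrite Re_sum; apply: ler_sum => x _.
  by rewrite bE Re_innerC; exact: gr.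
move=> /le_trans/(_ (cauchy_schwarz _ _)) le1.
rewrite -(ler_pM2r N0) (le_trans le1)// bop_rnormE -xi2 expr2 mulrA.
by rewrite ler_wpM2r ?rnorm_ge0// rnorm_bop.
Qed.

End given_damping.

(** Finitely many tests are damped at once. On a basis vector well inside a ball the
    powers of Y Y^* in the tests are controlled by square-root cancellation, so that the
    damping does not see it. *)
Lemma damped_stage (tau : R) (ks : nat -> nat) (ts : nat -> 'I_n -> nat -> nat -> R[i]) m :
  (0 < n)%N -> 0 < tau ->
  (forall j i, rnorm (level_mx (ks j) (ts j i) : bop H) <= tau) ->
  exists b : 'I_n -> bop H,
  [/\ forall i, amul (pe 0) (b i) = b i /\ amul (b i) (pe 0) = b i,
      forall i, rnorm (b i) <= 1,
      forall j, (j < m)%N ->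
        rnorm (ampl (@pe R V) b (ks j) (ts j)) <= Num.sqrt (2 * (4 * n%:R * tau ^+ 2))
    & forall K : hilbertTensor H H, n%:R / 3 <= rnorm (\sum_i op_tensor K (b i) (U i))].
Proof.
move=> n0 tau0 tb; set C : R := 4 * n%:R * tau ^+ 2.
have C0 : 0 < C by rewrite !mulr_gt0 ?exprn_gt0 ?ltr0n.
pose N := (\sum_(j < m) ks j).+1; pose q := (2 ^ N)%N.
pose M j := amul (Y (ks j) (ts j)) (astar (Y (ks j) (ts j))).
pose Z j l : bop H := iter q (amul (M j)) (pe l).
pose r := [seq Z j l | j <- iota 0 m, l <- iota 0 (ks j)].
pose c := (N%:R * C ^+ q) ^+ 2.
have sumr (F : bop H -> R) : \sum_(Z <- r) F Z = \sum_(j < m) \sum_(l < ks j) F (Z j l).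
  have idx k : iota 0 k = index_iota 0 k by rewrite /index_iota subn0.
  by rewrite big_allpairs_dep idx big_mkord; apply: eq_bigr => j _; rewrite idx big_mkord.
have c0 : 0 < c by rewrite exprn_gt0// mulr_gt0 ?exprn_gt0.
have [g [g1 gZ gx]] := damping r c0.
exists (damped_gen g); split.
- by move=> i; rewrite pe0_damped damped_pe0.
- exact: rnorm_damped.
- move=> j jm; have kN : (ks j < N)%N.
    by rewrite ltnS (bigD1 (Ordinal jm))//= leq_addr.
  apply: (@ampl_damped_le g g1 (ks j) (ts j) N N%:R C); rewrite ?(ltW C0)//.
    rewrite -natrM -natrX ltr_nat (@leq_trans (2 ^ N * 2 ^ N))//.
      by apply: ltn_mul; [exact: ltn_trans kN (ltn_expl _ _)|exact: ltn_expl].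
    rewrite -expnD leq_exp2l// addnn -mul2n; case: (N) (isT : 0 < N)%N => // N' _.
    by rewrite expnS leq_mul2l /= ltn_expl.
  move=> l v lk.
  have key : rnorm (Z j l (g v)) ^+ 2 <= (N%:R * C ^+ q * rnorm v) ^+ 2.
    rewrite [leRHS]exprMn; apply: le_trans (gZ v).
    rewrite sumr (bigD1 (Ordinal jm))//= (bigD1 (Ordinal lk))//= -addrA lerDl.
    apply: addr_ge0; apply: sumr_ge0 => j' _; first by rewrite exprn_ge0 ?rnorm_ge0.
    by apply: sumr_ge0 => l' _; rewrite exprn_ge0 ?rnorm_ge0.
  rewrite -iter_amul -/q -/(M j) -/(Z j l) -ler_sqr// nnegrE ?rnorm_ge0//.
  by rewrite !mulr_ge0 ?exprn_ge0 ?rnorm_ge0 ?(ltW C0).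
move=> K; apply: (@damped_tensor_ge g K q.*2) => x xq; apply: gx; first exact: rnorm_delta.
rewrite sumr; apply: (@le_trans _ _ (\sum_(j < m) \sum_(l < ks j) C ^+ q.*2)).
  apply: ler_sum => j _; apply: ler_sum => l _; rewrite /Z iter_amul.
  have -> : pe l (delta R (x, 0%N)) = delta R (x, nat_of_ord l) by rewrite /pe pop_delta.
  by apply: (local_power_bound (ltW tau0)) => //; rewrite xq.
under eq_bigr => j _ do rewrite sumr_const card_ord.
rewrite sumrMnr -[leLHS]mulr_natl /c [leRHS]exprMn -muln2 exprM ler_wpM2r ?exprn_ge0 ?(ltW C0)//.
by rewrite -natrX ler_nat expnS (leq_trans (leqnSn _))// leq_pmulr// expn_gt0.
Qed.

End damped.

(** * A sequence of tuples as one tuple at infinity *)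

Section corona_paths.
Context {R : realType} {B : cstarAlgebra R}.

Lemma repr_asymptotic (x : corona B) (f : path B) : x = pclass f ->
  rnorm (repr x t - f t) @[t --> +oo] --> (0 : R).
Proof.
move=> ->; apply/cvgrPdist_lt => e e0; have := repr_pclass f.
move=> /le_lt_trans/(_ e0)/path_norm_lt; apply: filterS => t.
by rewrite sub0r normrN ger0_norm ?rnorm_ge0// path_addE path_oppE.
Qed.

Lemma pclass_half_line (f g : path B) : (forall t : R, 0 <= t -> f t = g t) -> pclass f = pclass g.
Proof.
move=> fg; apply/pclassP; apply: path_norm_le => e e0; exists 0; split; first exact: num_real.
by move=> t /ltW/fg; rewrite path_addE path_oppE => ->; rewrite subrr rnorm0 add0r ltW.
Qed.

Lemma pclass_sum (J : Type) (r : seq J) (P : pred J) (F : J -> path B) :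
  pclass (\sum_(j <- r | P j) F j) = \sum_(j <- r | P j) pclass (F j).
Proof. exact: (big_morph (@pclass R B) (@pclass_addE R B) erefl). Qed.

Lemma path_sumE (J : Type) (r : seq J) (P : pred J) (F : J -> path B) t :
  (\sum_(j <- r | P j) F j) t = \sum_(j <- r | P j) F j t.
Proof. by apply: (big_morph (fun f : path B => f t)). Qed.

Lemma ampl_comb (E : nat -> B) n (b c : 'I_n -> B) k t (u v : R[i]) :
  ampl E (fun i => u *: b i + v *: c i) k t = u *: ampl E b k t + v *: ampl E c k t.
Proof.
rewrite /ampl !scaler_sumr -big_split; apply: eq_bigr => i _.
rewrite !scaler_sumr -big_split; apply: eq_bigr => l _.
rewrite !scaler_sumr -big_split; apply: eq_bigr => j _ /=.
by rewrite amulDl amulDr !amulZl !amulZr scalerDr !scalerA (mulrC u) (mulrC v).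
Qed.

Context {n : nat} (E : nat -> B) (b : nat -> 'I_n -> B).
Hypothesis b1 : forall m i, rnorm (b m i) <= 1.

Definition gen_path i : path B := Path (interp_bounded (fun m => b1 m i)).

(** Along the segment between two stages the amplification is a convex combination of
    its values at these stages; early stages do not affect the norm in the corona. *)
Lemma ampl_path_le k t (C : R) m0 : 
  (forall m, (m0 <= m)%N -> rnorm (ampl E (b m) k t) <= C) ->
  rnorm (ampl (fun j => pclass (path_cst (E j))) (fun i => pclass (gen_path i)) k t) <= C.
Proof.
move=> bC; pose P : path B := \sum_i \sum_(l < k) \sum_(j < k) t i l j *:
  path_mul (path_cst (E l)) (path_mul (gen_path i) (path_star (path_cst (E j)))).
have -> : ampl (fun j => pclass (path_cst (E j))) (fun i => pclass (gen_path i)) k t = pclass P.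
  rewrite pclass_sum; apply: eq_bigr => i _; rewrite pclass_sum; apply: eq_bigr => l _.
  rewrite pclass_sum; apply: eq_bigr => j _.
  by rewrite pclass_scaleE !pclass_mulE pclass_starE.
have PE s : P s = ampl E (fun i => interp (b^~ i) s) k t.
  rewrite path_sumE; apply: eq_bigr => i _; rewrite path_sumE; apply: eq_bigr => l _.
  by rewrite path_sumE; apply: eq_bigr.
rewrite rnorm_pclass; apply: path_norm_le => e e0; exists m0.+1%:R.
split=> [|s ms]; first exact: num_real.
have s0 : 0 <= s by rewrite (le_trans _ (ltW ms)).
have [m [m1 m2]] := floor_ex s0.
have mm : (m0 <= m)%N by rewrite -ltnS -(ltr_nat R) (le_lt_trans _ (lt_le_trans ms m2))// ler_nat.
rewrite PE (_ : (fun i => _) = (fun i => (1 - (s - m%:R))%:C *: b m i + (s - m%:R)%:C *: b m.+1 i)).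
  rewrite ampl_comb; have r0 : 0 <= s - m%:R by rewrite subr_ge0.
  have r1 : 0 <= 1 - (s - m%:R) by rewrite subr_ge0 lerBlDr addrC natr1.
  rewrite (le_trans (rnormD _ _))// !rnormZ !normc_RC//.
  have := bC m mm; have := bC m.+1 (leqW mm); nra.
by apply/funext => i; rewrite (interpE _ m1 m2).
Qed.

End corona_paths.

Lemma star_hom_asymptotic (R : realType) (B C : cstarAlgebra R) (pi : B -> C) :
  star_hom pi -> asymptotic_hom (fun _ : R => pi).
Proof.
move=> [pil pim pis]; split=> [a|a b|a b c|a].
- by apply: continuous_subspaceT => t; exact: cvg_cst.
- by rewrite pim subrr rnorm0; exact: cvg_cst.
- by rewrite [a + _]addrC pil addrK subrr rnorm0; exact: cvg_cst.
by rewrite pis subrr rnorm0; exact: cvg_cst.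
Qed.

(** * The left asymptotic norm may exceed the minimal norm *)

Section asymptotic_example.
Context {R : realType} {V : countType} {n : nat}.
Local Notation H := (ell2 R (V * nat)%type).
Context (b : nat -> 'I_n -> bop H) (U : 'I_n -> bop H) (kappa : R).
Hypothesis pe_b : forall m i, amul (pe 0) (b m i) = b m i.
Hypothesis b_pe : forall m i, amul (b m i) (pe 0) = b m i.
Hypothesis b1 : forall m i, rnorm (b m i) <= 1.
Hypothesis b_ampl : forall k t, contractive_coeffs k t ->
  exists m0, forall m, (m0 <= m)%N -> rnorm (ampl (@pe R V) (b m) k t) <= kappa.
Hypothesis U_star : forall i, astar (U i) = U i.
Hypothesis U_sq : forall i, amul (U i) (U i) = bop_id H.

Local Notation cst x := (pclass (path_cst x)).

Definition limit_gen (j : nat + 'I_n) : corona (bop H) :=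
  match j with inl j => cst (pe j) | inr i => pclass (gen_path b1 i) end.

Local Notation A := (calg (gens limit_gen)).
Local Notation D := (calg (gens U)).

Let e j : A := calg_of limit_gen (inl j).
Let a i : A := calg_of limit_gen (inr i).
Let d i : D := calg_of U i.

Definition limit_tensor : A ⊙ D := tclass [seq (a i, d i) | i <- enum 'I_n].

Lemma cst_mul (x y : bop H) : amul (cst x) (cst y) = cst (amul x y).
Proof. by rewrite -pclass_mulE; congr pclass; apply: pathE. Qed.

Lemma cst_star (x : bop H) : astar (cst x) = cst (astar x).
Proof. by rewrite -pclass_starE; congr pclass; apply: pathE. Qed.

Lemma cst0 : cst (0 : bop H) = 0.
Proof. by rewrite -[RHS]/(pclass 0); congr pclass; apply: pathE. Qed.

Let e_val j : calg_val (e j) = cst (pe j).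
Proof. exact: (calg_ofE limit_gen (inl j)). Qed.

Let a_val i : calg_val (a i) = pclass (gen_path b1 i).
Proof. exact: (calg_ofE limit_gen (inr i)). Qed.

Let d_val i : calg_val (d i) = U i.
Proof. exact: (calg_ofE U i). Qed.

Let e_orth j l : amul (astar (e j)) (e l) = if j == l then e 0%N else 0.
Proof.
apply: calgE; rewrite calg_valM calg_valS !e_val cst_star cst_mul pe_orth.
by case: eqP => // _; rewrite cst0.
Qed.

Let e0_mul : amul (e 0%N) (e 0%N) = e 0%N.
Proof. by apply: calgE; rewrite calg_valM e_val cst_mul pe_pe0. Qed.

Let e0_star : astar (e 0%N) = e 0%N.
Proof. by apply: calgE; rewrite calg_valS e_val cst_star pe0_star. Qed.

Let e0_a i : amul (e 0%N) (a i) = a i.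
Proof.
apply: calgE; rewrite calg_valM e_val a_val -pclass_mulE; apply: pclass_half_line => t t0.
have [m [m1 m2]] := floor_ex t0.
rewrite -[LHS]/(amul (pe 0) (gen_path b1 i t)) /= (interpE _ m1 m2).
by rewrite amulDr !amulZr !pe_b.
Qed.

Let a_e0 i : amul (a i) (e 0%N) = a i.
Proof.
apply: calgE; rewrite calg_valM e_val a_val -pclass_mulE; apply: pclass_half_line => t t0.
have [m [m1 m2]] := floor_ex t0.
rewrite -[LHS]/(amul (gen_path b1 i t) (pe 0)) /= (interpE _ m1 m2).
by rewrite amulDl !amulZl !b_pe.
Qed.

Let ampl_le k t : contractive_coeffs k t -> rnorm (ampl e a k t) <= kappa.
Proof.
move=> tk; have [m0 bm] := b_ampl tk; rewrite calg_rnorm.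
apply: le_trans (ampl_path_le b1 bm); rewrite le_eqVlt; apply/orP; left; apply/eqP.
congr rnorm; rewrite calg_val_sum; apply: eq_bigr => i _.
rewrite calg_val_sum; apply: eq_bigr => l _; rewrite calg_val_sum; apply: eq_bigr => j _.
by rewrite calg_valZ !calg_valM calg_valS !e_val a_val.
Qed.

(** In a spatial tensor product A is represented genuinely, hence bounded by its tests on
    scalar matrices, all of which are at most kappa in the corona. *)
Lemma min_limit_le : (min_norm A D limit_tensor <= kappa%:E)%E.
Proof.
apply: ge_ereal_sup => _ [H1 [H2 [K [pi [rho [hpi hrho ->]]]]]].
rewrite lee_fin bop_rnormE spatial_tensor_tclass// big_map big_enum /=.
apply: (tensor_bound_left e_orth e0_mul e0_star e0_a a_e0 ampl_le hpi K).
move=> i v; have dd : amul (astar (d i)) (d i) = amul (d i) (d i).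
  by congr amul; apply: calgE; rewrite calg_valS d_val U_star.
apply: (rep_partial_isometry_le hrho v dd); apply: calgE.
  by rewrite !calg_valM d_val U_sq; apply: bopE.
by rewrite calg_valS calg_valM d_val astarM U_star.
Qed.

(** Evaluation of representatives is multiplicative, linear and *-preserving up to paths
    that vanish at infinity, hence an asymptotic representation of A. *)
Definition evaluate (t : R) (x : A) : bop H := repr (calg_val x) t.

Lemma evaluate_asymptotic : asymptotic_hom evaluate.
Proof.
have near_zero (u : R -> bop H) (x : A) (f : path (bop H)) : calg_val x = pclass f ->
    (forall t, u t = evaluate t x - f t) -> rnorm (u t) @[t --> +oo] --> (0 : R).
  by move=> xf uE; under eq_fun do rewrite uE; exact: repr_asymptotic.
split=> [x|x y|x y c|x].
- by apply: continuous_subspaceT; exact: path_cont.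
- apply: (near_zero _ (amul x y) (path_mul (repr (calg_val x)) (repr (calg_val y)))) => //.
- apply: (near_zero _ (x + c *: y) (repr (calg_val x) + c *: repr (calg_val y))).
    by rewrite pclass_addE pclass_scaleE !pclass_repr.
  by move=> t; rewrite path_addE path_scaleE opprD addrA.
by apply: (near_zero _ (astar x) (path_star (repr (calg_val x)))).
Qed.

(** At the integer time m the representatives are close to the m-th tuple. *)
Lemma evaluate_limit_ge (K : hilbertTensor H H) (c : R) : 
  (forall m, c <= rnorm (\sum_i op_tensor K (b m i) (U i))) ->
  (c%:E <= quotient_norm (asymptotic_tensor K evaluate (fun=> @calg_val _ _ (gens U)) limit_tensor))%E.
Proof.
move=> bc; apply: quotient_norm_tclass_ge => [||T r r0]; first exact: evaluate_asymptotic.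
  exact: calg_val_hom.
have r1 : 0 < r / n.+1%:R by rewrite divr_gt0.
have near_all : \forall t \near +oo, forall i, rnorm (evaluate t (a i) - gen_path b1 i t) < r / n.+1%:R.
  apply: filter_forall => i; apply: asymptotic_small r1.
  by apply: repr_asymptotic; exact: a_val.
have [T0 [_ TE]] := near_all.
pose m := Num.bound `|Num.max T (T0 + 1)|.
have mT : Num.max T (T0 + 1) < m%:R.
  exact: le_lt_trans (ler_norm _) (archi_boundP (normr_ge0 _)).
exists m%:R; first by rewrite (le_trans _ (ltW mT))// le_max lexx.
have /TE mi : T0 < m%:R by rewrite (lt_trans _ mT)// lt_max ltrDl ltr01 orbT.
rewrite big_map big_enum /=.
set u := \sum_i _; pose v := \sum_i op_tensor K (b m i) (U i).
have uv : rnorm (v - u) <= r.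
  rewrite rnormB /u /v -sumrB (le_trans (rnorm_sum _ _ _))//.
  apply: (@le_trans _ _ (\sum_(i < n) r / n.+1%:R)); last first.
    rewrite sumr_const card_ord -[leLHS]mulr_natl mulrCA ler_piMr ?(ltW r0)//.
    by rewrite ler_pdivrMr// mul1r ler_nat.
  apply: ler_sum => i _; rewrite (gensE U i) -op_tensorBl bop_rnormE.
  rewrite (le_trans (opnorm_tensor _ _ _))// -!bop_rnormE.
  have U1 : rnorm (U i) <= 1.
    have UU : rnorm (U i) ^+ 2 <= 1.
      by rewrite -rnorm_cstar U_star U_sq bop_rnormE; apply: opnorm_le => // w; rewrite mul1r.
    by rewrite -(ler_sqr) ?nnegrE ?rnorm_ge0// expr1n.
  rewrite (@le_trans _ _ (rnorm (evaluate m%:R (a i) - b m i)))//.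
    by rewrite ler_piMr ?rnorm_ge0.
  by have := ltW (mi i); rewrite /= interp_nat.
have := bc m; rewrite -/v; have : rnorm v <= rnorm (v - u) + rnorm u.
  by rewrite -{1}(subrK u v) rnormD.
lra.
Qed.

Lemma limit_norms_neq (c : R) : kappa < c ->
  (forall (K : hilbertTensor H H) m, c <= rnorm (\sum_i op_tensor K (b m i) (U i))) ->
  [/\ separable A, separable D, lambda_norm A D <> min_norm A D
    & sigma_norm A D <> min_norm A D].
Proof.
move=> kc bc; pose K := @ell2_hilbertTensor R (V * nat)%type (V * nat)%type.
have sepH := @ell2_separable R (V * nat)%type.
have ge (N : A ⊙ D -> \bar R) : (c%:E <= N limit_tensor)%E -> N <> min_norm A D.
  move=> cN NE; move: cN; rewrite NE => /le_trans/(_ min_limit_le).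
  by rewrite lee_fin leNgt kc.
split; [exact: calg_separable|exact: calg_separable| |].
- apply: ge; apply: le_trans (evaluate_limit_ge (bc K)) _.
  apply: ereal_sup_ubound; exists H, H, K, evaluate, (@calg_val _ _ (gens U)).
  by split; [exact: sepH|exact: sepH|exact: evaluate_asymptotic|exact: calg_val_hom|].
- apply: ge; apply: le_trans (evaluate_limit_ge (bc K)) _.
  apply: ereal_sup_ubound; exists H, H, K, evaluate, (fun=> @calg_val _ _ (gens U)).
  split; [exact: sepH|exact: sepH|exact: evaluate_asymptotic| |by []].
  by apply: star_hom_asymptotic; exact: calg_val_hom.
Qed.

End asymptotic_example.

(** * Rational test matrices *)

Section rational_tests.
Context {R : realType} {n : nat}.

(** A test is a size with a family of square matrices, given by rational entries. *)
Definition test := (nat * seq (seq (seq (rat * rat))))%type.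

Definition coeffs (c : test) (i : 'I_n) (l j : nat) : R[i] :=
  ratc (nth (0, 0) (nth [::] (nth [::] c.2 i) l) j).

Lemma coeffs_dense k (t : 'I_n -> nat -> nat -> R[i]) (eps : R) : 0 < eps ->
  exists s, forall i l j, (l < k)%N -> (j < k)%N ->
    Normc.normc (t i l j - coeffs (k, s) i l j) < eps.
Proof.
move=> eps0; have [q qt] := choice (fun ilj : 'I_n * nat * nat => ratc_dense (t ilj.1.1 ilj.1.2 ilj.2) eps0).
exists [seq [seq [seq q (i, l, j) | j <- iota 0 k] | l <- iota 0 k] | i <- enum 'I_n].
move=> i l j lk jk; rewrite /coeffs (nth_map i) ?size_enum_ord// nth_ord_enum.
by rewrite (nth_map 0%N) ?size_iota// (nth_map 0%N) ?size_iota// !nth_iota//; exact: (qt (i, l, j)).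
Qed.

Lemma square_sum_le (B : normedModType R[i]) k (c : nat -> nat -> R[i]) (w : nat -> nat -> B) (eps : R) :
  0 <= eps -> (forall l j, (l < k)%N -> (j < k)%N -> Normc.normc (c l j) <= eps) ->
  (forall l j, rnorm (w l j) <= 1) ->
  rnorm (\sum_(l < k) \sum_(j < k) c l j *: w l j) <= k%:R * k%:R * eps.
Proof.
move=> eps0 cl w1; rewrite (le_trans (rnorm_sum _ _ _))//.
apply: (@le_trans _ _ (\sum_(l < k) \sum_(j < k) eps)); last first.
  by rewrite !sumr_const card_ord -[leLHS]mulr_natl -[X in _ * X]mulr_natl mulrA.
apply: ler_sum => l _; rewrite (le_trans (rnorm_sum _ _ _))//; apply: ler_sum => j _.
by rewrite rnormZ -[leRHS]mulr1 ler_pM ?rnorm_ge0 ?normc_ge0 ?cl.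
Qed.

Lemma rnorm_le_dist (B : normedModType R[i]) (x y : B) : rnorm x <= rnorm (y - x) + rnorm y.
Proof. by rewrite rnormB -{1}(subrK y x) rnormD. Qed.

Section levels.
Context {V : choiceType}.
Local Notation H := (ell2 R (V * nat)%type).

Lemma level_mx_close k (c c' : nat -> nat -> R[i]) (eps : R) : 0 <= eps ->
  (forall l j, (l < k)%N -> (j < k)%N -> Normc.normc (c l j - c' l j) <= eps) ->
  rnorm (level_mx k c - level_mx k c' : bop H) <= k%:R * k%:R * eps.
Proof.
move=> eps0 cc'.
have -> : level_mx k c - level_mx k c' =
    \sum_(l < k) \sum_(j < k) (c l j - c' l j) *: amul (pe l) (astar (pe j)) :> bop H.
  rewrite -sumrB; apply: eq_bigr => l _; rewrite -sumrB; apply: eq_bigr => j _.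
  by rewrite scalerBl.
apply: (square_sum_le (w := fun l j => amul (pe l) (astar (pe j))) eps0 cc') => l j.
by apply: rnormM_le1; rewrite ?rnorm_star; apply: rnorm_bop_le1; exact: pe_le.
Qed.

Lemma ampl_close k (b : 'I_n -> bop H) (t t' : 'I_n -> nat -> nat -> R[i]) (eps : R) : 0 <= eps ->
  (forall i, rnorm (b i) <= 1) ->
  (forall i l j, (l < k)%N -> (j < k)%N -> Normc.normc (t i l j - t' i l j) <= eps) ->
  rnorm (ampl (@pe R V) b k t - ampl (@pe R V) b k t') <= n%:R * (k%:R * k%:R * eps).
Proof.
move=> eps0 b1 tt'; rewrite -sumrB (le_trans (rnorm_sum _ _ _))//.
rewrite [leRHS](_ : _ = \sum_(i < n) k%:R * k%:R * eps); last first.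
  by rewrite sumr_const card_ord mulr_natl.
apply: ler_sum => i _; rewrite -sumrB; under eq_bigr => l _ do rewrite -sumrB.
under eq_bigr => l _ do under eq_bigr => j _ do rewrite -scalerBl.
apply: (square_sum_le (w := fun l j => amul (pe l) (amul (b i) (astar (pe j)))) eps0 (tt' i)) => l j.
apply: rnormM_le1; first by apply: rnorm_bop_le1; exact: pe_le.
apply: rnormM_le1; first exact: b1.
by rewrite rnorm_star; apply: rnorm_bop_le1; exact: pe_le.
Qed.

End levels.

Local Notation V := (@vertex n).
Local Notation H := (ell2 R (V * nat)%type).

Definition admissible (c : test) :=
  `[< forall i, rnorm (level_mx c.1 (coeffs c i) : bop H) <= 2 >].

(** Inadmissible codes are replaced by the empty test, so that all tests satisfy the
    bound. *)
Definition nth_test (j : nat) : test :=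
  if choice.unpickle j is Some c then if admissible c then c else (0%N, [::]) else (0%N, [::]).

Lemma nth_test_le j i : rnorm (level_mx (nth_test j).1 (coeffs (nth_test j) i) : bop H) <= 2.
Proof.
have zero : rnorm (level_mx (0%N, [::] : seq (seq (seq (rat * rat)))).1 (coeffs (0%N, [::]) i) : bop H) <= 2.
  by rewrite /level_mx big_ord0 rnorm0.
rewrite /nth_test; case: (choice.unpickle j) => [c|]; last exact: zero.
by case: ifP => [/asboolP c2|_]; [exact: c2|exact: zero].
Qed.

(** Rational tests suffice at infinity: a contractive family of matrices is close to
    an admissible rational one. *)
Lemma rational_test k (t : 'I_n -> nat -> nat -> R[i]) : contractive_coeffs k t ->
  exists j, forall b : 'I_n -> bop H, (forall i, rnorm (b i) <= 1) ->
  rnorm (ampl (@pe R V) b k t) <=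
  rnorm (ampl (@pe R V) b (nth_test j).1 (coeffs (nth_test j))) + 1.
Proof.
move=> tk; pose eps : R := (n.+1%:R * (k%:R * k%:R) + 1)^-1.
have N0 : 0 <= n.+1%:R * (k%:R * k%:R) :> R by rewrite !mulr_ge0.
have eps0 : 0 < eps by rewrite invr_gt0 ltr_wpDl.
have Ne : n.+1%:R * (k%:R * k%:R) * eps <= 1.
  by rewrite /eps ler_pdivrMr ?ltr_wpDl// mul1r lerDl.
have small m : (m <= n.+1)%N -> m%:R * (k%:R * k%:R * eps) <= 1.
  move=> mn; rewrite mulrA; apply: le_trans Ne; rewrite ler_wpM2r ?(ltW eps0)//.
  by rewrite ler_wpM2r ?mulr_ge0// ler_nat.
have [s st] := coeffs_dense k t eps0.
have {}st i l j lk jk := ltW (st i l j lk jk).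
have adm : admissible (k, s).
  apply/asboolP => i; rewrite -[leRHS](natrD _ 1 1).
  apply: le_trans (rnorm_le_dist _ (level_mx k (t i))) _; apply: (@lerD R).
    apply: le_trans (level_mx_close (ltW eps0) (st i)) _.
    by have := small 1%N isT; rewrite mul1r.
  by rewrite bop_rnormE; apply: opnorm_le => // w; exact: contractive_level_mx.
exists (choice.pickle ((k, s) : test)) => b b1; rewrite /nth_test choice.pickleK adm.
rewrite addrC; apply: le_trans (rnorm_le_dist _ (ampl (@pe R V) b k (coeffs (k, s)))) _.
rewrite lerD2r rnormB (le_trans (ampl_close (ltW eps0) b1 st))//.
exact: small (leqnSn _).
Qed.

End rational_tests.

Lemma vertex_norms_neq (R : realType) n : (0 < n)%N ->
  Num.sqrt (2 * (4 * n%:R * 2 ^+ 2)) + 1 < n%:R / 3 :> R ->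
  exists A D : cstarAlgebra R, [/\ separable A, separable D,
    lambda_norm A D <> min_norm A D & sigma_norm A D <> min_norm A D].
Proof.
move=> n0 n_large; pose T j := nth_test (R := R) (n := n) j.
have [b bP] := choice (fun m => damped_stage (ks := fun j => (T j).1)
  (ts := fun j => coeffs (T j)) m n0 (ltr0n R 2) (@nth_test_le R n)).
have b1 m i : rnorm (b m i) <= 1 by have [_ b1 _ _] := bP m; exact: b1.
have pe_b m i : amul (pe 0) (b m i) = b m i by have [/(_ i)[]] := bP m.
have b_pe m i : amul (b m i) (pe 0) = b m i by have [/(_ i)[]] := bP m.
have b_ampl k t : contractive_coeffs k t -> exists m0, forall m, (m0 <= m)%N ->
    rnorm (ampl (@pe R (@vertex n)) (b m) k t) <= Num.sqrt (2 * (4 * n%:R * 2 ^+ 2)) + 1.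
  move=> /rational_test[j jt]; exists j.+1 => m jm; rewrite (le_trans (jt _ (b1 m)))//.
  by have [_ _ + _] := bP m; move=> /(_ j jm); rewrite -(lerD2r 1).
pose U : 'I_n -> bop (ell2 R (@vertex n * nat)%type) := shift_op (@vertex_stepK n).
have Us i : astar (U i) = U i by exact: shift_star.
have UU i : amul (U i) (U i) = bop_id _ by exact: shift_sq.
have bc (K : hilbertTensor (ell2 R (@vertex n * nat)%type) _) m :
    n%:R / 3 <= rnorm (\sum_i op_tensor K (b m i) (U i)) by have [_ _ _ +] := bP m; exact.
by do 2!eexists; exact: (limit_norms_neq pe_b b_pe b1 b_ampl Us UU n_large bc).
Qed.

Theorem theorem3p4 (R : realType) :
  (exists A D : cstarAlgebra R,
     [/\ separable A, separable D & lambda_norm A D <> min_norm A D]) /\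
  (exists A D : cstarAlgebra R,
     [/\ separable A, separable D & lambda_norm A D <> max_norm A D]) /\
  (exists A D : cstarAlgebra R,
     [/\ separable A, separable D & sigma_norm A D <> min_norm A D]).
Proof.
have [|A [D [sA sD lambda_min sigma_min]]] := @vertex_norms_neq R 400 isT.
  (* 114 ^ 2 = 12996 exceeds 2 * 4 * 400 * 4 = 12800, and 115 < 400 / 3. *)
  apply: (@le_lt_trans _ _ (114 + 1)); last by lra.
  rewrite lerD2r -[leRHS]ger0_norm// -sqrtr_sqr ler_wsqrtr//; lra.
by split; [exists A, D|split; [exact: lambda_neq_max|exists A, D]].
Qed.
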